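(* Let $m\ge 1$ be an integer and $p\in[0,1]$ with $pm>1$. Then the Watts-Strogatz model with parameters $m$ and $p$ is strongly idemetric.
   Context: Watts-Strogatz model: for each $n$, start with nodes $0,\dots,n-1$ arranged in a circle, with an edge between distinct nodes $i,j$ iff their cyclic distance is at most $m$ (i.e. $|i-j|\le m \bmod n$). Then for every node $i$ and every edge $(i,j)$ with $0<(j-i)\bmod n\le m$, independently with probability $p$ the edge is rewired: it is replaced by an edge $(i,k)$ where $k$ is chosen uniformly at random from all values that avoid self-loops and multi-edges. The resulting undirected graph is $G_n$; $m,p$ are fixed as $n\to\infty$. $d(u,v)$ is graph distance ($\infty$ if no path). Strongly idemetric: there exist a finite-valued function $f$ and, for each $\epsilon>0$, a bound $b_\epsilon$ independent of $n$, such that for all sufficiently large $n$, if $u,v$ are chosen uniformly at random from $G_n$ then $|f(n)-d(u,v)|<b_\epsilon$ with probability $>1-\epsilon$. *)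

(* Defs.v *)
From HB Require Import structures.
From mathcomp Require Import all_boot all_order all_algebra.
From mathcomp Require Import reals.
Set Implicit Arguments. Unset Strict Implicit. Unset Printing Implicit Defensive.
Import Order.TTheory GRing.Theory Num.Theory.
Local Open Scope ring_scope.

(* Simple graphs on vertex set {0,...,n-1}: a set of ordered pairs,
   kept symmetric (every undirected edge {x,y} is stored as (x,y) and (y,x)). *)
Definition graph (n : nat) := {set 'I_n * 'I_n}.

Definition add_edge n (G : graph n) (x y : 'I_n) : graph n := G :|: [set (x, y); (y, x)].
Definition rem_edge n (G : graph n) (x y : 'I_n) : graph n := G :\: [set (x, y); (y, x)].

Definition cshift n (d : nat) (x : 'I_n) : 'I_n := iter d (@ordS n) x.

Definition ring_lattice (n m : nat) : graph n :=
  [set e : 'I_n * 'I_n | (e.1 != e.2) &&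
     ((((e.2 + n - e.1) %% n)%N <= m)%N || (((e.1 + n - e.2) %% n)%N <= m)%N)].

Definition fdist (R : realType) (T : finType) := T -> R.
Definition dirac (R : realType) (T : finType) (x : T) : fdist R T :=
  fun y => (y == x)%:R.
Definition fbind (R : realType) (T U : finType) (mu : fdist R T) (k : T -> fdist R U)
  : fdist R U := fun y => \sum_(x : T) mu x * k x y.

Definition rewire_step (R : realType) (p : R) n (u v : 'I_n) (G : graph n)
  : fdist R (graph n) :=
  if (u, v) \in G then
    let C := [set w : 'I_n | (w != u) && ((u, w) \notin G)] in
    if C == set0 then dirac R G else
    fun H => (1 - p) * (H == G)%:R +
             p * ((\sum_(w in C) (H == add_edge (rem_edge G u v) u w)%:R) / #|C|%:R)
  else dirac R G.

(* Edges to be processed, in order: for each offset d = 1..min(m, n-1)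
   (outer loop) and each node u = 0..n-1 (inner loop), the edge (u, u+d mod n). *)
Definition WS_schedule (n m : nat) : seq (nat * 'I_n) :=
  [seq (d, u) | d <- iota 1 (minn m n.-1), u <- enum 'I_n].

Definition WS_law (R : realType) (m : nat) (p : R) (n : nat) : fdist R (graph n) :=
  foldl (fun mu du => fbind mu (rewire_step p du.2 (cshift du.1 du.2)))
        (dirac R (ring_lattice n m)) (WS_schedule n m).

Fixpoint ball n (G : graph n) (k : nat) (u : 'I_n) : {set 'I_n} :=
  if k is k'.+1 then
    ball G k' u :|: [set y | [exists x in ball G k' u, (x, y) \in G]]
  else [set u].

(* Graph distance: Some d if v is reachable from u (a shortest walk has length
   d < n), None (= infinity) otherwise. *)
Definition gdist n (G : graph n) (u v : 'I_n) : option nat :=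
  let k := find (fun k => v \in ball G k u) (iota 0 n) in
  if (k < n)%N then Some k else None.

Definition prob_close (R : realType) (law : forall n, fdist R (graph n))
  (f : nat -> R) (b : R) (n : nat) : R :=
  \sum_(G : graph n) law n G *
    (#|[set uv : 'I_n * 'I_n |
         if gdist G uv.1 uv.2 is Some d then `|f n - d%:R| < b else false]|%:R
     / (n * n)%:R).

Definition strongly_idemetric (R : realType) (law : forall n, fdist R (graph n)) : Prop :=
  exists f : nat -> R, forall eps : R, 0 < eps ->
    exists b : R, exists N : nat, forall n : nat, (N <= n)%N ->
      prob_close law f b n > 1 - eps.

(* Main.v *)
(** The sequential rewiring is compared with an independent model in which every
    slot (d, x), with edge {x, x + d + 1} at the start, is redrawn uniformly over all
    vertices with probability p.  As long as no vertex has degree n/2, the conditional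
    law of each redrawn endpoint has density at most 1 + O(deg / n) with respect to
    the uniform one; the degrees sum to O(n), so the whole density is bounded and
    events that are rare in the independent model are rare in the Watts-Strogatz
    model.

    In the independent model, explore the balls of u and v up to about s = sqrt (n/D)
    vertices.  Because pm > 1, a ball is entered from outside at a rate that makes
    frontiers grow geometrically; so the frontier is of order s once s vertices are
    reached, and two such frontiers are connected by boundedly many further steps.
    By translation invariance the explorations of two random vertices rarely
    interfere, so the number of vertices whose r-ball has at least s elements is
    concentrated, and it is of order n as soon as a positive proportion of the pairs
    is within distance 2r.  Hence in that case a positive proportion of the pairs is
    connected within 2r + b with high probability.  Finally the orbit of v along a
    fixed slot supplies L vertices each of which sends another slot into a given
    linear-size ball with probability bounded below, and increasing the distance by L
    turns a positive proportion of the pairs into almost all of them.  So for every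
    e > 0 the proportion of pairs within distance k passes from e to 1 - e in a
    bounded window, which is located at the median distance. *)

(* No growth rate or limiting distance is computed: it suffices that the density of close pairs
   crosses any intermediate range quickly. The obstacle is that an exploration conditions the slots
   it has not revealed. The information kept is therefore only the values of the slots at discovered
   vertices and a set avoided by all other slots. Every conditioning event is then a product set,
   unrevealed slots remain exactly independent, and Chebyshev's inequality applies on each such
   event. Growth is counted along incoming edges, since a small frontier T receives on average about
   p m |T| or more redrawn slots from outside. The parameter D balances two errors: explorations of
   size s interfere with probability of order s^2/n, that is 1/D, whereas joining two frontiers of
   order s requires one of them to grow by a factor of order D, which takes a number of steps
   logarithmic in D. Neither depends on n. As p <= 1, the condition pm > 1 gives m >= 2, hence two
   distinct slot indices: a vertex outside both explorations can send one to each side, and an orbit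
   along one index leaves the other index fresh. *)
Require Import Defs.
From HB Require Import structures.
From mathcomp Require Import all_boot all_order all_algebra.
From mathcomp Require Import reals.
From mathcomp Require Import archimedean sequences exp.
From mathcomp Require Import ring lra zify.
Set Implicit Arguments. Unset Strict Implicit. Unset Printing Implicit Defensive.
Import Order.TTheory GRing.Theory Num.Theory.
Local Open Scope ring_scope.

(** * Product measures *)

Section ProductMeasure.
Variables (R : realType) (J S : finType) (q : J -> S -> R).
Hypothesis q_ge0 : forall e y, 0 <= q e y.
Hypothesis q_sum1 : forall e, \sum_y q e y = 1.
Local Notation Om := {ffun J -> S}.

Definition mass (w : Om) : R := \prod_e q e (w e).
Definition Ex (F : Om -> R) : R := \sum_w mass w * F w.
Definition Pr (E : pred Om) : R := Ex (fun w => (E w)%:R).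
(** Membership in a product set of configurations; conditioning on such an event keeps the
    coordinates independent. *)
Definition inr (rho : {ffun J -> {set S}}) : pred Om := fun w => [forall e, w e \in rho e].
Definition qs (e : J) (B : {set S}) : R := \sum_(y in B) q e y.

Implicit Types (E : pred Om) (F G : Om -> R).

Lemma mass_ge0 w : 0 <= mass w.
Proof. by apply: prodr_ge0 => e _; apply: q_ge0. Qed.

Lemma Pr_rect rho : Pr (inr rho) = \prod_e qs e (rho e).
Proof.
rewrite /qs bigA_distr_big_dep /= /Pr /Ex [RHS]big_mkcond /=.
apply: eq_bigr => w _; rewrite /mass /inr.
have -> : (w \in family (fun e => mem (rho e))) = [forall e, w e \in rho e] by [].
by case: ifP => _; rewrite ?mulr1 ?mulr0.
Qed.

Lemma Ex_le F G : (forall w, F w <= G w) -> Ex F <= Ex G.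
Proof. by move=> FG; apply: ler_sum => w _; rewrite ler_wpM2l ?mass_ge0. Qed.

Lemma Ex_eq F G : F =1 G -> Ex F = Ex G.
Proof. by move=> FG; apply: eq_bigr => w _; rewrite FG. Qed.

Lemma ExD F G : Ex (fun w => F w + G w) = Ex F + Ex G.
Proof. by rewrite /Ex -big_split; apply: eq_bigr => w _; rewrite mulrDr. Qed.

Lemma ExZ c F : Ex (fun w => c * F w) = c * Ex F.
Proof. by rewrite /Ex mulr_sumr; apply: eq_bigr => w _; rewrite mulrCA. Qed.

Lemma ExZr c F : Ex (fun w => F w * c) = Ex F * c.
Proof. by rewrite mulrC -ExZ; apply: Ex_eq => w; rewrite mulrC. Qed.

Lemma Ex_sum (T : finType) (P : pred T) (F : T -> Om -> R) :
  Ex (fun w => \sum_(i | P i) F i w) = \sum_(i | P i) Ex (F i).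
Proof.
rewrite /Ex exchange_big; apply: eq_bigr => w _; by rewrite mulr_sumr.
Qed.

Lemma Ex1 : Ex (fun=> 1) = 1.
Proof.
have := Pr_rect [ffun=> setT]; rewrite (eq_bigr (fun=> 1)) => [|e _]; last first.
  by rewrite /qs ffunE big_mkcond /= -[RHS](q_sum1 e); apply: eq_bigr => y _; rewrite inE.
rewrite big1 // => E; rewrite -[RHS]E; apply: Ex_eq => w; rewrite /inr.
suff -> : [forall e, w e \in [ffun=> [set: S]] e] by [].
by apply/forallP => e; rewrite ffunE inE.
Qed.

Lemma Ex_cst c : Ex (fun=> c) = c.
Proof. by rewrite -[in LHS](mulr1 c) ExZ Ex1 mulr1. Qed.

Lemma Ex_ge0 F : (forall w, 0 <= F w) -> 0 <= Ex F.
Proof. by move=> F0; apply: sumr_ge0 => w _; rewrite mulr_ge0 ?mass_ge0. Qed.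

Lemma Pr_ge0 E : 0 <= Pr E.
Proof. by apply: Ex_ge0 => w. Qed.

Lemma Pr_le E E' : (forall w, E w -> E' w) -> Pr E <= Pr E'.
Proof.
move=> EE; apply: Ex_le => w; rewrite ler_nat.
by have := EE w; case: (E w) => [->|].
Qed.

Lemma Pr_le1 E : Pr E <= 1.
Proof. by rewrite -Ex1; apply: Ex_le => w; case: (E w). Qed.

Lemma Pr_eq E E' : E =1 E' -> Pr E = Pr E'.
Proof. by move=> EE; apply: Ex_eq => w; rewrite EE. Qed.

Lemma Pr_predC E : Pr (predC E) = 1 - Pr E.
Proof.
apply/eqP; rewrite eq_sym subr_eq -Ex1 /Pr -ExD.
by apply/eqP/Ex_eq => w /=; case: (E w); rewrite ?addr0 ?add0r.
Qed.

Lemma Pr_union E E1 E2 : (forall w, E w -> E1 w || E2 w) -> Pr E <= Pr E1 + Pr E2.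
Proof.
move=> EE; rewrite /Pr -ExD; apply: Ex_le => w.
by rewrite -natrD ler_nat; have := EE w; case: (E w) => [/(_ isT)|_] //; case: (E1 w); case: (E2 w).
Qed.

Lemma Pr_union_sum (T : finType) (P : pred T) E (F : T -> pred Om) :
  (forall w, E w -> exists2 i, P i & F i w) -> Pr E <= \sum_(i | P i) Pr (F i).
Proof.
move=> EF; rewrite /Pr -Ex_sum; apply: Ex_le => w.
case Ew : (E w); last by apply: sumr_ge0.
have [i Pi Fi] := EF _ Ew.
by rewrite (bigD1 i) //= Fi lerDl sumr_ge0.
Qed.

Lemma Ex_swap (H : Om -> Om -> R) :
  Ex (fun w => Ex (H w)) = Ex (fun o => Ex (fun w => H w o)).
Proof.
rewrite /Ex (eq_bigr (fun w => \sum_o mass w * (mass o * H w o))) => [|w _]; last by rewrite mulr_sumr.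
by rewrite exchange_big; apply: eq_bigr => o _; rewrite mulr_sumr; apply: eq_bigr => w _; rewrite mulrCA.
Qed.

Lemma markov (F : Om -> R) a : 0 < a -> (forall w, 0 <= F w) ->
  Pr (fun w => a <= F w) <= Ex F / a.
Proof.
move=> a0 F0; rewrite ler_pdivlMr // -ExZr; apply: Ex_le => w.
by case: (leP a (F w)) => ?; rewrite ?mul1r ?mul0r.
Qed.

(** A finite sigma-algebra with product sets as atoms: [Rf w] is the atom that contains [w], the
    information revealed at [w]. *)
Definition partitioning (Rf : Om -> {ffun J -> {set S}}) :=
  (forall w, inr (Rf w) w) /\ (forall w w', inr (Rf w) w' -> Rf w' = Rf w).

(* The sets [inr (Rf w)] form a partition of the probability space, so that an
   inequality on each block may be summed over all of them. *)
Lemma Ex_blocks Rf F G : partitioning Rf ->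
  (forall w, Ex (fun w' => (inr (Rf w) w')%:R * F w') <=
             Ex (fun w' => (inr (Rf w) w')%:R * G w')) ->
  Ex F <= Ex G.
Proof.
move=> [Rw RR] H; rewrite /Ex (partition_big Rf xpredT) //= [leRHS](partition_big Rf xpredT) //=.
apply: ler_sum => rho _.
case: (pickP (fun w => Rf w == rho)) => [w /eqP Ew|no]; last by rewrite !big_pred0.
have eqr : forall w', (Rf w' == rho) = inr (Rf w) w'.
  move=> w'; apply/eqP/idP => [|/RR ->//]; rewrite Ew => <-; exact: Rw.
have := H w; rewrite /Ex.
rewrite [X in X <= _ -> _](bigID (fun w' => Rf w' == rho)) /=.
rewrite [X in _ + X]big1 => [|w']; last by rewrite eqr => /negbTE ->; rewrite mul0r mulr0.
rewrite [X in _ <= X -> _](bigID (fun w' => Rf w' == rho)) /=.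
rewrite [X in _ <= _ + X -> _]big1 => [|w']; last by rewrite eqr => /negbTE ->; rewrite mul0r mulr0.
rewrite !addr0 (eq_bigr (fun w => mass w * F w)); last by move=> w'; rewrite eqr => ->; rewrite mul1r.
by rewrite [leRHS](eq_bigr (fun w => mass w * G w)) // => w'; rewrite eqr => ->; rewrite mul1r.
Qed.

(** Integrates a conditional bound that is known only on the atoms inside [G]; the other atoms
    contribute nothing since [E] implies [G]. *)
Lemma Pr_blocks Rf (E G : pred Om) c : partitioning Rf ->
  (forall w w', inr (Rf w) w' -> G w' = G w) -> (forall w, E w -> G w) ->
  (forall w, G w -> Pr (fun w' => inr (Rf w) w' && E w') <= c * Pr (inr (Rf w))) ->
  Pr E <= c * Pr G.
Proof.
move=> Rp GR EG H; rewrite /Pr -ExZ.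
apply: (Ex_blocks Rp) => w.
have -> : Ex (fun w' => (inr (Rf w) w')%:R * (E w')%:R) = Pr (fun w' => inr (Rf w) w' && E w').
  by apply: Ex_eq => w'; rewrite -natrM mulnb.
case Gw : (G w); last first.
  rewrite /Pr /Ex !big1 // => w' _; case Ew' : (inr _ _); rewrite ?mul0r ?mulr0 //=.
    by rewrite (GR w w' Ew') Gw !mulr0.
  by rewrite (contraFF (@EG w')) ?mulr0 // (GR w w' Ew').
apply: le_trans (H w Gw) _; rewrite /Pr -ExZ; apply: Ex_le => w'.
case Ew' : (inr _ _); rewrite ?mul0r ?mulr0 //= (GR w w' Ew') Gw.
by rewrite !mulr1 mul1r.
Qed.

(* Chebyshev's inequality on a block of measure [M], the events [H x] being
   pairwise independent for the normalized restricted measure. *)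
Lemma chebyshev_block (X : finType) (A : {set X}) (H : X -> pred Om) (rho : pred Om) (mean a : R) :
  (forall x y, x \in A -> y \in A -> x != y ->
     Pr (fun w => [&& rho w, H x w & H y w]) * Pr rho =
     Pr (fun w => rho w && H x w) * Pr (fun w => rho w && H y w)) ->
  \sum_(x in A) Pr (fun w => rho w && H x w) = mean * Pr rho ->
  0 < a ->
  Pr (fun w => rho w && (a <= `|\sum_(x in A) (H x w)%:R - mean|)) <=
  mean / a ^+ 2 * Pr rho.
Proof.
move=> ind meanE a0.
have [r0|rn0] := eqVneq (Pr rho) 0.
  rewrite r0 mulr0; have <- : Pr rho = 0 by [].
  by apply: Pr_le => w /andP[].
have rp : 0 < Pr rho by rewrite lt_neqAle eq_sym rn0 Pr_ge0.
set X1 := fun w : Om => \sum_(x in A) (H x w)%:R : R.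
rewrite mulrAC ler_pdivlMr ?exprn_gt0 //.
apply: (@le_trans _ _ (Ex (fun w => (rho w)%:R * (X1 w - mean) ^+ 2))).
  rewrite /Pr -ExZr; apply: Ex_le => w.
  case: (rho w); rewrite ?mul0r //= mul1r.
  case: (leP a _) => [h|_] /=; last by rewrite mul0r sqr_ge0.
  rewrite mul1r -[leRHS]real_normK ?num_real //.
  by apply: lerXn2r; rewrite ?nnegrE ?(ltW a0) ?normr_ge0.
have E1 : Ex (fun w => (rho w)%:R * X1 w) = mean * Pr rho.
  rewrite -meanE -Ex_sum; apply: Ex_eq => w; rewrite /X1 mulr_sumr.
  by apply: eq_bigr => x _; rewrite -natrM mulnb.
have E2 : Ex (fun w => (rho w)%:R * X1 w ^+ 2) * Pr rho <=
          mean * Pr rho * Pr rho + (mean * Pr rho) ^+ 2.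
  have -> : Ex (fun w => (rho w)%:R * X1 w ^+ 2) =
     \sum_(x in A) \sum_(y in A) Pr (fun w => [&& rho w, H x w & H y w]).
    rewrite -[RHS](eq_bigr _ (fun x _ => Ex_sum _ _)) -Ex_sum; apply: Ex_eq => w.
    rewrite /X1 expr2 mulr_suml mulr_sumr; apply: eq_bigr => x _.
    rewrite mulr_sumr mulr_sumr; apply: eq_bigr => y _.
    by case: (rho w); case: (H x w); case: (H y w); rewrite ?mul0r ?mulr0 ?mulr1 //.
  rewrite -meanE expr2 mulr_suml [X in _ <= _ + X]mulr_suml mulr_suml -big_split /=.
  apply: ler_sum => x xA; rewrite mulr_suml (bigD1 x) //=; apply: lerD.
    by rewrite ler_wpM2r ?Pr_ge0 //; apply: Pr_le => w /and3P[-> ->].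
  rewrite mulr_sumr [leRHS](bigD1 x) //= -[leLHS]add0r; apply: lerD.
    by rewrite mulr_ge0 ?Pr_ge0.
  apply: ler_sum => y /andP[yA yx]; rewrite ind //; by rewrite eq_sym.
have -> : Ex (fun w => (rho w)%:R * (X1 w - mean) ^+ 2) =
   Ex (fun w => (rho w)%:R * X1 w ^+ 2) - mean ^+ 2 * Pr rho.
  have -> : Ex (fun w => (rho w)%:R * (X1 w - mean) ^+ 2) =
     Ex (fun w => (rho w)%:R * X1 w ^+ 2 + (- (2 * mean) * ((rho w)%:R * X1 w) + mean ^+ 2 * (rho w)%:R)).
    by apply: Ex_eq => w; ring.
  rewrite !ExD !ExZ E1 -/(Pr rho); ring.
rewrite -(ler_pM2r rp) mulrBl.
apply: le_trans (lerB E2 (lexx _)) _.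
by rewrite le_eqVlt; apply/orP; left; apply/eqP; ring.
Qed.

End ProductMeasure.

(** * Product sets and conditional independence of coordinates *)

Section Rectangles.
Variables (R : realType) (J S : finType) (q : J -> S -> R).
Hypothesis q_ge0 : forall e y, 0 <= q e y.
Local Notation Om := {ffun J -> S}.
Local Notation rectangle := {ffun J -> {set S}}.
Implicit Types (rho K : rectangle).

Definition recI rho K : rectangle := [ffun e => rho e :&: K e].

Lemma inr_recI rho K w : inr (recI rho K) w = inr rho w && inr K w.
Proof.
apply/forallP/andP => [H|[/forallP H1 /forallP H2] e]; last by rewrite ffunE inE H1 H2.
by split; apply/forallP => e; have := H e; rewrite ffunE inE => /andP[].
Qed.

Lemma qs_ge0 e B : 0 <= qs q e B.
Proof. by apply: sumr_ge0 => y _; apply: q_ge0. Qed.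

Lemma qs_disjoint e (B C : {set S}) : [disjoint B & C] -> qs q e (B :|: C) = qs q e B + qs q e C.
Proof. by move=> BC; rewrite /qs -bigU //=; apply: eq_bigl => y; rewrite !inE. Qed.

(** [K] and [K'] constrain disjoint sets of coordinates, so the identity holds factor by factor.
    Clearing denominators also covers null rectangles. *)
Lemma Pr_rect_indep rho K K' :
  (forall e, (K e == setT) || (K' e == setT)) ->
  Pr q (fun w => [&& inr rho w, inr K w & inr K' w]) * Pr q (inr rho) =
  Pr q (fun w => inr rho w && inr K w) * Pr q (fun w => inr rho w && inr K' w).
Proof.
move=> KK.
rewrite (Pr_eq q (E' := inr (recI (recI rho K) K'))) => [|w]; last by rewrite !inr_recI andbA.
rewrite (Pr_eq q (E' := inr (recI rho K)) (E := fun w => inr rho w && inr K w)) => [|w];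
  last by rewrite !inr_recI.
rewrite (Pr_eq q (E' := inr (recI rho K')) (E := fun w => inr rho w && inr K' w)) => [|w];
  last by rewrite !inr_recI.
rewrite !Pr_rect -!big_split /=; apply: eq_bigr => e _; rewrite !ffunE.
by case/orP: (KK e) => /eqP ->; rewrite !setIT // mulrC.
Qed.

Lemma Pr_slot rho e (T : {set S}) :
  Pr q (fun w => inr rho w && (w e \in T)) * qs q e (rho e) =
  qs q e (rho e :&: T) * Pr q (inr rho).
Proof.
rewrite (Pr_eq q (E' := inr (recI rho [ffun e' => if e' == e then T else setT]))); last first.
  move=> w; rewrite inr_recI; congr andb; apply/idP/forallP => [wT e'|/(_ e)]; last by rewrite ffunE eqxx.
  by rewrite ffunE; case: eqP => [->|_]; rewrite ?inE.
rewrite !Pr_rect (bigD1 e) //= [in RHS](bigD1 e) //= !ffunE eqxx -mulrA; congr (_ * _).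
rewrite mulrC;  congr (_ * _); apply: eq_bigr => e' /negbTE ne.
by rewrite !ffunE ne setIT.
Qed.

End Rectangles.

(** * Explorations *)

Section Explorable.
Variables (n m : nat).
Local Notation V := 'I_n.+1.
Local Notation slot := ('I_m * V)%type.
Local Notation Om := {ffun slot -> V}.
Implicit Types (w : Om) (I A T Z : Om -> {set V}).

(* A configuration [w] records, for the slot [(d, x)], the current endpoint of the
   edge that initially joins [x] to [x + d + 1]. *)
Definition adj w (x y : V) := [exists d, w (d, x) == y] || [exists d, w (d, y) == x].
Definition Gr w : graph n.+1 := [set e | adj w e.1 e.2].
Definition nbr (G : graph n.+1) (T : {set V}) : {set V} :=
  [set y | [exists x in T, (x, y) \in G]].
(** [hit] leaves [T] backwards, through slots of undiscovered vertices, and [out] leaves it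
    forwards, through the slots of [T] itself. *)
Definition hit w (A T : {set V}) : {set V} := [set x | (x \notin A) && [exists d, w (d, x) \in T]].
Definition out w (T : {set V}) : {set V} := [set y | [exists e : slot, (e.2 \in T) && (w e == y)]].

Definition block I A w : {ffun slot -> {set V}} :=
  [ffun e => if e.2 \in A w then [set w e] else ~: I w].

(* A random exploration: [I] is the set of vertices all of whose incident edges
   have been revealed, [A] the set of discovered vertices, all of whose own slots
   count as revealed; about the other slots it is only known that they avoid [I]. *)
Definition explorable I A :=
  (forall w e, e.2 \notin A w -> w e \notin I w) /\
  (forall w w', inr (block I A w) w' -> I w' = I w /\ A w' = A w).

Definition measurable (X : Type) I A (f : Om -> X) :=
  forall w w', inr (block I A w) w' -> f w' = f w.

Lemma inr_blockP I A w w' :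
  reflect ((forall e, e.2 \in A w -> w' e = w e) /\ (forall e, e.2 \notin A w -> w' e \notin I w))
          (inr (block I A w) w').
Proof.
apply: (iffP forallP) => [H|[H1 H2] e].
  split=> e; have := H e; rewrite ffunE; first by case: ifP => // _; rewrite inE => /eqP.
  by case: ifP => // _; rewrite inE.
by rewrite ffunE; case: ifP => [/H1 ->|/negbT/H2]; rewrite inE.
Qed.

Lemma inr_block_self I A w : explorable I A -> inr (block I A w) w.
Proof. by move=> [e1 _]; apply/inr_blockP; split=> // e; apply: e1. Qed.

Lemma explorable_partitioning I A : explorable I A -> partitioning (block I A).
Proof.
move=> ex; have [e1 e2] := ex; split=> [w|w w' ww']; first exact: inr_block_self.
have [EI EA] := e2 _ _ ww'; have /inr_blockP[H _] := ww'.
by apply/ffunP => e; rewrite !ffunE EI EA; case: ifP => // /H ->.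
Qed.

Lemma measurableI I A : explorable I A -> measurable I A I.
Proof. by move=> [_ e2] w w' /e2[]. Qed.

Lemma measurableA I A : explorable I A -> measurable I A A.
Proof. by move=> [_ e2] w w' /e2[]. Qed.

Lemma measurable_out I A T : measurable I A T -> (forall w, T w \subset A w) ->
  measurable I A (fun w => out w (T w)).
Proof.
move=> mT TA w w' ww'; rewrite (mT _ _ ww'); have /inr_blockP[H _] := ww'.
apply/setP => y; rewrite !inE; apply: eq_existsb => e.
by case: (boolP (e.2 \in T w)) => //= eT; rewrite H // (subsetP (TA w)).
Qed.

(** Expanding [T] makes it interior. [Z] is an already determined set whose slots are revealed in
    addition: the forward endpoints in a breadth-first step, nothing in backward growth. *)
Definition stepI I T w := I w :|: T w.
Definition stepA A T Z w := A w :|: hit w (A w) (T w) :|: Z w.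

Lemma step_refine I A T Z w w' : explorable I A ->
  inr (block (stepI I T) (stepA A T Z) w) w' -> inr (block I A w) w'.
Proof.
move=> [e1 _] /inr_blockP[H1 H2]; apply/inr_blockP; split=> e eA.
  by apply: H1; rewrite !inE eA.
case: (boolP (e.2 \in stepA A T Z w)) => [/H1 ->|/H2]; first exact: e1.
by rewrite inE negb_or => /andP[].
Qed.

Lemma measurable_step (X : Type) I A T Z (f : Om -> X) : explorable I A -> measurable I A f ->
  measurable (stepI I T) (stepA A T Z) f.
Proof. by move=> ex mf w w' /(step_refine ex)/mf. Qed.

(** The slots of a vertex left outside the new [A] avoid the new interior, which already says that
    it does not hit [T]; so the set of hitting vertices is constant on the new atom. *)
Lemma measurable_hit I A T Z : explorable I A -> measurable I A T ->
  measurable (stepI I T) (stepA A T Z) (fun w => hit w (A w) (T w)).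
Proof.
move=> ex mT w w' ww'; have /(step_refine ex) ww := ww'.
rewrite (mT _ _ ww) (measurableA ex ww); have /inr_blockP[H1 H2] := ww'.
apply/setP => x; rewrite !inE; case: (boolP (x \in A w)) => //= xA.
case: (boolP (x \in stepA A T Z w)) => xA'.
  by apply: eq_existsb => d; rewrite H1.
have -> : [exists d, w (d, x) \in T w] = false.
  by move: xA'; rewrite !inE !negb_or xA /= => /andP[/negbTE].
by apply/existsP => -[d]; have := H2 (d, x) xA'; rewrite inE negb_or => /andP[_ /negbTE ->].
Qed.

Lemma explorable_step I A T Z : explorable I A -> measurable I A T -> measurable I A Z ->
  explorable (stepI I T) (stepA A T Z).
Proof.
move=> ex mT mZ; have [e1 e2] := ex; split=> [w e|w w' ww'].
  rewrite !inE !negb_or => /andP[/andP[eA eh] _]; rewrite e1 //=.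
  move: eh; rewrite eA /= negb_exists => /forallP/(_ e.1).
  by rewrite -surjective_pairing.
have /(step_refine ex) ww := ww'; have [EI EA] := e2 _ _ ww.
rewrite /stepI /stepA EI EA (mT _ _ ww) (mZ _ _ ww); split=> //.
have := measurable_hit ex mT ww'; rewrite EA (mT _ _ ww) => ->; by [].
Qed.

Lemma explorable_join I A I' A' : explorable I A -> explorable I' A' ->
  explorable (fun w => I w :|: I' w) (fun w => A w :|: A' w).
Proof.
move=> ex ex'; have [e1 e2] := ex; have [e1' e2'] := ex'.
split=> [w e|w w' /inr_blockP[H1 H2]].
  by rewrite !inE !negb_or => /andP[/e1 -> /e1' ->].
have [|-> ->] := e2 w w'.
  apply/inr_blockP; split=> e eA; first by rewrite H1 // inE eA.
  case: (boolP (e.2 \in A w :|: A' w)) => [/H1 ->|/H2]; first exact: e1.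
  by rewrite inE negb_or => /andP[].
have [|-> ->//] := e2' w w'.
apply/inr_blockP; split=> e eA; first by rewrite H1 // inE eA orbT.
case: (boolP (e.2 \in A w :|: A' w)) => [/H1 ->|/H2]; first exact: e1'.
by rewrite inE negb_or => /andP[].
Qed.

Lemma measurable_joinl (X : Type) I A I' A' (f : Om -> X) :
  explorable I A -> measurable I A f ->
  measurable (fun w => I w :|: I' w) (fun w => A w :|: A' w) f.
Proof.
move=> [e1 _] mf w w' /inr_blockP[H1 H2]; apply: mf; apply/inr_blockP; split=> e eA.
  by rewrite H1 // inE eA.
case: (boolP (e.2 \in A w :|: A' w)) => [/H1 ->|/H2]; first exact: e1.
by rewrite inE negb_or => /andP[].
Qed.

Lemma measurable_joinr (X : Type) I A I' A' (f : Om -> X) :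
  explorable I' A' -> measurable I' A' f ->
  measurable (fun w => I w :|: I' w) (fun w => A w :|: A' w) f.
Proof.
move=> ex mf w w' ww'; apply: (measurable_joinl (I' := I) (A' := A) ex mf).
have <- : block (fun w => I w :|: I' w) (fun w => A w :|: A' w) w =
  block (fun w => I' w :|: I w) (fun w => A' w :|: A w) w; last by [].
by apply/ffunP => e; rewrite !ffunE (setUC (A w)) (setUC (I w)).
Qed.

End Explorable.

Lemma iter_ordS_inj n k : injective (iter k (@ordS n)).
Proof. by elim: k => [|k IH] x y //= /ordS_inj/IH. Qed.

(** * Hitting estimates in the independent model *)

Section Slots.
Variables (R : realType) (n m : nat) (p : R).
Hypotheses (p0 : 0 < p) (p1 : p <= 1).
Local Notation V := 'I_n.+1.
Local Notation N := (n.+1%:R : R).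
Local Notation slot := ('I_m * V)%type.
Local Notation Om := {ffun slot -> V}.

Implicit Types (e : slot) (T I A W : {set V}) (w : Om).

Definition lat (e : slot) : V := cshift e.1.+1 e.2.
Definition q (e : slot) (y : V) : R := (1 - p) * (y == lat e)%:R + p / N.

Lemma N_gt0 : 0 < N. Proof. by rewrite ltr0n. Qed.

Lemma q_gt0 e y : 0 < q e y.
Proof. by rewrite ltr_wpDl ?divr_gt0 ?N_gt0 // mulr_ge0 ?subr_ge0. Qed.

Lemma q_ge0 e y : 0 <= q e y.
Proof. exact/ltW/q_gt0. Qed.

Lemma q_sum1 e : \sum_y q e y = 1.
Proof.
rewrite /q big_split /= sumr_const card_ord -mulr_sumr (bigD1 (lat e)) //= eqxx big1 => [|y /negbTE -> //].
by rewrite -[_ / _ *+ _]mulr_natr mulfVK ?gt_eqF ?N_gt0 //= addr0 mulr1 subrK.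
Qed.

Lemma lat_inj d : injective (fun x => lat (d, x)).
Proof. by move=> x y; apply: iter_ordS_inj. Qed.

(** For a fixed slot index [lat] is a bijection, so the endpoint law is doubly stochastic; this is
    why every vertex has mean in-degree [m]. *)
Lemma q_col d y : \sum_x q (d, x) y = 1.
Proof.
have [g gK Kg] : bijective (fun x => lat (d, x)) by apply/injF_bij/lat_inj.
rewrite /q big_split /= sumr_const card_ord -mulr_sumr (bigD1 (g y)) //= Kg eqxx big1 => [|x xg].
  by rewrite -[_ / _ *+ _]mulr_natr mulfVK ?gt_eqF ?N_gt0 //= addr0 mulr1 subrK.
by case: eqP => // yE; rewrite yE gK eqxx in xg.
Qed.

Lemma qs_sum T : \sum_e qs q e T = m%:R * #|T|%:R.
Proof.
rewrite /qs exchange_big /= (eq_bigr (fun=> m%:R)) ?sumr_const ?mulr_natr // => y _.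
rewrite -(pair_big xpredT xpredT (fun d x => q (d, x) y)) /= (eq_bigr (fun=> 1)) => [|d _]; last exact: q_col.
by rewrite sumr_const card_ord.
Qed.

Lemma qs_ge e T : p * #|T|%:R / N <= qs q e T.
Proof.
rewrite /qs /q big_split /= sumr_const -[X in _ + X]mulr_natr mulrAC.
by rewrite lerDr sumr_ge0 // => y _; rewrite mulr_ge0 ?subr_ge0.
Qed.

Lemma qs_eq e T : lat e \notin T -> qs q e T = p * #|T|%:R / N.
Proof.
move=> eT; rewrite /qs /q big_split /= sumr_const -[X in _ + X]mulr_natr mulrAC.
rewrite big1 ?add0r // => y yT; case: eqP => [E|_]; last by rewrite mulr0.
by rewrite -E yT in eT.
Qed.

Lemma qs_le1 e T : qs q e T <= 1.
Proof.
by rewrite -(q_sum1 e) /qs big_mkcond; apply: ler_sum => y _; case: ifP => // _; apply: q_ge0.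
Qed.

Lemma qs_setC e T : qs q e (~: T) = 1 - qs q e T.
Proof.
apply/eqP; rewrite eq_sym subr_eq -(q_sum1 e) /qs [X in X == _](bigID (mem T)) /= addrC.
by apply/eqP; congr (_ + _); apply: eq_bigl => y; rewrite !inE.
Qed.

(** The redraw alone reaches the complement of [I] with this probability. The inverse [2 / p] is the
    price of conditioning a slot to avoid [I] and enters the growth constants below. *)
Lemma qs_compl_ge e I : (#|I|.*2 <= n.+1)%N -> p / 2 <= qs q e (~: I).
Proof.
move=> HI; apply: le_trans (qs_ge e _); rewrite -mulrA ler_pM2l //.
rewrite ler_pdivlMr ?N_gt0 // mulrC ler_pdivrMr // -natrM ler_nat.
by have := cardsC I; rewrite card_ord; lia.
Qed.

Lemma mass_gt0 w : 0 < mass q w.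
Proof. by apply: prodr_gt0 => e _; apply: q_gt0. Qed.

Lemma Pr_gt0 (E : pred Om) w : E w -> 0 < Pr q E.
Proof.
move=> Ew; rewrite /Pr /Ex (bigD1 w) //= Ew mulr1 ltr_pwDl ?mass_gt0 //.
by apply: sumr_ge0 => w' _; rewrite mulr_ge0 // ltW ?mass_gt0.
Qed.

Section Block.
Variables (I A : Om -> {set V}) (w : Om).
Hypotheses (ex : explorable I A) (sI : (#|I w|.*2 <= n.+1)%N).
Local Notation rho := (block I A w).
Local Notation M := (Pr q (inr rho)).

Lemma M_gt0 : 0 < M.
Proof. by apply: Pr_gt0; apply: inr_block_self ex. Qed.

Variable (T : {set V}).
Hypothesis TI : [disjoint T & I w].

Lemma block_off e : e.2 \notin A w -> rho e = ~: I w.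
Proof. by move=> eA; rewrite ffunE (negbTE eA). Qed.

Lemma block_offT e : e.2 \notin A w -> rho e :&: T = T.
Proof.
move=> eA; rewrite block_off //; apply/setIidPr/subsetP => y yT; rewrite inE.
by rewrite (disjointFr TI yT).
Qed.

Lemma block_slot_le e : e.2 \notin A w ->
  Pr q (fun w' => inr rho w' && (w' e \in T)) <= 2 / p * qs q e T * M.
Proof.
move=> eA; have := Pr_slot q rho e T; rewrite block_offT // block_off // => E.
have h := qs_compl_ge e sI.
have hp : 0 < qs q e (~: I w) by apply: lt_le_trans h; rewrite divr_gt0.
rewrite -(ler_pM2r hp) E; have k : 1 <= 2 / p * qs q e (~: I w).
  by rewrite mulrAC ler_pdivlMr //; lra.
have -> : 2 / p * qs q e T * M * qs q e (~: I w) = 2 / p * qs q e (~: I w) * (qs q e T * M) by ring.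
by rewrite ler_peMl // mulr_ge0 ?(ltW M_gt0) // qs_ge0 //; apply: q_ge0.
Qed.

Definition hits x : pred Om := fun w' => [exists d, w' (d, x) \in T].
Definition missK x : {ffun slot -> {set V}} := [ffun e => if e.2 == x then ~: T else setT].

Lemma inr_missK x w' : inr (missK x) w' = ~~ hits x w'.
Proof.
rewrite /hits negb_exists; apply/forallP/forallP => H.
  by move=> d; have := H (d, x); rewrite ffunE eqxx inE.
move=> [d y]; rewrite ffunE /=; case: eqP => [->|]; rewrite inE //; exact: H.
Qed.

(** Hitting [T] is not a product event but missing it is, so independence is taken for the
    complements and transferred by inclusion-exclusion. *)
Lemma hits_indep x y : x != y ->
  Pr q (fun w' => [&& inr rho w', hits x w' & hits y w']) * M =
  Pr q (fun w' => inr rho w' && hits x w') * Pr q (fun w' => inr rho w' && hits y w').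
Proof.
move=> xy.
have KK e : (missK x e == setT) || (missK y e == setT).
  rewrite !ffunE; case: (eqVneq e.2 x) => [->|_]; last by rewrite eqxx.
  by rewrite (negbTE xy) eqxx orbT.
have ind := Pr_rect_indep q rho KK.
have hx z : Pr q (fun w' => inr rho w' && hits z w') = M - Pr q (fun w' => inr rho w' && inr (missK z) w').
  apply/eqP; rewrite eq_sym subr_eq /Pr -ExD; apply/eqP/Ex_eq => w'; rewrite inr_missK.
  by case: (inr rho w'); case: (hits z w'); rewrite ?addr0 ?add0r.
have hxy : Pr q (fun w' => [&& inr rho w', hits x w' & hits y w']) +
   (Pr q (fun w' => inr rho w' && inr (missK x) w') + Pr q (fun w' => inr rho w' && inr (missK y) w'))
   = M + Pr q (fun w' => [&& inr rho w', inr (missK x) w' & inr (missK y) w']).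
  rewrite /Pr -!ExD; apply: Ex_eq => w'; rewrite !inr_missK.
  by case: (inr rho w'); case: (hits x w'); case: (hits y w') => /=; ring.
move: hxy ind; rewrite !hx; set a := Pr q _; set b := Pr q _; set c := Pr q _; set d := Pr q _.
move=> /(canRL (addrK _)) -> ind.
by rewrite mulrBl mulrDl ind; ring.
Qed.

Lemma Pr_block_ge (K : {ffun slot -> {set V}}) (c : slot -> R) :
  (forall e, 0 <= c e) -> (forall e, c e * qs q e (rho e) <= qs q e (rho e :&: K e)) ->
  (\prod_e c e) * M <= Pr q (fun w' => inr rho w' && inr K w').
Proof.
move=> c0 H; rewrite (Pr_eq q (E := fun w' => inr rho w' && inr K w') (E' := inr (recI rho K))) => [|w']; last by rewrite inr_recI.
rewrite !Pr_rect -big_split /=; apply: ler_prod => e _; rewrite [recI _ _ _]ffunE H ?andbT ?andTb.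
by rewrite mulr_ge0 ?c0 ?qs_ge0 //; apply: q_ge0.
Qed.

Lemma Pr_block_le (K : {ffun slot -> {set V}}) (c : slot -> R) :
  (forall e, qs q e (rho e :&: K e) <= c e * qs q e (rho e)) ->
  Pr q (fun w' => inr rho w' && inr K w') <= (\prod_e c e) * M.
Proof.
move=> H; rewrite (Pr_eq q (E := fun w' => inr rho w' && inr K w') (E' := inr (recI rho K))) => [|w']; last by rewrite inr_recI.
rewrite !Pr_rect -big_split /=; apply: ler_prod => e _; rewrite [recI _ _ _]ffunE H ?andbT ?andTb.
by rewrite qs_ge0 //; apply: q_ge0.
Qed.

Local Notation a := (p * #|T|%:R / N).

Lemma a_ge0 : 0 <= a.
Proof. by rewrite divr_ge0 ?mulr_ge0 ?(ltW p0). Qed.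

Lemma a_le1 : a <= 1.
Proof.
rewrite ler_pdivrMr ?N_gt0 // mul1r; apply: (@le_trans _ _ #|T|%:R); first by rewrite ler_piMl.
by rewrite ler_nat; apply: leq_trans (max_card _) _; rewrite card_ord.
Qed.

(** As [T] is disjoint from [I w], conditioning on avoiding [I w] can only raise the chance of
    landing in [T]; each of the [m] slots of [x] misses with probability at most [1 - a]. *)
Lemma miss_le x : x \notin A w ->
  Pr q (fun w' => inr rho w' && ~~ hits x w') <= (1 - a) ^+ m * M.
Proof.
move=> xA; rewrite (Pr_eq q (E' := fun w' => inr rho w' && inr (missK x) w')) => [|w']; last by rewrite inr_missK.
have -> : (1 - a) ^+ m = \prod_(e : slot) (if e.2 == x then 1 - a else 1).
  rewrite -(pair_big xpredT xpredT (fun (_ : 'I_m) y => if y == x then 1 - a else 1)) /=.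
  rewrite (eq_bigr (fun=> 1 - a)) => [|d _]; last by rewrite (bigD1 x) //= eqxx big1 ?mulr1 // => y /negbTE ->.
  by rewrite prodr_const card_ord.
apply: Pr_block_le => e; rewrite [missK x e]ffunE; case: eqP => [ex2|_]; last by rewrite setIT mul1r.
rewrite block_off ?ex2 // -setCU setUC qs_setC qs_disjoint // qs_setC.
have h := qs_ge e T; have := qs_le1 e (I w); have := a_ge0.
have := qs_ge0 q_ge0 e (I w); move: h; move: (a) (qs _ _ _) (qs _ _ _) => b y z.
by move=> ? ? ? ?; nra.
Qed.

(** Turns the product bound on missing into the rational lower bound on hitting of [hits_ge], which
    is nearly linear when [k * b] is small. *)
Lemma expr_1Bx_le (k : nat) (b : R) : 0 <= b <= 1 -> (1 - b) ^+ k * (1 + k%:R * b) <= 1.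
Proof.
move=> /andP[b0 b1]; elim: k => [|k IH]; first by rewrite expr0 mul0r addr0 mulr1.
apply: le_trans IH; rewrite exprSr -mulrA ler_wpM2l ?exprn_ge0 ?subr_ge0 //.
rewrite -natr1; have : 0 <= k%:R * b * b by rewrite !mulr_ge0.
move: (k%:R) => c; nra.
Qed.

Lemma hits_ge x : x \notin A w ->
  m%:R * a / (1 + m%:R * a) * M <= Pr q (fun w' => inr rho w' && hits x w').
Proof.
move=> xA; have := miss_le xA.
have -> : Pr q (fun w' => inr rho w' && hits x w') = M - Pr q (fun w' => inr rho w' && ~~ hits x w').
  apply/eqP; rewrite eq_sym subr_eq /Pr -ExD; apply/eqP/Ex_eq => w'.
  by case: (inr rho w'); case: (hits x w'); rewrite ?addr0 ?add0r.
move=> h; rewrite lerBrDr; apply: le_trans (lerD (lexx _) h) _; rewrite -mulrDl.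
rewrite ler_piMl ?(ltW M_gt0) //.
have k := @expr_1Bx_le m a; have {}k := k _; move: k; rewrite a_ge0 a_le1 => /(_ isT) k.
have d0 : 0 < 1 + m%:R * a by rewrite ltr_pwDl // mulr_ge0 ?a_ge0.
by rewrite -(ler_pM2r d0) mulrDl mul1r divfK ?gt_eqF // addrC lerD2r.
Qed.

Lemma hits_le x : x \notin A w ->
  Pr q (fun w' => inr rho w' && hits x w') <= \sum_d 2 / p * qs q (d, x) T * M.
Proof.
move=> xA; apply: (@le_trans _ _ (\sum_d Pr q (fun w' => inr rho w' && (w' (d, x) \in T)))).
  apply: Pr_union_sum => // [|w' /andP[-> /existsP[d]] wd]; first exact: q_ge0.
  by exists d.
by apply: ler_sum => d _; apply: block_slot_le.
Qed.

Lemma card_hit (A0 : {set V}) w' : #|hit w' A0 T|%:R = \sum_(x in ~: A0) (hits x w')%:R :> R.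
Proof.
rewrite -sum1_card natr_sum big_mkcond [RHS]big_mkcond; apply: eq_bigr => x _.
by rewrite !inE; case: (x \in A0) => //=; rewrite /hits; case: existsP.
Qed.

Lemma sum_qs_off : \sum_(x in ~: A w) \sum_d 2 / p * qs q (d, x) T * M <= 2 / p * (m%:R * #|T|%:R) * M.
Proof.
move: M M_gt0 => mm /ltW mm0; rewrite -qs_sum.
have -> : \sum_e qs q e T = \sum_x \sum_d qs q (d, x) T.
  by rewrite [RHS]exchange_big (pair_bigA _ (fun d x => qs q (d, x) T)).
have pp : 0 <= 2 / p by rewrite divr_ge0 // ltW.
rewrite big_distrr big_distrl /= big_mkcond; apply: ler_sum => x _.
rewrite big_distrr big_distrl /=; case: ifP => // _; apply: sumr_ge0 => d _.
by apply: mulr_ge0 => //; apply: mulr_ge0 => //; apply: qs_ge0; apply: q_ge0.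
Qed.

Lemma hit_mean_block : Ex q (fun w' => (inr rho w')%:R * #|hit w' (A w) T|%:R) <=
  2 / p * (m%:R * #|T|%:R) * M.
Proof.
apply: le_trans sum_qs_off.
rewrite (Ex_eq q (G := fun w' => \sum_(x in ~: A w) (inr rho w' && hits x w')%:R)).
  by rewrite Ex_sum; apply: ler_sum => x; rewrite inE => /hits_le.
by move=> w'; rewrite card_hit mulr_sumr; apply: eq_bigr => x _; rewrite -natrM mulnb.
Qed.

Variables (gam gam' th : R).
Hypotheses (g_lt : gam < gam') (g_le : gam' * (1 + m%:R * th) <= p * m%:R * (1 - th)).
(** [gam'] is the mean growth factor guaranteed while at most a proportion [th] is discovered; [gam]
    leaves room for deviations. [Gam] is the upper bound on the mean factor plus the same deviation,
    and [Cvar] is what Chebyshev's inequality yields for that deviation. *)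
Definition Gam := 2 / p * m%:R + (gam' - gam).
Definition Cvar := 2 / p * m%:R / (gam' - gam) ^+ 2.

Definition grows (X : nat) (t : nat) := (gam * t%:R <= X%:R) && (X%:R <= Gam * t%:R).

(** On the atom, hits of distinct undiscovered vertices are independent and their mean number lies
    between [gam' * #|T|] and [2 / p * m * #|T|]; Chebyshev is applied with deviation
    [(gam' - gam) * #|T|]. *)
Lemma step_block : (0 < #|T|)%N -> #|A w|%:R <= th * N -> #|T|%:R <= th * N -> 0 <= gam' ->
  Pr q (fun w' => inr rho w' && ~~ grows #|hit w' (A w) T| #|T|) <= Cvar / #|T|%:R * M.
Proof.
move=> T0 Ath Tth g0; have t0 : 0 < #|T|%:R :> R by rewrite ltr0n.
have M0 := M_gt0; have N0 := N_gt0.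
set mean := (\sum_(x in ~: A w) Pr q (fun w' => inr rho w' && hits x w')) / M.
have meanE : \sum_(x in ~: A w) Pr q (fun w' => inr rho w' && hits x w') = mean * M.
  by rewrite divfK ?gt_eqF.
have mean_le : mean <= 2 / p * m%:R * #|T|%:R.
  rewrite ler_pdivrMr // -(mulrA (2 / p)); apply: le_trans sum_qs_off.
  by apply: ler_sum => x; rewrite inE => /hits_le.
have mean_ge : gam' * #|T|%:R <= mean.
  rewrite ler_pdivlMr //; apply: (@le_trans _ _ (\sum_(x in ~: A w) m%:R * a / (1 + m%:R * a) * M)).
    rewrite sumr_const -[leRHS]mulr_natr; have -> : #|~: A w|%:R = N - #|A w|%:R :> R.
      by apply/eqP; rewrite eq_sym subr_eq -natrD addnC cardsC card_ord.
    have d0 : 0 < 1 + m%:R * a by rewrite ltr_pwDl // mulr_ge0 ?a_ge0.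
    have hd : 1 + m%:R * a <= 1 + m%:R * th.
      rewrite lerD2l ler_wpM2l // ler_pdivrMr //; apply: le_trans Tth.
      by rewrite ler_piMl // ltW.
    have -> : m%:R * a / (1 + m%:R * a) * M * (N - #|A w|%:R) =
       m%:R * a * (N - #|A w|%:R) / (1 + m%:R * a) * M by ring.
    rewrite ler_pM2r // ler_pdivlMr //.
    apply: (@le_trans _ _ (gam' * #|T|%:R * (1 + m%:R * th))).
      by rewrite ler_wpM2l // mulr_ge0.
    rewrite mulrAC; apply: (@le_trans _ _ (p * m%:R * (1 - th) * #|T|%:R)); first by apply: ler_wpM2r => //.
    have aN : a * N = p * #|T|%:R by rewrite divfK ?gt_eqF.
    have -> : p * m%:R * (1 - th) * #|T|%:R = m%:R * a * (N - th * N).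
      by transitivity (m%:R * (1 - th) * (a * N)); [rewrite aN; ring | move: (a) (N) => b c; ring].
    apply: ler_wpM2l; first by rewrite mulr_ge0 ?a_ge0.
    by rewrite lerD2l lerN2.
  by apply: ler_sum => x; rewrite inE => /hits_ge.
have gg : 0 < gam' - gam by rewrite subr_gt0.
have da : 0 < (gam' - gam) * #|T|%:R by rewrite mulr_gt0.
have := @chebyshev_block R _ _ q q_ge0 _ (~: A w) hits (inr rho) mean _ _ meanE da.
move=> /(_ (fun x y _ _ => @hits_indep x y)) cheb.
apply: le_trans (le_trans cheb _).
  apply: Pr_le => // [|w' /andP[-> ngr] /=]; first exact: q_ge0.
  rewrite -card_hit; apply: contraR ngr; rewrite -ltNge ltr_norml /grows => /andP[h1 h2].
  rewrite /Gam; apply/andP; split; move: h1 h2 mean_le mean_ge; lra.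
rewrite ler_pM2r // ler_pdivrMr ?exprn_gt0 //; apply: le_trans mean_le _.
rewrite /Cvar le_eqVlt; apply/orP; left; apply/eqP; field.
by rewrite !gt_eqF.
Qed.

Section Connect.
Variables (d0 d1 : 'I_m) (W : {set V}).
Hypotheses (d01 : d0 != d1) (WI : [disjoint W & I w]).

Definition links x : pred Om := fun w' => (w' (d0, x) \in T) && (w' (d1, x) \in W).
Definition linkK x : {ffun slot -> {set V}} :=
  [ffun e => if e == (d0, x) then T else if e == (d1, x) then W else setT].

Lemma inr_linkK x w' : inr (linkK x) w' = links x w'.
Proof.
apply/forallP/andP => [H|[H0 H1] e].
  split; first by have := H (d0, x); rewrite ffunE eqxx.
  by have := H (d1, x); rewrite ffunE xpair_eqE (eq_sym d1) (negbTE d01) /= eqxx.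
by rewrite ffunE; case: eqP => [->//|_]; case: eqP => [->//|_]; rewrite inE.
Qed.

Lemma links_indep x y : x != y ->
  Pr q (fun w' => [&& inr rho w', links x w' & links y w']) * M =
  Pr q (fun w' => inr rho w' && links x w') * Pr q (fun w' => inr rho w' && links y w').
Proof.
move=> xy; have KK e : (linkK x e == setT) || (linkK y e == setT).
  rewrite !ffunE; case: e => d z; rewrite !xpair_eqE.
  by case: (eqVneq z x) => [->|_]; rewrite ?(negbTE xy) ?andbF /= ?eqxx ?orbT.
have := Pr_rect_indep q rho KK.
rewrite (Pr_eq q (E' := fun w' => [&& inr rho w', links x w' & links y w'])) => [|w']; last by rewrite !inr_linkK.
rewrite (Pr_eq q (E := fun w' => inr rho w' && inr (linkK x) w') (E' := fun w' => inr rho w' && links x w')) => [|w']; last by rewrite !inr_linkK.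
by rewrite (Pr_eq q (E := fun w' => inr rho w' && inr (linkK y) w') (E' := fun w' => inr rho w' && links y w')) => [|w']; last by rewrite !inr_linkK.
Qed.

(** At least [N / 2] undiscovered vertices each link the two sets with probability at least
    [(p * #|T| / N) * (p * #|W| / N)]; Chebyshev with deviation equal to the mean leaves the inverse
    of the mean. *)
Lemma connect_block : (0 < #|T|)%N -> (0 < #|W|)%N -> (#|A w|.*2 <= n.+1)%N ->
  Pr q (fun w' => inr rho w' && [forall x in ~: A w, ~~ links x w']) <=
  2 * N / (p ^+ 2 * #|T|%:R * #|W|%:R) * M.
Proof.
move=> T0 W0 A2; have M0 := M_gt0; have N0 := N_gt0.
have t0 : 0 < #|T|%:R :> R by rewrite ltr0n.
have u0 : 0 < #|W|%:R :> R by rewrite ltr0n.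
set mean := (\sum_(x in ~: A w) Pr q (fun w' => inr rho w' && links x w')) / M.
have meanE : \sum_(x in ~: A w) Pr q (fun w' => inr rho w' && links x w') = mean * M.
  by rewrite divfK ?gt_eqF.
have mean_ge : (p ^+ 2 * #|T|%:R * #|W|%:R) / (2 * N) <= mean.
  rewrite ler_pdivlMr //.
  apply: (@le_trans _ _ (\sum_(x in ~: A w) (a * (p * #|W|%:R / N)) * M)).
    rewrite sumr_const -[leRHS]mulr_natr.
    have AA : N / 2 <= #|~: A w|%:R.
      rewrite ler_pdivrMr // -natrM ler_nat.
      by move: A2 (cardsC (A w)); rewrite card_ord; clear; lia.
    rewrite [leRHS]mulrAC ler_wpM2r ?(ltW M0) //.
    apply: (@le_trans _ _ (a * (p * #|W|%:R / N) * (N / 2))).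
      by rewrite le_eqVlt; apply/orP; left; apply/eqP; move: N N0 => b b0; field; rewrite gt_eqF.
    by rewrite ler_wpM2l // !mulr_ge0 ?invr_ge0 ?(ltW p0) ?(ltW N0).
  apply: ler_sum => x; rewrite inE => xA.
  rewrite (Pr_eq q (E := fun w' => inr rho w' && links x w') (E' := fun w' => inr rho w' && inr (linkK x) w'))
     => [|w']; last by rewrite inr_linkK.
  set c := fun e : slot => if e == (d0, x) then a else if e == (d1, x) then p * #|W|%:R / N else 1.
  have -> : a * (p * #|W|%:R / N) = \prod_e c e.
    rewrite (bigD1 (d0, x)) //= (bigD1 (d1, x)) //= /c ?eqxx; last by rewrite xpair_eqE (eq_sym d1) negb_and d01.
    rewrite xpair_eqE (eq_sym d1) (negbTE d01) /= big1 ?mulr1 // => e /andP[/negbTE -> /negbTE ->]; by [].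
  have b_ge0 : 0 <= p * #|W|%:R / N by rewrite divr_ge0 ?mulr_ge0 ?(ltW p0).
  have partial_to_full (B : {set V}) e : [disjoint B & I w] -> e.2 \notin A w ->
     p * #|B|%:R / N * qs q e (rho e) <= qs q e (rho e :&: B).
    move=> BI eA; have -> : rho e :&: B = B.
      rewrite block_off //; apply/setIidPr/subsetP => y yB; by rewrite inE (disjointFr BI yB).
    apply: le_trans (qs_ge e B); apply: ler_piMr; last exact: qs_le1.
    by rewrite divr_ge0 ?mulr_ge0 ?(ltW p0).
  apply: Pr_block_ge => e; first by rewrite /c; case: ifP => // _; [exact: a_ge0|case: ifP].
  rewrite [linkK x e]ffunE /c; case: eqP => [->|_]; first exact: partial_to_full.
  case: eqP => [->|_]; first exact: partial_to_full.
  by rewrite setIT mul1r.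
have mp : 0 < mean.
  by apply: lt_le_trans mean_ge; rewrite divr_gt0 ?mulr_gt0 ?exprn_gt0.
have := @chebyshev_block R _ _ q q_ge0 _ (~: A w) links (inr rho) mean _ _ meanE mp.
move=> /(_ (fun x y _ _ => @links_indep x y)) cheb.
apply: le_trans (le_trans cheb _).
  apply: Pr_le => // [|w' /andP[-> /forallP no] /=]; first exact: q_ge0.
  rewrite big1 ?sub0r ?normrN ?ger0_norm ?(ltW mp) // => x xA.
  by have := no x; rewrite xA /= => /negbTE ->.
rewrite ler_pM2r // expr2 invfM mulrA divff ?gt_eqF // mul1r -invf_div lef_pV2 ?posrE //.
by rewrite divr_gt0 ?mulr_gt0 ?exprn_gt0.
Qed.
End Connect.

End Block.

Section Global.
Variables (I A T : Om -> {set V}) (G : pred Om).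
Hypotheses (ex : explorable I A) (mT : measurable I A T) (mG : measurable I A G).
Hypothesis Gok : forall w, G w -> [disjoint T w & I w] && (#|I w|.*2 <= n.+1)%N.

Lemma hit_mean :
  Ex q (fun w => (G w)%:R * #|hit w (A w) (T w)|%:R) <= 2 / p * m%:R * Ex q (fun w => (G w)%:R * #|T w|%:R).
Proof.
rewrite -ExZ; apply: (Ex_blocks (explorable_partitioning ex)) => w.
case Gw : (G w); last first.
  have z X : Ex q (fun w' => (inr (block I A w) w')%:R * ((G w')%:R * X w')) = 0.
    rewrite /Ex big1 // => w' _; case ww' : (inr _ _); rewrite ?mul0r ?mulr0 //.
    by rewrite (mG ww') Gw !mul0r !mulr0.
  rewrite z -[leLHS](z (fun w' => 2 / p * m%:R * #|T w'|%:R)).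
  by apply: Ex_le => [|w']; rewrite ?[2 / p * m%:R * (_ * _)]mulrCA //; apply: q_ge0.
have /andP[TI sI] := Gok Gw.
have := hit_mean_block ex sI TI; rewrite -ExZ => h.
apply: le_trans (le_trans h _); (apply: Ex_le => [|w']; first exact: q_ge0);
 case ww' : (inr _ _); rewrite ?mul0r ?mulr0 // ?(mG ww') ?Gw ?mul1r ?(mT ww') ?(measurableA ex ww') //.
by rewrite mulr1 mulrA.
Qed.

Variables (gam gam' th : R).
Hypotheses (g_lt : gam < gam') (g0 : 0 <= gam').
Hypothesis (g_le : gam' * (1 + m%:R * th) <= p * m%:R * (1 - th)).
Local Notation grow := (grows gam gam').

Hypothesis Gok' : forall w, G w -> [&& (0 < #|T w|)%N, #|A w|%:R <= th * N & #|T w|%:R <= th * N].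

Lemma step_fail_Ex :
  Ex q (fun w => (G w && ~~ grow #|hit w (A w) (T w)| #|T w|)%:R) <=
  Ex q (fun w => (G w)%:R * (Cvar gam gam' / #|T w|%:R)).
Proof.
apply: (Ex_blocks (explorable_partitioning ex)) => w.
case Gw : (G w); last first.
  have z X : Ex q (fun w' => (inr (block I A w) w')%:R * ((G w')%:R * X w')) = 0.
    rewrite /Ex big1 // => w' _; case ww' : (inr _ _); rewrite ?mul0r ?mulr0 //.
    by rewrite (mG ww') Gw !mul0r !mulr0.
  rewrite z -[leRHS](z (fun w' => (~~ grow #|hit w' (A w') (T w')| #|T w'|)%:R)).
  by apply: Ex_le => [|w']; rewrite -?natrM ?mulnb //; apply: q_ge0.
have /andP[TI sI] := Gok Gw; have /and3P[T0 Ath Tth] := Gok' Gw.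
have h := step_block ex sI TI g_lt g_le T0 Ath Tth g0; rewrite -ExZ in h.
apply: le_trans (le_trans h _); (apply: Ex_le => [|w']; first exact: q_ge0);
 case ww' : (inr _ _); rewrite ?mul0r ?mulr0 // ?(mG ww') ?Gw ?mul1r ?(mT ww') ?(measurableA ex ww') //.
by rewrite mulr1.
Qed.

Lemma step_fail t : 0 < t -> (forall w, G w -> t <= #|T w|%:R) ->
  Pr q (fun w => G w && ~~ grow #|hit w (A w) (T w)| #|T w|) <= Cvar gam gam' / t * Pr q G.
Proof.
move=> t0 tT; apply: le_trans step_fail_Ex _; rewrite -ExZ; apply: Ex_le => [|w]; first exact: q_ge0.
case Gw : (G w); rewrite ?mul0r ?mulr0 // mul1r mulr1 ler_wpM2l //.
  by rewrite /Cvar !mulr_ge0 ?invr_ge0 ?exprn_ge0 ?(ltW p0) // subr_ge0 ltW.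
by rewrite lef_pV2 ?tT // posrE; apply: lt_le_trans (tT _ Gw).
Qed.

End Global.

Lemma connect_fail (I A T W : Om -> {set V}) (G : pred Om) (d0 d1 : 'I_m) (t u : R) :
  explorable I A -> measurable I A T -> measurable I A W -> measurable I A G -> d0 != d1 ->
  0 < t -> 0 < u ->
  (forall w, G w -> [&& [disjoint T w & I w], [disjoint W w & I w], (#|A w|.*2 <= n.+1)%N,
     t <= #|T w|%:R & u <= #|W w|%:R]) ->
  Pr q (fun w => G w && [forall x in ~: A w, ~~ links (T w) d0 d1 (W w) x w]) <=
  2 * N / (p ^+ 2 * t * u) * Pr q G.
Proof.
move=> ex mT mW mG d01 t0 u0 Gok.
apply: (Pr_blocks q_ge0 (explorable_partitioning ex)) => // [w|w Gw].
  by case/andP.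
have /and5P[TI WI A2 tT uW] := Gok _ Gw.
have T0 : 0 < #|T w|%:R :> R by apply: lt_le_trans tT.
have W0 : 0 < #|W w|%:R :> R by apply: lt_le_trans uW.
have Tn : (0 < #|T w|)%N by rewrite -(ltr0n R).
have Wn : (0 < #|W w|)%N by rewrite -(ltr0n R).
have h := connect_block ex TI d01 WI Tn Wn A2.
apply: le_trans (le_trans h _).
  apply: Pr_le => [|w']; first exact: q_ge0.
  case ww' : (inr _ _) => //=; rewrite (mT _ _ ww') (mW _ _ ww') (measurableA ex ww').
  by case/andP.
rewrite ler_wpM2r ?Pr_ge0 //; first exact: q_ge0.
rewrite ler_wpM2l ?mulr_ge0 ?(ltW N_gt0) // lef_pV2 ?posrE ?mulr_gt0 ?exprn_gt0 //.
by rewrite ler_pM ?mulr_ge0 ?exprn_ge0 ?(ltW p0) ?(ltW t0) ?(ltW u0) // ler_wpM2l ?exprn_ge0 ?(ltW p0).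
Qed.

End Slots.

(** * Stopped breadth-first exploration *)

Section Graphs.
Variables (n m : nat).
Local Notation V := 'I_n.+1.
Local Notation slot := ('I_m * V)%type.
Local Notation Om := {ffun slot -> V}.
Implicit Types (w : Om) (G : graph n.+1) (S T I A : {set V}).

Lemma ballS G k u : ball G k.+1 u = ball G k u :|: nbr G (ball G k u).
Proof. by []. Qed.

Lemma nbrU G S T : nbr G (S :|: T) = nbr G S :|: nbr G T.
Proof.
apply/setP => y; rewrite !inE; apply/existsP/orP.
  move=> [x /andP[]]; rewrite inE => /orP[] xS xy; [left|right]; apply/existsP; exists x; rewrite xS //.
by move=> [] /existsP[x /andP[xS xy]]; exists x; rewrite inE xS ?orbT.
Qed.

Lemma nbr_sub G S T : S \subset T -> nbr G S \subset nbr G T.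
Proof. by move=> /setUidPr <-; rewrite nbrU subsetUl. Qed.

Lemma ball_leq G k l u : (k <= l)%N -> ball G k u \subset ball G l u.
Proof.
move=> /subnK <-; elim: (l - k)%N => [|j IH]; first by rewrite add0n.
by rewrite addSn ballS; apply: subset_trans IH (subsetUl _ _).
Qed.

Lemma nbr_ball G k u T : T \subset ball G k u -> nbr G T \subset ball G k.+1 u.
Proof. by move=> H; rewrite ballS; apply: subset_trans (nbr_sub G H) (subsetUr _ _). Qed.

(** Exhibits a breadth-first step as an exploration step whose extra set is [out w T]. *)
Lemma nbrE w T A : A :|: nbr (Gr w) T = A :|: hit w A T :|: out w T.
Proof.
apply/setP => y; rewrite !inE; case: (boolP (y \in A)) => //= yA.
apply/existsP/orP => [[x /andP[xT]]|[|]].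
- rewrite inE /adj /= => /orP[/existsP[d xy]|/existsP[d /eqP yx]].
    by right; apply/existsP; exists (d, x); rewrite /= xT.
  by left; apply/existsP; exists d; rewrite yx.
- move=> /existsP[d dT]; exists (w (d, y)); rewrite dT inE /adj /=; apply/orP; right.
  by apply/existsP; exists d.
- move=> /existsP[[d x] /= /andP[xT xy]]; exists x; rewrite xT inE /adj /=; apply/orP; left.
  by apply/existsP; exists d.
Qed.

Lemma card_out w T : (#|out w T| <= m * #|T|)%N.
Proof.
have -> : out w T = [set w e | e in [set e : slot | e.2 \in T]].
  apply/setP => y; rewrite inE; apply/existsP/imsetP => [[e /andP[eT /eqP <-]]|[e]].
    by exists e; rewrite ?inE.
  by rewrite inE => eT ->; exists e; rewrite eT eqxx.
apply: leq_trans (leq_imset_card _ _) _.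
have -> : [set e : slot | e.2 \in T] = setX setT T by apply/setP => -[d x]; rewrite !inE.
by rewrite cardsX cardsT card_ord.
Qed.

Lemma nbrP w T y : reflect (exists2 x, x \in T & adj w x y) (y \in nbr (Gr w) T).
Proof.
rewrite inE; apply: (iffP existsP) => [[x /andP[xT]]|[x xT xy]].
  by rewrite inE; exists x.
by exists x; rewrite xT inE.
Qed.

Lemma explorable_ext (I A I' A' : Om -> {set V}) : I =1 I' -> A =1 A' -> explorable I A -> explorable I' A'.
Proof.
move=> EI EA [e1 e2]; split=> [w e|w w' ww']; first by rewrite -EI -EA; apply: e1.
rewrite -!EI -!EA; apply: e2; move: ww'.
by have -> : block I' A' w = block I A w by apply/ffunP => e; rewrite !ffunE EI EA.
Qed.

Variable (s : nat).

(* Breadth-first exploration from [u], stopped once [s] vertices are discovered. *)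
Fixpoint explore (u : V) w k : {set V} * {set V} :=
  if k is k'.+1 then
    let IA := explore u w k' in
    let T := if (#|IA.2| < s)%N then IA.2 :\: IA.1 else set0 in
    (IA.1 :|: T, IA.2 :|: nbr (Gr w) T)
  else (set0, [set u]).

Definition SI u k w := (explore u w k).1.
Definition SA u k w := (explore u w k).2.
Definition ST u k w := if (#|SA u k w| < s)%N then SA u k w :\: SI u k w else set0.

Lemma SI_S u k w : SI u k.+1 w = SI u k w :|: ST u k w. Proof. by []. Qed.
Lemma SA_S u k w : SA u k.+1 w = SA u k w :|: nbr (Gr w) (ST u k w). Proof. by []. Qed.

Lemma ST_sub u k w : ST u k w \subset SA u k w.
Proof. by rewrite /ST; case: ifP => _; rewrite ?sub0set ?subsetDl. Qed.

Lemma ST_disj u k w : [disjoint ST u k w & SI u k w].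
Proof.
rewrite /ST; case: ifP => _; last by rewrite -setI_eq0 set0I.
by rewrite -setI_eq0 setDE -setIA (setIC (~: _)) setICr setI0.
Qed.

Lemma SI_sub u k w : SI u k w \subset SA u k w.
Proof.
elim: k => [|k IH]; first exact: sub0set.
rewrite SI_S SA_S subUset (subset_trans IH) ?subsetUl //=.
exact: subset_trans (ST_sub _ _ _) (subsetUl _ _).
Qed.

Lemma nbr_SI u k w : nbr (Gr w) (SI u k w) \subset SA u k w.
Proof.
elim: k => [|k IH]; first by apply/subsetP => y /nbrP[x]; rewrite inE.
by rewrite SI_S nbrU SA_S subUset subsetUr (subset_trans IH) ?subsetUl.
Qed.

Lemma active_SI u k w : (#|SA u k w| < s)%N -> SI u k.+1 w = SA u k w.
Proof.
move=> a; rewrite SI_S /ST a; apply/setP => x; rewrite !inE.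
by case: (boolP (x \in SI u k w)) => //= /(subsetP (SI_sub u k w)) ->.
Qed.

Lemma active_SA u k w : (#|SA u k w| < s)%N -> SA u k.+1 w = SA u k w :|: nbr (Gr w) (SA u k w).
Proof.
move=> a; rewrite -[X in nbr _ X](active_SI a) SI_S SA_S nbrU setUA.
by rewrite (setUidPl (nbr_SI u k w)).
Qed.

Lemma stopped_SA u k w : (s <= #|SA u k w|)%N -> SA u k.+1 w = SA u k w /\ SI u k.+1 w = SI u k w.
Proof.
rewrite leqNgt => /negbTE a; rewrite SA_S SI_S /ST a setU0; split=> //.
by apply/setUidPl/subsetP => y /nbrP[x]; rewrite inE.
Qed.

Lemma SA_mono u k w : SA u k w \subset SA u k.+1 w.
Proof. by rewrite SA_S subsetUl. Qed.

Lemma SA_leq u k l w : (k <= l)%N -> SA u k w \subset SA u l w.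
Proof.
move=> /subnK <-; elim: (l - k)%N => [|j IH]; first by rewrite add0n.
by rewrite addSn; apply: subset_trans IH (SA_mono _ _ _).
Qed.

Lemma SA_ball u k w : SA u k w \subset ball (Gr w) k u /\
  ((#|ball (Gr w) k u| < s)%N = (#|SA u k w| < s)%N) /\ ((#|SA u k w| < s)%N -> SA u k w = ball (Gr w) k u).
Proof.
elim: k => [|k [IH1 [IH2 IH3]]] //.
have sub : SA u k.+1 w \subset ball (Gr w) k.+1 u.
  rewrite SA_S subUset (subset_trans IH1) ?ball_leq //=.
  exact: nbr_ball (subset_trans (ST_sub _ _ _) IH1).
split=> //; case: (ltnP #|SA u k w| s) => [a|na].
  have E : SA u k.+1 w = ball (Gr w) k.+1 u by rewrite active_SA // IH3.
  by rewrite E.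
have na' : (s <= #|SA u k.+1 w|)%N := leq_trans na (subset_leq_card (SA_mono u k w)).
by rewrite !ltnNge na' (leq_trans na' (subset_leq_card sub)).
Qed.

Lemma explorable_start u : explorable (fun _ : Om => set0 : {set V}) (fun _ => [set u]).
Proof. by split=> // w e _; rewrite inE. Qed.

Lemma explorable_S u k : explorable (SI u k) (SA u k).
Proof.
elim: k => [|k IH]; first exact: (explorable_start u).
have mT : measurable (SI u k) (SA u k) (ST u k).
  by move=> w w' ww'; rewrite /ST (measurableA IH ww') (measurableI IH ww').
have ex := explorable_step IH mT (measurable_out mT (ST_sub u k)).
apply: explorable_ext ex => w //; by rewrite SA_S nbrE.
Qed.

Lemma measurable_ST u k : measurable (SI u k) (SA u k) (ST u k).
Proof.
by move=> w w' ww'; rewrite /ST (measurableA (explorable_S u k) ww') (measurableI (explorable_S u k) ww').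
Qed.

Lemma measurable_S (X : Type) u k (f : Om -> X) :
  measurable (SI u k) (SA u k) f -> measurable (SI u k.+1) (SA u k.+1) f.
Proof.
move=> mf; have := measurable_step (T := ST u k) (Z := fun w => out w (ST u k w)) (explorable_S u k) mf.
move=> H w w' ww'; apply: H; move: ww'.
suff -> : block (SI u k.+1) (SA u k.+1) w =
  block (stepI (SI u k) (ST u k)) (stepA (SA u k) (ST u k) (fun w => out w (ST u k w))) w by [].
by apply/ffunP => e; rewrite !ffunE SA_S nbrE.
Qed.

Lemma measurable_S_leq (X : Type) u k l (f : Om -> X) : (k <= l)%N ->
  measurable (SI u k) (SA u k) f -> measurable (SI u l) (SA u l) f.
Proof.
move=> /subnK <-; elim: (l - k)%N => [|j IH] // mf.
by rewrite addSn; apply/measurable_S/IH.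
Qed.

(** The last step may discover many vertices at once, so only the expanded set [SI] has a
    deterministic bound; [SA] is controlled in mean, by [Ex_SA]. *)
Lemma card_SI u k w : (0 < s)%N -> (#|SI u k w| < s)%N.
Proof.
move=> s0; elim: k => [|k IH]; first by rewrite cards0.
by case: (ltnP #|SA u k w| s) => [a|/stopped_SA[_ ->]//]; rewrite active_SI.
Qed.

Lemma card_SI_S u k w : #|SI u k.+1 w| = (#|SI u k w| + #|ST u k w|)%N.
Proof. by rewrite SI_S cardsU setIC (eqP (_ : _ :&: _ == set0)) ?setI_eq0 ?ST_disj // cards0 subn0. Qed.

End Graphs.

(** * Translation invariance of the independent model *)

Section Translation.
Variables (R : realType) (n m : nat) (p : R).
Local Notation V := 'I_n.+1.
Local Notation slot := ('I_m * V)%type.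
Local Notation Om := {ffun slot -> V}.
Local Notation q := (@q R n m p).
Implicit Types (e : slot) (w : Om) (t x y u : V) (X Y : {set V}).

Lemma iter_ordSE k x : iter k (@ordS _) x = x + inZp k.
Proof.
elim: k => [|k IH]; first by apply: val_inj; rewrite /= mod0n addn0 modn_small.
by rewrite iterS IH; apply: val_inj; rewrite /= !modnDmr -addn1 modnDml addn1 addnS.
Qed.

Lemma lat_shift (d : 'I_m) x t : lat (d, x + t) = lat (d, x) + t.
Proof. by rewrite /lat /cshift !iter_ordSE /= addrAC. Qed.

Definition shift t w : Om := [ffun e => w (e.1, e.2 - t) + t].
Definition shS t X : {set V} := [set y | y - t \in X].

Lemma shiftK t : cancel (shift t) (shift (- t)).
Proof. by move=> w; apply/ffunP => -[d x]; rewrite !ffunE /= opprK addrK addrK. Qed.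

Lemma q_shift d x y t : q (d, x + t) (y + t) = q (d, x) y.
Proof. by rewrite /q lat_shift (inj_eq (addIr t)). Qed.

Lemma mass_shift t w : mass q (shift t w) = mass q w.
Proof.
rewrite /mass (reindex (fun e : slot => (e.1, e.2 + t))) /=.
  by apply: eq_bigr => -[d x] _; rewrite ffunE /= addrK q_shift.
by exists (fun e => (e.1, e.2 - t)) => -[d x] _ /=; rewrite ?addrK ?subrK.
Qed.

Lemma Ex_shift t F : Ex q (fun w => F (shift t w)) = Ex q F.
Proof.
rewrite /Ex [RHS](reindex (shift t)) /=; first by apply: eq_bigr => w _; rewrite mass_shift.
exists (shift (- t)) => w _; first exact: shiftK.
by rewrite -[X in shift X]opprK; apply: shiftK.
Qed.

Lemma adj_shift t w x y : adj (shift t w) x y = adj w (x - t) (y - t).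
Proof.
by rewrite /adj; congr orb; apply: eq_existsb => d; rewrite ffunE /= -[X in _ == X](subrK t) (inj_eq (addIr t)).
Qed.

Lemma card_shS t X : #|shS t X| = #|X|.
Proof. by have -> : shS t X = (fun y => y - t) @^-1: X; [apply/setP => y; rewrite !inE | rewrite card_preimset //; apply: addIr]. Qed.

Lemma nbr_shift t w X : nbr (Gr (shift t w)) (shS t X) = shS t (nbr (Gr w) X).
Proof.
apply/setP => y; rewrite [RHS]inE; apply/nbrP/nbrP => -[x].
  by rewrite inE adj_shift => xX xy; exists (x - t).
by move=> xX xy; exists (x + t); rewrite ?inE ?adj_shift addrK.
Qed.

Variable s : nat.
Lemma explore_shift t u w k :
  explore s (u + t) (shift t w) k = (shS t (explore s u w k).1, shS t (explore s u w k).2).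
Proof.
elim: k => [|k IH] /=.
  by congr pair; apply/setP => y; rewrite !inE // subr_eq.
rewrite IH /= card_shS; set I := (explore s u w k).1; set A := (explore s u w k).2.
have -> : (if (#|A| < s)%N then shS t A :\: shS t I else set0) = shS t (if (#|A| < s)%N then A :\: I else set0).
  by apply/setP => y; case: ifP; rewrite !inE.
by rewrite nbr_shift; congr pair; apply/setP => y; rewrite !inE.
Qed.

(** Mass transport: by translation, summing over the starting points that reach a fixed [y] amounts
    to summing over the vertices reached from [0]. *)
Lemma sum_Pr_SA k y : \sum_v Pr q (fun w => y \in SA s v k w) = Ex q (fun w => #|SA s 0 k w|%:R).
Proof.
rewrite (eq_bigr (fun v => Pr q (fun w => y - v \in SA s 0 k w))) => [|v _].
  rewrite (reindex_inj (subrI y)) /=.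
  rewrite -Ex_sum; apply: Ex_eq => w; rewrite -sum1_card natr_sum [RHS]big_mkcond.
  by apply: eq_bigr => x _; rewrite subKr; case: ifP.
rewrite /Pr -[LHS](Ex_shift v); apply: Ex_eq => w.
by rewrite /SA -[X in explore _ X](add0r v) explore_shift inE.
Qed.

End Translation.

(** * Mean size of a stopped exploration *)

Section Size.
Variables (R : realType) (n m : nat) (p : R) (s : nat).
Hypotheses (p0 : 0 < p) (p1 : p <= 1) (s0 : (0 < s)%N) (sN : 4 * s%:R <= p * n.+1%:R).
Local Notation V := 'I_n.+1.
Local Notation N := (n.+1%:R : R).
Local Notation slot := ('I_m * V)%type.
Local Notation Om := {ffun slot -> V}.
Local Notation q := (@q R n m p).
Local Notation qge0 := (q_ge0 p0 p1).
Implicit Types (e : slot) (w : Om) (t x y u v : V) (X Y : {set V}).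

Lemma s2N : (s.*2 <= n.+1)%N.
Proof.
rewrite -(ler_nat R) -muln2 natrM; have : p * N <= N by rewrite ler_piMl.
have : 0 <= s%:R :> R by []; move: sN; lra.
Qed.

(** Discoveries per expanded vertex: at most [2 / p * m] backwards in mean, and at most [m]
    forwards. *)
Definition Csize : R := 2 / p * m%:R + m%:R.
Lemma Csize_ge0 : 0 <= Csize.
Proof. by rewrite addr_ge0 // mulr_ge0 // divr_ge0 // ltW. Qed.

Lemma Ex_SA_SI u k : Ex q (fun w => #|SA s u k w|%:R) <= 1 + Csize * Ex q (fun w => #|SI s u k w|%:R).
Proof.
elim: k => [|k IH].
  rewrite (Ex_eq q (G := fun=> 1)) => [|w]; last by rewrite cards1.
  by rewrite Ex_cst ?lerDl ?mulr_ge0 ?Csize_ge0 ?Ex_ge0 //; [exact: qge0 | exact: q_sum1].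
rewrite [X in _ <= _ + _ * X](Ex_eq q (G := fun w => #|SI s u k w|%:R + #|ST s u k w|%:R)) => [|w]; last first.
  by rewrite card_SI_S natrD.
rewrite ExD mulrDr addrA; apply: le_trans (lerD IH (lexx _)).
have ex := @explorable_S n m s u k.
have H := @hit_mean R n m p p0 p1 _ _ _ xpredT ex (@measurable_ST n m s u k) (fun _ _ _ => erefl).
have {}H := H _; have Hyp : forall w, xpredT w -> [disjoint ST s u k w & SI s u k w] && (#|SI s u k w|.*2 <= n.+1)%N.
  move=> w _; rewrite ST_disj /=; apply: leq_trans s2N.
  by rewrite leq_double ltnW // card_SI.
have {Hyp}H := H Hyp; rewrite [X in _ <= _ * X](Ex_eq q (G := fun w => #|ST s u k w|%:R)) in H;
  last by move=> w; rewrite mul1r.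
rewrite /Csize mulrDl; apply: le_trans (lerD (lexx _) (lerD H (lexx _))).
rewrite -(ExZ q m%:R) -!ExD; apply: Ex_le => [|w] /=; first exact: qge0.
rewrite mul1r -natrM -!natrD ler_nat SA_S nbrE.
apply: leq_trans (leq_card_setU _ _) _; rewrite addnA leq_add ?leq_card_setU //.
by rewrite -[X in (_ <= X)%N]mulnC; apply: leq_trans (card_out _ _) _; rewrite mulnC.
Qed.

Lemma Ex_SA u k : Ex q (fun w => #|SA s u k w|%:R) <= 1 + Csize * s%:R.
Proof.
apply: le_trans (Ex_SA_SI u k) _; rewrite lerD2l ler_wpM2l ?Csize_ge0 //.
rewrite -[leRHS](Ex_cst (q_sum1 p (m := m) (n := n))); apply: Ex_le => [|w]; first exact: qge0.
by rewrite ler_nat ltnW // card_SI.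
Qed.

End Size.

(** Weierstrass's product inequality; the induction carries along the bounds on the product and on
    the sum. *)
Lemma prod_1B_ge (R : realType) (T : finType) (f : T -> R) : (forall i, 0 <= f i <= 1) ->
  1 - \sum_i f i <= \prod_i (1 - f i).
Proof.
move=> H; suff : (1 - \sum_i f i <= \prod_i (1 - f i)) && (0 <= \prod_i (1 - f i) <= 1) && (0 <= \sum_i f i).
  by case/andP => /andP[].
elim/big_rec2: _ => [|i y z _ /andP[/andP[IH /andP[z0 z1]] y0]]; first by rewrite subr0 !lexx ler01.
by have /andP[f0 f1] := H i; rewrite -!andbA; apply/and4P; split; nra.
Qed.

(** * Approximate independence of two explorations *)

Section Decoupling.
Variables (R : realType) (n m : nat) (p : R) (s : nat).
Hypotheses (p0 : 0 < p) (p1 : p <= 1) (s0 : (0 < s)%N) (sN : 4 * s%:R <= p * n.+1%:R).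
Local Notation V := 'I_n.+1.
Local Notation N := (n.+1%:R : R).
Local Notation slot := ('I_m * V)%type.
Local Notation Om := {ffun slot -> V}.
Local Notation q := (@q R n m p).
Local Notation qge0 := (q_ge0 p0 p1).
Implicit Types (e : slot) (w : Om) (x y u v : V).

Section Pair.
Variables (I A I' A' : Om -> {set V}).
Hypotheses (ex : explorable I A) (ex' : explorable I' A').
Hypotheses (IA : forall w, I w \subset A w) (IA' : forall w, I' w \subset A' w).
Hypotheses (cI : forall w, (#|I w| <= s)%N) (cI' : forall w, (#|I' w| <= s)%N).

(** The two atoms impose consistent constraints: no slot is fixed by both, and a slot fixed by one
    avoids the interior of the other. *)
Definition compat w w' := [&& [disjoint A w & A' w'],
  [forall e, (e.2 \in A w) ==> (w e \notin I' w')] & [forall e, (e.2 \in A' w') ==> (w' e \notin I w)]].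

(** Total over the slots of the relative loss in [block_prod]: [4 / p ^+ 2] times [p * s / N] times
    the bound [2 * m * s] on the summed masses of the two interiors. *)
Definition edec : R := 8 * m%:R * s%:R ^+ 2 / (p * N).

Lemma edec_ge0 : 0 <= edec.
Proof. by rewrite /edec divr_ge0 ?mulr_ge0 ?exprn_ge0 // ?(ltW p0). Qed.

(** A slot unrevealed on both sides is the source of the loss: if the interiors have masses [a] and
    [b], then [1 - a - b] falls short of [(1 - a) * (1 - b)] by [a * b]. The interiors are disjoint,
    so the lattice endpoint lies in at most one of them and the mass of the other is at most
    [p * s / N]. *)
Lemma block_prod w w' : compat w w' ->
  (1 - edec) * (Pr q (inr (block I A w)) * Pr q (inr (block I' A' w'))) <=
  Pr q (fun w'' => inr (block I A w) w'' && inr (block I' A' w') w'').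
Proof.
case/and3P => dA /forallP c1 /forallP c2.
rewrite (Pr_eq q (E := fun w'' => inr (block I A w) w'' && inr (block I' A' w') w'') (E' := inr (recI (block I A w) (block I' A' w')))) => [|w'']; last by rewrite inr_recI.
rewrite !Pr_rect; have N0 : 0 < N by exact: N_gt0.
have pN : 0 < p * N by rewrite mulr_gt0.
have sN1 : p * s%:R / N <= p ^+ 2 / 4.
  rewrite ler_pdivrMr // mulrAC ler_pdivlMr // expr2 -!mulrA ler_pM2l //.
  by rewrite mulrC.
set eps := fun e => 4 / p ^+ 2 * (qs q e (I w) * qs q e (I' w')).
have dI : [disjoint I w & I' w'].
  by apply: disjointWl (IA w) _; apply: disjointWr (IA' w') dA.
have qIs (X : {set V}) e : (#|X| <= s)%N -> lat e \notin X -> qs q e X <= p * s%:R / N.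
  move=> Xs eX; rewrite qs_eq // ler_pM2r ?invr_gt0 // ler_pM2l // ler_nat; exact: Xs.
have prodI e : qs q e (I w) * qs q e (I' w') <= p * s%:R / N * (qs q e (I w) + qs q e (I' w')).
  have g1 := qs_ge0 qge0 e (I w); have g2 := qs_ge0 qge0 e (I' w').
  have b0 : 0 <= p * s%:R / N by rewrite divr_ge0 ?mulr_ge0 // ltW.
  case: (boolP (lat e \in I w)) => eI.
    have h := qIs _ e (cI' w') (negbT (disjointFr dI eI)).
    by rewrite mulrDr mulrC; apply: le_trans (ler_wpM2r g1 h) _; rewrite lerDl mulr_ge0.
  have h := qIs _ e (cI w) eI.
  by rewrite mulrDr; apply: le_trans (ler_wpM2r g2 h) _; rewrite lerDr mulr_ge0.
have epsP e : 0 <= eps e <= 1.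
  have g1 := qs_ge0 qge0 e (I w); have g2 := qs_ge0 qge0 e (I' w').
  have p2 : 0 < p ^+ 2 by rewrite exprn_gt0.
  apply/andP; split; first by rewrite !mulr_ge0 ?invr_ge0 ?(ltW p2).
  rewrite /eps mulrAC ler_pdivrMr // mul1r mulrC -ler_pdivlMr //.
  apply: le_trans sN1.
  case: (boolP (lat e \in I w)) => eI.
    apply: le_trans (qIs _ e (cI' w') (negbT (disjointFr dI eI))).
    by rewrite ler_piMl // qs_le1.
  by apply: le_trans (qIs _ e (cI w) eI); rewrite ler_piMr // qs_le1.
have sumeps : \sum_e eps e <= edec.
  rewrite -mulr_sumr; apply: (@le_trans _ _ (4 / p ^+ 2 * \sum_e p * s%:R / N * (qs q e (I w) + qs q e (I' w')))).
    by rewrite ler_wpM2l ?divr_ge0 ?exprn_ge0 ?(ltW p0) //; apply: ler_sum => e _; apply: prodI.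
  rewrite -mulr_sumr big_split /= !qs_sum.
  have -> : edec = 4 / p ^+ 2 * (p * s%:R / N * (m%:R * s%:R + m%:R * s%:R)).
    by rewrite /edec; move: N N0 pN => b b0 _; field; rewrite !gt_eqF.
  rewrite ler_wpM2l ?divr_ge0 ?exprn_ge0 ?(ltW p0) // ler_wpM2l ?divr_ge0 ?mulr_ge0 ?(ltW p0) //.
  by rewrite lerD // ler_wpM2l // ler_nat.
apply: (@le_trans _ _ ((\prod_e (1 - eps e)) * (\prod_e qs q e (block I A w e) * \prod_e qs q e (block I' A' w' e)))).
  apply: ler_wpM2r; first by rewrite mulr_ge0 // prodr_ge0 // => e _; apply: qs_ge0 qge0 _ _.
  apply: le_trans (prod_1B_ge epsP); by rewrite lerD2l lerN2.
rewrite -!big_split /=; apply: ler_prod => e _.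
have /andP[ep0 ep1] := epsP e.
rewrite !mulr_ge0 ?subr_ge0 ?qs_ge0 //=; try exact: qge0.
have q01 X : 0 <= qs q e X <= 1 by rewrite (qs_ge0 qge0) qs_le1.
rewrite [recI _ _ _]ffunE !ffunE.
case: (boolP (e.2 \in A w)) => eA.
  rewrite (disjointFr dA eA); have /implyP/(_ eA) we := c1 e.
  have -> : [set w e] :&: ~: I' w' = [set w e] by apply/setIidPl; rewrite sub1set inE.
  rewrite [qs _ _ _ * _]mulrC mulrA; have /andP[a0 a1] := q01 (~: I' w'); have /andP[b0 b1] := q01 [set w e].
  by apply: ler_piMl => //; apply: mulr_ile1 => //; rewrite ?subr_ge0 ?lerBlDr ?lerDl.
case: (boolP (e.2 \in A' w')) => eA'.
  have /implyP/(_ eA') we := c2 e.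
  have -> : ~: I w :&: [set w' e] = [set w' e] by apply/setIidPr; rewrite sub1set inE.
  rewrite mulrA; have /andP[a0 a1] := q01 (~: I w); have /andP[b0 b1] := q01 [set w' e].
  by apply: ler_piMl => //; apply: mulr_ile1 => //; rewrite ?subr_ge0 ?lerBlDr ?lerDl.
rewrite -setCU !qs_setC qs_disjoint // /eps.
have h1 : p / 2 <= 1 - qs q e (I w).
  rewrite -qs_setC; apply: qs_compl_ge => //; apply: leq_trans (s2N p1 sN); by rewrite leq_double.
have h2 : p / 2 <= 1 - qs q e (I' w').
  rewrite -qs_setC; apply: qs_compl_ge => //; apply: leq_trans (s2N p1 sN); by rewrite leq_double.
have /andP[a0 _] := q01 (I w); have /andP[b0 _] := q01 (I' w').
move: h1 h2 a0 b0; move: (qs q e _) (qs q e _) => a b h1 h2 a0 b0.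
have k : 1 <= 4 / p ^+ 2 * ((1 - a) * (1 - b)).
  rewrite mulrAC ler_pdivlMr ?exprn_gt0 // mul1r.
  have := ler_pM _ _ h1 h2; rewrite !divr_ge0 ?(ltW p0) // => /(_ isT isT); rewrite expr2; lra.
have ab0 : 0 <= a * b by rewrite mulr_ge0.
have := ler_peMl ab0 k; move: (4 / p ^+ 2) => c; nra.
Qed.

(** Each compatible pair of atoms is weighted by a third configuration [o] lying in both. After
    exchanging expectations, the independent [w] and [w'] must lie in the atoms of [o], whose masses
    cancel. *)
Lemma pair_bound (X : Om -> Om -> bool) :
  (forall w w', X w w' -> compat w w') ->
  (forall w1 w2 w1' w2', inr (block I A w1) w2 -> inr (block I' A' w1') w2' -> X w2 w2' = X w1 w1') ->
  (1 - edec) * Ex q (fun w => Ex q (fun w' => (X w w')%:R)) <= Pr q (fun w => X w w).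
Proof.
move=> Xc XB; have [Rw RR] := explorable_partitioning ex; have [Rw' RR'] := explorable_partitioning ex'.
set M := fun w => Pr q (inr (block I A w)); set M' := fun w => Pr q (inr (block I' A' w)).
have M0 w : 0 < M w by apply: M_gt0.
have M0' w : 0 < M' w by apply: M_gt0.
have symB w w' : inr (block I A w) w' = inr (block I A w') w.
  by apply/idP/idP => /RR ->; apply: Rw.
have symB' w w' : inr (block I' A' w) w' = inr (block I' A' w') w.
  by apply/idP/idP => /RR' ->; apply: Rw'.
apply: (@le_trans _ _ (Ex q (fun w => Ex q (fun w' => Ex q (fun o =>
   (X w w')%:R / (M w * M' w') * ((inr (block I A w) o)%:R * (inr (block I' A' w') o)%:R)))))).
  rewrite -ExZ; apply: Ex_le => [|w]; first exact: qge0.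
  rewrite -ExZ; apply: Ex_le => [|w']; first exact: qge0.
  rewrite ExZ; case Xw : (X w w'); rewrite ?mulr0 ?mul0r // mulr1 div1r.
  rewrite -ler_pdivrMl ?invr_gt0 ?mulr_gt0 // invrK mulrC.
  apply: le_trans (block_prod (Xc _ _ Xw)) _; rewrite le_eqVlt; apply/orP; left; apply/eqP.
  by apply: Ex_eq => o; rewrite -natrM mulnb.
have swap (F : Om -> Om -> Om -> R) : Ex q (fun w => Ex q (fun w' => Ex q (F w w'))) =
  Ex q (fun o => Ex q (fun w => Ex q (fun w' => F w w' o))).
  rewrite -[RHS]Ex_swap; apply: Ex_eq => w; exact: Ex_swap.
rewrite swap; apply: Ex_le => [|o]; first exact: qge0.
rewrite (Ex_eq q (G := fun w => (X o o)%:R / (M o * M' o) * M' o * (inr (block I A o) w)%:R)).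
  rewrite ExZ; have -> : Ex q (fun w => (inr (block I A o) w)%:R) = M o by [].
  rewrite le_eqVlt; apply/orP; left; apply/eqP.
  by move: ((X o o)%:R) (M0 o) (M0' o); move: (M o) (M' o) => a b c a0 b0; field; rewrite !gt_eqF.
move=> w.
transitivity (Ex q (fun w' => (X o o)%:R / (M o * M' o) * (inr (block I A o) w)%:R * (inr (block I' A' o) w')%:R));
  last by rewrite ExZ mulrAC.
apply: Ex_eq => w'.
rewrite (symB w) (symB' w'); case ow : (inr (block I A o) w); last by rewrite mul0r !mulr0 mul0r.
case ow' : (inr (block I' A' o) w'); rewrite ?mulr0 // !mulr1.
by rewrite (XB o w o w' ow ow') /M /M' (RR _ _ ow) (RR' _ _ ow').
Qed.

End Pair.

Section Explorations.
Variable k : nat.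
Local Notation A := (fun u => SA s u k).
Local Notation I := (fun u => SI s u k).

Definition closed_set u w := A u w :|: out w (A u w).

Lemma card_closed u w : (#|closed_set u w| <= m.+1 * #|A u w|)%N.
Proof.
by apply: leq_trans (leq_card_setU _ _) _; rewrite mulSn leq_add2l card_out.
Qed.

Lemma not_compat u v w w' : ~~ compat (I u) (A u) (I v) (A v) w w' ->
  [exists y in closed_set u w, y \in A v w'] || [exists y in closed_set v w', y \in A u w].
Proof.
rewrite !negb_and -setI_eq0 => /or3P[/set0Pn[y]|/forallPn[e]|/forallPn[e]].
- by rewrite inE => /andP[yA yA']; apply/orP; left; apply/existsP; exists y; rewrite inE yA.
- rewrite negb_imply negbK => /andP[eA we]; apply/orP; left; apply/existsP; exists (w e).
  rewrite (subsetP (SI_sub _ _ _ _)) // andbT !inE; apply/orP; right; apply/existsP; exists e.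
  by rewrite eA eqxx.
- rewrite negb_imply negbK => /andP[eA we]; apply/orP; right; apply/existsP; exists (w' e).
  rewrite (subsetP (SI_sub _ _ _ _)) // andbT !inE; apply/orP; right; apply/existsP; exists e.
  by rewrite eA eqxx.
Qed.

Local Notation asize := (1 + Csize m p * s%:R).

(** For each [u], a union bound over [closed_set u w] and mass transport for the independent second
    exploration give the product of two mean sizes, with a factor [m.+1] for the forward slots. *)
Lemma sum_touch : \sum_u \sum_v Ex q (fun w => Ex q (fun w' => [exists y in closed_set u w, y \in A v w']%:R)) <=
  m.+1%:R * N * asize ^+ 2.
Proof.
have as0 : 0 <= asize by rewrite addr_ge0 // mulr_ge0 // Csize_ge0.
apply: (@le_trans _ _ (\sum_(u : V) m.+1%:R * asize ^+ 2)); last first.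
  by rewrite sumr_const card_ord -[leLHS]mulr_natr mulrAC.
apply: ler_sum => u _.
apply: (@le_trans _ _ (Ex q (fun w => m.+1%:R * asize * #|A u w|%:R))); last first.
  rewrite ExZ expr2 mulrA; apply: ler_wpM2l; first by rewrite mulr_ge0.
  exact: Ex_SA.
rewrite -Ex_sum; apply: Ex_le => [|w]; first exact: qge0.
apply: (@le_trans _ _ (\sum_v \sum_(y in closed_set u w) Pr q (fun w' => y \in A v w'))).
  apply: ler_sum => v _; apply: Pr_union_sum => [|w' /existsP[y /andP[]]]; first exact: qge0.
  by exists y.
rewrite exchange_big /= (eq_bigr (fun=> Ex q (fun w => #|A 0 w|%:R))) => [|y _]; last exact: sum_Pr_SA.
rewrite sumr_const -[leLHS]mulr_natr mulrC [leRHS]mulrAC -natrM; apply: ler_pM => //.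
- by apply: Ex_ge0 => // *; apply: qge0.
- by rewrite ler_nat card_closed.
- exact: Ex_SA.
Qed.

Definition errdec : R := edec + 2 * m.+1%:R * asize ^+ 2 / N.

(* Stopped explorations from [u] and [v] are almost independent unless they touch,
   which by translation invariance has probability O(s^2 / n) on average. *)
Lemma decoupling (f g : nat -> bool) :
  (\sum_u Pr q (fun w => f #|A u w|)) * (\sum_u Pr q (fun w => g #|A u w|)) - errdec * N ^+ 2 <=
  \sum_u \sum_v Pr q (fun w => [&& f #|A u w|, g #|A v w| & [disjoint A u w & A v w]]).
Proof.
set X := fun u v w w' => [&& f #|A u w|, g #|A v w'| & compat (I u) (A u) (I v) (A v) w w'].
have main : (1 - edec) * \sum_u \sum_v Ex q (fun w => Ex q (fun w' => (X u v w w')%:R)) <=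
  \sum_u \sum_v Pr q (fun w => [&& f #|A u w|, g #|A v w| & [disjoint A u w & A v w]]).
  rewrite mulr_sumr; apply: ler_sum => u _; rewrite mulr_sumr; apply: ler_sum => v _.
  have exu := @explorable_S n m s u k; have exv := @explorable_S n m s v k.
  apply: le_trans (pair_bound exu exv _ _ _ _ _ _) _.
  - by move=> w; apply: SI_sub.
  - by move=> w; apply: SI_sub.
  - by move=> w; apply/ltnW/card_SI.
  - by move=> w; apply/ltnW/card_SI.
  - by move=> w w' /and3P[].
  - move=> w1 w2 w1' w2' b b'; have /inr_blockP[b1 _] := b; have /inr_blockP[b1' _] := b'.
    rewrite /X /compat (measurableA exu b) (measurableI exu b) (measurableA exv b') (measurableI exv b').
    congr [&& _, _ & [&& _, _ & _]]; apply: eq_forallb => e.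
      by case: (boolP (e.2 \in A u w1)) => //= /b1 ->.
    by case: (boolP (e.2 \in A v w1')) => //= /b1' ->.
  by apply: Pr_le => [|w /and3P[-> -> /and3P[]]]; first exact: qge0.
have N0 : 0 < N by exact: N_gt0.
have prod_le : (\sum_u Pr q (fun w => f #|A u w|)) * (\sum_u Pr q (fun w => g #|A u w|)) <=
   \sum_u \sum_v Ex q (fun w => Ex q (fun w' => (X u v w w')%:R)) + 2 * m.+1%:R * asize ^+ 2 * N.
  set TT := fun u v => Ex q (fun w => Ex q (fun w' => [exists y in closed_set u w, y \in A v w']%:R)).
  have st : \sum_u \sum_v TT u v <= m.+1%:R * N * asize ^+ 2 := sum_touch.
  have st' : \sum_u \sum_v TT v u <= m.+1%:R * N * asize ^+ 2 by rewrite exchange_big.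
  apply: (@le_trans _ _ (\sum_u \sum_v Ex q (fun w => Ex q (fun w' => (X u v w w')%:R)) +
    (\sum_u \sum_v TT u v + \sum_u \sum_v TT v u))); last by rewrite lerD2l; lra.
  rewrite big_distrl -!big_split; apply: ler_sum => u _ /=.
  rewrite big_distrr -!big_split; apply: ler_sum => v _ /=; rewrite /TT.
  rewrite [X in _ + (_ + X)]Ex_swap.
  rewrite -!ExD /Pr -ExZr; apply: Ex_le => [|w]; first exact: qge0.
  rewrite -!ExD -ExZ; apply: Ex_le => [|w']; first exact: qge0.
  rewrite /X; case: (f _); rewrite ?mul0r ?addr_ge0 // mul1r.
  case: (g _); rewrite ?addr_ge0 //=; case: (boolP (compat _ _ _ _ _ _)) => [_|/not_compat/orP[] ->].
  - by rewrite lerDl addr_ge0.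
  - by rewrite add0r lerDl.
  - by rewrite add0r lerDr.
have tot : \sum_u \sum_v Ex q (fun w => Ex q (fun w' => (X u v w w')%:R)) <= N ^+ 2.
  apply: (@le_trans _ _ (\sum_(u : V) \sum_(v : V) 1)).
    apply: ler_sum => u _; apply: ler_sum => v _.
    rewrite -[leRHS](Ex_cst (q_sum1 p (m := m) (n := n))); apply: Ex_le => [|w]; first exact: qge0.
    rewrite -[leRHS](Ex_cst (q_sum1 p (m := m) (n := n))); apply: Ex_le => [|w']; first exact: qge0.
    by case: (X _ _ _ _).
  by rewrite !sumr_const card_ord -mulrnA -natrX.
apply: le_trans main; rewrite mulrBl mul1r lerBlDr -addrA.
have e0 := edec_ge0.
have -> : errdec * N ^+ 2 = edec * N ^+ 2 + 2 * m.+1%:R * asize ^+ 2 * N.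
  by rewrite /errdec; move: (asize) (m.+1%:R) N N0 => a b c c0; field; rewrite gt_eqF.
apply: le_trans prod_le _; rewrite lerD2l addrA lerDr addrC subr_ge0.
by rewrite ler_wpM2l.
Qed.

End Explorations.

End Decoupling.

(** * Backward growth *)

Section Growth.
Variables (R : realType) (n m : nat) (p : R).
Hypotheses (p0 : 0 < p) (p1 : p <= 1).
Local Notation V := 'I_n.+1.
Local Notation N := (n.+1%:R : R).
Local Notation slot := ('I_m * V)%type.
Local Notation Om := {ffun slot -> V}.
Local Notation q := (@q R n m p).
Local Notation qge0 := (q_ge0 p0 p1).
Implicit Types (e : slot) (w : Om) (x y u v : V).

Variables (gam gam' th : R).
Hypotheses (gam1 : 1 <= gam) (g_lt : gam < gam') (th2 : th <= 2^-1).
Hypothesis (g_le : gam' * (1 + m%:R * th) <= p * m%:R * (1 - th)).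
Local Notation grow := (grows m p gam gam').
Local Notation Gam := (Gam m p gam gam').
Local Notation Cvar := (Cvar m p gam gam').

Lemma gam'_ge0 : 0 <= gam'. Proof. by move: gam1 g_lt; lra. Qed.
Lemma Gam_ge0 : 0 <= Gam.
Proof. by rewrite /Gam addr_ge0 ?mulr_ge0 ?invr_ge0 ?(ltW p0) // subr_ge0 ltW. Qed.
Lemma Cvar_ge0 : 0 <= Cvar.
Proof. by rewrite /Cvar !mulr_ge0 ?invr_ge0 ?exprn_ge0 ?(ltW p0) // subr_ge0 ltW. Qed.

Section InGrowth.
Variables (I A T : Om -> {set V}).

(** Backward growth from arbitrary initial data: the frontier is replaced by its undiscovered
    in-neighbours, and forward endpoints are not added to the discovered set. *)
Fixpoint ingrow j w : {set V} * {set V} * {set V} :=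
  if j is j'.+1 then
    let S := ingrow j' w in
    let H := hit w S.1.2 S.2 in (S.1.1 :|: S.2, S.1.2 :|: H :|: set0, H)
  else (I w, A w, T w).
Definition gI j w := (ingrow j w).1.1.
Definition gA j w := (ingrow j w).1.2.
Definition gT j w := (ingrow j w).2.

Hypotheses (ex : explorable I A) (mT : measurable I A T).
Lemma ingrow_ok j : explorable (gI j) (gA j) /\ measurable (gI j) (gA j) (gT j).
Proof.
elim: j => [|j [IH1 IH2]]; first by [].
split; first exact: (explorable_step IH1 IH2 (Z := fun=> set0)).
exact: (measurable_hit (Z := fun=> set0) IH1 IH2).
Qed.

Lemma measurable_ingrow (X : Type) j (f : Om -> X) : measurable I A f -> measurable (gI j) (gA j) f.
Proof.
move=> mf; elim: j => [|j IH] //; have [IH1 IH2] := ingrow_ok j.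
exact: (measurable_step (T := gT j) (Z := fun=> set0) IH1 IH).
Qed.

Lemma gA_S j w : gA j.+1 w = gA j w :|: gT j.+1 w.
Proof. by rewrite /gA /gT /= setU0. Qed.

Definition grown j w := [forall i : 'I_j, grow #|gT i.+1 w| #|gT i w|].

Lemma grownS j w : grown j.+1 w = grown j w && grow #|gT j.+1 w| #|gT j w|.
Proof.
apply/forallP/andP => [H|[/forallP H1 H2] [i ij]].
  split; last exact: (H ord_max).
  by apply/forallP => -[i ij]; exact: (H (Ordinal (leqW ij))).
by case: (ltngtP i j) (ij) => [ij' _|ji|->] //=; [exact: (H1 (Ordinal ij')) | rewrite ltnS leqNgt ji].
Qed.

Lemma measurable_grown j : measurable (gI j) (gA j) (grown j).
Proof.
elim: j => [|j IH] w w' ww'; first by apply/forallP/forallP => _ [].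
have [e1 m1] := ingrow_ok j; rewrite !grownS.
have H (X : Type) (f : Om -> X) : measurable (gI j) (gA j) f -> f w' = f w.
  by move=> mf; have := measurable_step (T := gT j) (Z := fun=> set0) e1 mf; apply.
by rewrite (H _ _ IH) (H _ _ m1) ((ingrow_ok j.+1).2 _ _ ww').
Qed.

Variables (Gd : pred Om) (t alpha : R) (J : nat).
Hypotheses (mG : measurable I A Gd) (t0 : 0 < t) (al0 : 0 <= alpha) (al : alpha * (1 + Gam) ^+ J <= th).
Hypothesis Gok : forall w, Gd w -> [&& [disjoint T w & I w], T w \subset A w, I w \subset A w,
   t <= #|T w|%:R & #|A w|%:R <= alpha * N].

Lemma grown_facts j w : Gd w -> grown j w ->
  [&& [disjoint gT j w & gI j w], gT j w \subset gA j w, gI j w \subset gA j w,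
   gam ^+ j * #|T w|%:R <= #|gT j w|%:R & #|gA j w|%:R <= (1 + Gam) ^+ j * (alpha * N)].
Proof.
move=> Gw; have /and5P[h1 h2 h3 h4 h5] := Gok Gw.
elim: j => [|j IH]; first by rewrite /gT /gI /gA /= h1 h2 h3 !expr0 !mul1r lexx h5.
rewrite grownS => /andP[/IH/and5P[i1 i2 i3 i4 i5] /andP[g1 g2]].
have dis : [disjoint gT j.+1 w & gA j w].
  by rewrite disjoint_subset; apply/subsetP => x; rewrite !inE => /andP[].
apply/and5P; split.
- by apply: disjointWr dis; rewrite /gI /= subUset i3 i2.
- by rewrite gA_S subsetUr.
- by rewrite gA_S /gI /= subUset !(subset_trans _ (subsetUl _ _)).
- rewrite exprS -mulrA; apply: le_trans g1; rewrite ler_wpM2l //; by move: gam1; lra.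
- rewrite gA_S exprS -mulrA; apply: (@le_trans _ _ ((1 + Gam) * #|gA j w|%:R)); last first.
    by rewrite ler_wpM2l // addr_ge0 ?Gam_ge0.
  rewrite mulrDl mul1r; apply: (@le_trans _ _ (#|gA j w| + #|gT j.+1 w|)%:R).
    by rewrite ler_nat leq_card_setU.
  rewrite natrD lerD2l; apply: le_trans g2 _; rewrite ler_wpM2l ?Gam_ge0 //.
  by rewrite ler_nat subset_leq_card.
Qed.

(** While all steps succeed, the frontier keeps at least [t] vertices and the choice of [alpha]
    keeps the discovered set below [th * N]; so each further step fails with probability at most
    [Cvar / t]. *)
Lemma grow_fail j : (j <= J)%N -> Pr q (fun w => Gd w && ~~ grown j w) <= j%:R * (Cvar / t) * Pr q Gd.
Proof.
have ct0 : 0 <= Cvar / t by rewrite divr_ge0 ?Cvar_ge0 // ltW.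
have PG0 : 0 <= Pr q Gd by apply: Pr_ge0 qge0 _.
elim: j => [|j IH] jJ.
  rewrite !mul0r; have <- : Pr q (fun=> false) = 0 by rewrite /Pr /Ex big1 // => w _; rewrite mulr0.
  apply: Pr_le => [|w /andP[_]]; first exact: qge0.
  by move/forallPn => -[[]].
have [e1 m1] := ingrow_ok j.
set Gj := fun w => Gd w && grown j w.
have mGj : measurable (gI j) (gA j) Gj.
  by move=> w w' ww'; rewrite /Gj (measurable_ingrow mG ww') (measurable_grown ww').
have N0 := N_gt0 R n.
have alN : (1 + Gam) ^+ j * alpha <= th.
  apply: le_trans al; rewrite mulrC ler_wpM2l // ler_weXn2l ?(ltnW jJ) //.
  by rewrite lerDl Gam_ge0.
have thN w : Gj w -> #|gA j w|%:R <= th * N.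
  move=> /andP[Gw gw]; have /and5P[_ _ _ _ h] := grown_facts Gw gw.
  by apply: le_trans h _; rewrite mulrA ler_wpM2r // ltW.
have half w : Gj w -> (#|gA j w|.*2 <= n.+1)%N.
  move=> /thN h; rewrite -(ler_nat R) -muln2 natrM -ler_pdivlMr //.
  by apply: le_trans h _; rewrite mulrC ler_wpM2l // ltW.
have ok1 w : Gj w -> [disjoint gT j w & gI j w] && (#|gI j w|.*2 <= n.+1)%N.
  move=> Gw; have /and5P[h1 h2 h3 _ _] := grown_facts (andP Gw).1 (andP Gw).2.
  rewrite h1 /=; apply: leq_trans (half _ Gw); by rewrite leq_double subset_leq_card.
have tT w : Gj w -> t <= #|gT j w|%:R.
  move=> Gw; have /and5P[_ _ _ h4 _] := grown_facts (andP Gw).1 (andP Gw).2.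
  have /and5P[_ _ _ k4 _] := Gok (andP Gw).1.
  by apply: le_trans h4; apply: le_trans k4 _; rewrite ler_peMl // exprn_ege1.
have ok2 w : Gj w -> [&& (0 < #|gT j w|)%N, #|gA j w|%:R <= th * N & #|gT j w|%:R <= th * N].
  move=> Gw; have /and5P[_ h2 _ _ _] := grown_facts (andP Gw).1 (andP Gw).2.
  rewrite thN //= -(ltr0n R) (lt_le_trans t0 (tT _ Gw)) /=.
  by apply: le_trans (thN _ Gw); rewrite ler_nat subset_leq_card.
have st := step_fail p0 p1 e1 m1 mGj ok1 g_lt gam'_ge0 g_le ok2 t0 tT.
apply: (@le_trans _ _ (Pr q (fun w => Gd w && ~~ grown j w) +
   Pr q (fun w => Gj w && ~~ grow #|hit w (gA j w) (gT j w)| #|gT j w|))).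
  apply: Pr_union => [|w /andP[Gw]]; first exact: qge0.
  by rewrite grownS negb_and /Gj Gw /=; case: (grown j w).
rewrite -natr1 !mulrDl mul1r; apply: lerD; first exact: IH (ltnW jJ).
apply: le_trans st _; rewrite ler_wpM2l //.
by apply: Pr_le => [|w /andP[]]; first exact: qge0.
Qed.

End InGrowth.
End Growth.

(** * Orbits of a single slot *)

Section Orbit.
Variables (R : realType) (n m : nat) (p : R) (d0 : 'I_m).
Hypotheses (p0 : 0 < p) (p1 : p <= 1) (d00 : d0 = 0%N :> nat).
Local Notation V := 'I_n.+1.
Local Notation N := (n.+1%:R : R).
Local Notation slot := ('I_m * V)%type.
Local Notation Om := {ffun slot -> V}.
Local Notation q := (@q R n m p).
Local Notation qge0 := (q_ge0 p0 p1).
Implicit Types (e : slot) (w : Om) (x y u v : V).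

Definition orb w u j := iter j (fun x => w (d0, x)) u.
Definition orbs u j w : {set V} := [set x | [exists i : 'I_j, orb w u i == x]].

Lemma orbs_mem u j w i : (i < j)%N -> orb w u i \in orbs u j w.
Proof. by move=> ij; rewrite inE; apply/existsP; exists (Ordinal ij). Qed.

Lemma orb_agree u j w w' : inr (block (fun=> set0) (orbs u j) w) w' ->
  forall i, (i <= j)%N -> orb w' u i = orb w u i.
Proof.
move=> /inr_blockP[H _]; elim=> [|i IH] // ij; rewrite /orb !iterS -!/(orb _ _ _) IH ?(ltnW ij) //.
by rewrite H // orbs_mem.
Qed.

Lemma explorable_orbs u j : explorable (fun=> set0) (orbs u j).
Proof.
split=> [w e _|w w' ww']; first by rewrite inE.
split=> //; apply/setP => x; rewrite !inE; apply: eq_existsb => i.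
by rewrite (orb_agree ww') // ltnW.
Qed.

(* At time [j] the orbit stays clear of the [K - j] lattice steps preceding any
   earlier point, so that following the lattice cannot close a cycle. *)
Definition clear u K j w := [forall i : 'I_j, forall c : 'I_(K - j).+1,
  iter c (@ordS n.+1) (orb w u j) != orb w u i].

Lemma clearP u K j w : reflect (forall i c, (i < j)%N -> (c <= K - j)%N ->
  iter c (@ordS n.+1) (orb w u j) != orb w u i) (clear u K j w).
Proof.
apply: (iffP forallP) => [H i c ij cK|H i]; last by apply/forallP => c; apply: H => //; rewrite -ltnS.
by have /forallP/(_ (Ordinal (n:=(K - j).+1) cK)) := H (Ordinal ij).
Qed.

Lemma iter_ordS_neq c x : (0 < c <= n)%N -> iter c (@ordS n.+1) x != x.
Proof.
move=> /andP[c0 cn]; rewrite iter_ordSE -subr_eq0 addrC addrA addNr add0r.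
by apply/eqP => /(congr1 val) /=; rewrite modn_small ?ltnS // => E; rewrite E in c0.
Qed.

(** Since [d0] is the unit lattice step, clearance keeps the lattice endpoint of the current point
    out of the bad set [B]; only a redraw can land there, and [B] has at most [K.+1 ^ 2]
    elements. *)
Lemma orb_step_fail u K j : (j < K)%N -> (K <= n)%N ->
  Pr q (fun w => clear u K j w && ~~ clear u K j.+1 w) <= K.+1%:R ^+ 2 / N.
Proof.
move=> jK Kn; have ex := explorable_orbs u j; have N0 := N_gt0 R n.
have bnd : 0 <= K.+1%:R ^+ 2 / N by rewrite divr_ge0 ?exprn_ge0.
have E1 : 1 = Pr q xpredT by rewrite -(Ex1 (q_sum1 p (m := m) (n := n))).
rewrite -[leRHS]mulr1 [X in _ <= _ * X]E1.
apply: (Pr_blocks qge0 (explorable_partitioning ex)) => // w _.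
set y := orb w u j.
set B := [set z | [exists i : 'I_j.+1, exists c : 'I_(K - j), iter c (@ordS n.+1) z == orb w u i]].
have cB : (#|B| <= K.+1 ^ 2)%N.
  pose h (ic : 'I_j.+1 * 'I_(K - j)) := iter ic.2 (@ord_pred n.+1) (orb w u ic.1).
  have sub : B \subset [set h ic | ic in setT].
    apply/subsetP => z; rewrite inE => /existsP[i /existsP[c /eqP zE]].
    apply/imsetP; exists (i, c) => //; rewrite /h /= -zE.
    elim: (c : nat) => [|k IH] //; by rewrite iterSr /= -iterS iterS ordSK.
  apply: leq_trans (subset_leq_card sub) _; apply: leq_trans (leq_imset_card _ _) _.
  rewrite cardsT card_prod !card_ord; apply: leq_mul => //.
    by rewrite ltnS ltnW.
  by apply: leq_trans (leq_subr _ _) (leqnSn _).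
case: (boolP (clear u K j w)) => [/clearP cl|ncl]; last first.
  rewrite (_ : Pr q _ = 0); first by apply: mulr_ge0 => //; apply: Pr_ge0 qge0 _.
  rewrite /Pr /Ex big1 // => w' _; case ww' : (inr _ _); rewrite ?mulr0 //=.
  suff -> : clear u K j w' = clear u K j w by rewrite (negbTE ncl) mulr0.
  apply: eq_forallb => i; apply: eq_forallb => c.
  by rewrite !(orb_agree ww') // ltnW.
have ynotin : y \notin orbs u j w.
  rewrite inE negb_exists; apply/forallP => i; rewrite eq_sym; exact: (cl i 0%N).
have latB : lat (d0, y) \notin B.
  rewrite inE /lat /cshift /= d00 /=; apply/existsP => -[i /existsP[c]].
  rewrite -iterSr; case: (ltnP i j) => ij.
    by apply/negP; apply: cl.
  have -> : orb w u i = y by rewrite /y; congr orb; apply/eqP; rewrite eqn_leq -ltnS ltn_ord ij.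
  apply/negP/iter_ordS_neq => /=; apply: leq_trans Kn.
  by apply: leq_trans (ltn_ord c) (leq_subr _ _).
have := Pr_slot q (block (fun=> set0) (orbs u j) w) (d0, y) B.
rewrite ffunE /= (negbTE ynotin) setC0 setTI.
have -> : qs q (d0, y) setT = 1 by rewrite -(q_sum1 p (d0, y)) /qs; apply: eq_bigl => z; rewrite inE.
rewrite mulr1 qs_eq // => E.
apply: (@le_trans _ _ (Pr q (fun w' => inr (block (fun=> set0) (orbs u j) w) w' && (w' (d0, y) \in B)))).
  apply: Pr_le => [|w' /andP[ww' /andP[_ ncl]]]; first exact: qge0.
  rewrite ww' /= inE; move: ncl; rewrite negb_forall => /existsP[i]; rewrite negb_forall => /existsP[c].
  rewrite negbK /orb iterS -!/(orb _ _ _) (orb_agree ww') //.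
  have ij : (i <= j)%N by rewrite -ltnS.
  rewrite (orb_agree ww' ij) => /eqP E'.
  have cK : (c < K - j)%N by apply: leq_trans (ltn_ord c) _; rewrite subnS prednK // subn_gt0.
  by apply/existsP; exists i; apply/existsP; exists (Ordinal cK); apply/eqP.
rewrite E ler_wpM2r ?Pr_ge0 //; first exact: qge0.
rewrite ler_pM2r ?invr_gt0 //; apply: (@le_trans _ _ #|B|%:R); first by rewrite ler_piMl.
by rewrite -natrX ler_nat.
Qed.

Lemma orb_fail u K : (K <= n)%N ->
  Pr q (fun w => ~~ [forall j : 'I_K.+1, clear u K j w]) <= K.+1%:R ^+ 3 / N.
Proof.
move=> Kn; have N0 := N_gt0 R n.
have bnd : 0 <= K.+1%:R ^+ 2 / N by rewrite divr_ge0 ?exprn_ge0.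
apply: (@le_trans _ _ (\sum_(j < K) Pr q (fun w => clear u K j w && ~~ clear u K j.+1 w))).
  apply: Pr_union_sum => [|w]; first exact: qge0.
  rewrite negb_forall => /existsP[j ncl].
  have cl0 : clear u K 0 w by apply/forallP => -[].
  have [i [ij [c1 c2]]] : exists i, (i < j)%N /\ clear u K i w /\ ~~ clear u K i.+1 w.
    elim: (j : nat) ncl => [|k IH]; first by rewrite cl0.
    case: (boolP (clear u K k w)) => [ck nck|nck _]; first by exists k.
    by have [i [ik H]] := IH nck; exists i; split=> //; apply: ltnW.
  have iK : (i < K)%N by apply: leq_trans ij _; rewrite -ltnS.
  by exists (Ordinal iK) => //=; rewrite c1.
apply: (@le_trans _ _ (\sum_(j < K) K.+1%:R ^+ 2 / N)).
  by apply: ler_sum => j _; apply: orb_step_fail.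
rewrite sumr_const card_ord -[leLHS]mulr_natr [_ ^+ 3]exprSr mulrAC ler_wpM2r ?invr_ge0 ?(ltW N0) //.
by rewrite ler_wpM2l ?exprn_ge0 // ler_nat.
Qed.

Lemma clear_inj u K w : [forall j : 'I_K.+1, clear u K j w] ->
  forall i j, (i < j <= K)%N -> orb w u i != orb w u j.
Proof.
move=> /forallP H i j /andP[ij jK]; rewrite eq_sym.
by have /clearP h := H (Ordinal (n:=K.+1) jK); exact: (h i 0%N ij isT).
Qed.

Lemma clear_card u K w : [forall j : 'I_K.+1, clear u K j w] -> #|orbs u K.+1 w| = K.+1.
Proof.
move=> H; have -> : orbs u K.+1 w = [set orb w u (i : 'I_K.+1) | i in setT].
  apply/setP => x; rewrite inE; apply/existsP/imsetP => -[i].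
    by move=> /eqP <-; exists i.
  by move=> _ ->; exists i.
rewrite card_in_imset ?cardsT ?card_ord // => i j _ _ E; apply/val_inj/eqP.
case: (ltngtP i j) => // ij.
  by have := clear_inj H (i := i) (j := j); rewrite ij -ltnS ltn_ord E eqxx => /(_ isT).
by have := clear_inj H (i := j) (j := i); rewrite ij -ltnS ltn_ord E eqxx => /(_ isT).
Qed.

Lemma orb_ball u j w : orb w u j \in ball (Gr w) j u.
Proof.
elim: j => [|j IH]; first by rewrite inE.
rewrite ballS inE; apply/orP; right; apply/nbrP; exists (orb w u j) => //.
by apply/orP; left; apply/existsP; exists d0; rewrite /orb iterS.
Qed.

Lemma orbs_ball u j w : orbs u j.+1 w \subset ball (Gr w) j u.
Proof.
apply/subsetP => x; rewrite inE => /existsP[i /eqP <-].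
by apply: (subsetP (ball_leq _ _ _)) (orb_ball _ _ _); rewrite -ltnS.
Qed.

End Orbit.

(** * Growth constants and escape from small balls *)

Section Asymptotics.
Variable R : realType.
Implicit Types x y : R.

Lemma nat_above x : exists k : nat, x <= k%:R.
Proof.
exists (Num.bound `|x|); apply: le_trans (ler_norm x) _.
by apply/ltW/archi_boundP.
Qed.

Lemma above_all x : exists n0, forall n, (n0 <= n)%N -> x <= n.+1%:R.
Proof.
have [k xk] := nat_above x; exists k => n kn; apply: le_trans xk _.
by rewrite ler_nat ltnW.
Qed.

Lemma bernoulli_exp y j : 1 <= y -> 1 + j%:R * (y - 1) <= y ^+ j.
Proof.
move=> y1; elim: j => [|j IH]; first by rewrite mul0r addr0 expr0.
rewrite exprS; apply: le_trans (ler_wpM2l _ IH); last by lra.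
have : 0 <= j%:R * (y - 1) ^+ 2 by rewrite mulr_ge0 ?sqr_ge0.
by rewrite -natr1; move: (j%:R : R) => c; lra.
Qed.

Lemma expr_above x y : 1 < y -> exists j : nat, x <= y ^+ j.
Proof.
move=> y1; have [k xk] := nat_above (x / (y - 1)); exists k.
have y0 : 0 < y - 1 by lra.
apply: le_trans (bernoulli_exp k (ltW y1)).
by rewrite ler_pdivrMr // in xk; apply: le_trans xk _; rewrite lerDr.
Qed.

Lemma growth_constants (m : nat) (p : R) : 0 < p -> 1 < p * m%:R ->
  exists gam gam' th : R, [/\ 1 < gam, gam < gam', 0 < th, th <= 2^-1 &
    gam' * (1 + m%:R * th) <= p * m%:R * (1 - th)].
Proof.
move=> p0; set c := p * m%:R => c1.
have m0 : 0 <= m%:R :> R by [].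
(* The excess [c - 1] is cut in thirds: one up to [gam], one from [gam] to [gam'], and one that is
   spent on solving the last inequality for [th]. *)
set g' := 1 + 2 * (c - 1) / 3.
have d0 : 0 < 3 * (g' * m%:R + c) by rewrite mulr_gt0 // ltr_wpDl ?mulr_ge0 // /g'; lra.
exists (1 + (c - 1) / 3), g', (Num.min 2^-1 ((c - 1) / (3 * (g' * m%:R + c)))).
split; [lra | rewrite /g'; lra | | by rewrite ge_min lexx | ].
  by rewrite lt_min invr_gt0 ltr0n divr_gt0 //; lra.
set th := Num.min _ _.
have : th <= (c - 1) / (3 * (g' * m%:R + c)) by rewrite ge_min lexx orbT.
rewrite ler_pdivlMr // => H; move: H; rewrite /g'; move: (m%:R) => M; nra.
Qed.

End Asymptotics.

Lemma gT_ball n m (I A T : {ffun 'I_m * 'I_n.+1 -> 'I_n.+1} -> {set 'I_n.+1}) j k u w :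
  T w \subset ball (Gr w) k u -> gT I A T j w \subset ball (Gr w) (k + j) u.
Proof.
move=> Tk; elim: j => [|j IH]; first by rewrite addn0.
rewrite addnS; apply: subset_trans (nbr_ball IH).
apply/subsetP => x; rewrite inE => /andP[_ /existsP[d xd]].
apply/nbrP; exists (w (d, x)) => //; by apply/orP; right; apply/existsP; exists d.
Qed.

Section Reach.
Variables (R : realType) (m : nat) (p : R) (d0 : 'I_m).
Hypotheses (p0 : 0 < p) (p1 : p <= 1) (d00 : d0 = 0%N :> nat).
Variables (gam gam' th : R).
Hypotheses (gam1 : 1 < gam) (g_lt : gam < gam') (th0 : 0 < th) (th2 : th <= 2^-1).
Hypothesis (g_le : gam' * (1 + m%:R * th) <= p * m%:R * (1 - th)).
Local Notation Gam := (Gam m p gam gam').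
Local Notation Cvar := (Cvar m p gam gam').
Local Notation Gr := (@Gr _ m).

(** A single vertex gives no concentration. An orbit of [L.+1] vertices makes the Chebyshev failures
    small, and [j] backward steps then multiply it by at least [2 * K]. The lemma serves to exclude
    that all layers up to depth [c] are smaller than [K]. *)
Lemma reach (K : nat) (eta : R) : (0 < K)%N -> 0 < eta -> exists c n0, forall n, (n0 <= n)%N ->
  forall u : 'I_n.+1, Pr (@q R n m p) (fun w => #|ball (Gr w) c u| <= K * c.+1)%N <= eta.
Proof.
move=> K0 eta0; have C0 := Cvar_ge0 m p0 g_lt; have G0 := Gam_ge0 m p0 g_lt.
have [j Kj] := expr_above (2 * K%:R) gam1.
have [L0 HL0] := nat_above (2 * j%:R * Cvar / eta).
(* [L >= j] makes [2 * K * L.+1] exceed [K * (L + j).+1], where [L + j] is the final radius. *)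
have [L [HLj HL0']] : exists L, (j <= L)%N /\ (L0 <= L)%N by exists (maxn j L0); rewrite leq_maxl leq_maxr.
have jL : (j <= L)%N by [].
have HL : j%:R * (Cvar / L.+1%:R) <= eta / 2.
  rewrite mulrA ler_pdivrMr //; move: HL0; rewrite ler_pdivrMr // => HL0.
  have : L0%:R <= L.+1%:R :> R by rewrite ler_nat ltnW // ltnS.
  by move: HL0; nra.
set alpha := th / (1 + Gam) ^+ j.
have al0 : 0 < alpha by rewrite divr_gt0 // exprn_gt0 // ltr_pwDl.
have [n1 Hn1] := above_all (L.+1%:R / alpha).
have [n2 Hn2] := above_all (2 * L.+1%:R ^+ 3 / eta).
exists (L + j)%N, (maxn L (maxn n1 n2)) => n; rewrite 2!geq_max => /and3P[Ln n1n n2n] u.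
have N0 := N_gt0 R n; have qge0 := q_ge0 (n := n) (m := m) p0 p1.
set A := orbs d0 u L.+1.
have ex := explorable_orbs d0 u L.+1.
pose Gd := fun w : {ffun 'I_m * 'I_n.+1 -> 'I_n.+1} => [forall i : 'I_L.+1, clear d0 u L i w].
have mG : measurable (fun=> set0) A Gd.
  move=> w w' ww'; apply: eq_forallb => i; apply: eq_forallb => l; apply: eq_forallb => c.
  by rewrite !(orb_agree ww') // ltnW // (ltn_trans (ltn_ord l)).
have Gok w : Gd w -> [&& [disjoint A w & set0], A w \subset A w, set0 \subset A w,
   L.+1%:R <= #|A w|%:R :> R & #|A w|%:R <= alpha * n.+1%:R].
  move=> Gw; rewrite subxx sub0set (clear_card Gw) lexx /= -setI_eq0 setI0 eqxx /=.
  by have := Hn1 _ n1n; rewrite ler_pdivrMr // mulrC.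
have mA : measurable (fun=> set0) A A := measurableA ex.
have alJ : alpha * (1 + Gam) ^+ j <= th by rewrite divfK // gt_eqF // exprn_gt0 // ltr_pwDl.
have L0' : 0 < L.+1%:R :> R by [].
have gf := grow_fail p0 p1 (ltW gam1) g_lt th2 g_le ex mA mG L0' (ltW al0) alJ Gok (leqnn j).
apply: (@le_trans _ _ (Pr (@q R n m p) (fun w => ~~ Gd w) + Pr (@q R n m p)
    (fun w => Gd w && ~~ grown p gam gam' (fun=> set0) A A j w))).
  apply: Pr_union => // w small; case Gw : (Gd w) => //=.
  apply/negP => gw; have /and5P[_ _ _ h _] := grown_facts p0 (ltW gam1) g_lt Gok Gw gw.
  move: h; rewrite (clear_card Gw) => h.
  have AB : A w \subset ball (Gr w) L u by apply: orbs_ball.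
  have gB := gT_ball (fun=> set0) A j AB.
  have h2 : 2 * K%:R * L.+1%:R <= #|ball (Gr w) (L + j) u|%:R :> R.
    apply: le_trans (le_trans _ h) _; first by rewrite ler_wpM2r.
    by rewrite ler_nat subset_leq_card.
  move: h2; rewrite -!natrM ler_nat => h2.
  have := leq_trans h2 small; rewrite -mulnA mulnCA leq_pmul2l //.
  by move: jL; clear; lia.
have -> : eta = eta / 2 + eta / 2 by lra.
apply: lerD.
  apply: le_trans (orb_fail p0 p1 d00 u Ln) _.
  have := Hn2 _ n2n; rewrite !ler_pdivrMr //; lra.
apply: le_trans gf _; apply: le_trans HL; rewrite ler_piMr ?Pr_le1 //; last exact: q_sum1.
by rewrite mulr_ge0 // divr_ge0.
Qed.

End Reach.

(** * Frontiers *)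

Section Frontier.
Variables (R : realType) (n m : nat) (p : R) (s : nat).
Hypotheses (p0 : 0 < p) (p1 : p <= 1) (s0 : (0 < s)%N) (sN : 4 * s%:R <= p * n.+1%:R).
Variables (gam gam' th : R).
Hypotheses (gam1 : 1 < gam) (g_lt : gam < gam') (sth : s%:R <= th * n.+1%:R).
Hypothesis (g_le : gam' * (1 + m%:R * th) <= p * m%:R * (1 - th)).
Local Notation Cvar := (Cvar m p gam gam').
Local Notation V := 'I_n.+1.
Local Notation N := (n.+1%:R : R).
Local Notation slot := ('I_m * V)%type.
Local Notation Om := {ffun slot -> V}.
Local Notation q := (@q R n m p).
Local Notation qge0 := (q_ge0 p0 p1).
Variable u : V.
Implicit Types (w : Om).
Local Notation SA := (SA s u).
Local Notation SI := (SI s u).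
Local Notation ST := (ST s u).

Definition layer k w := #|SA k w :\: SI k w|.
Local Notation D := layer.
Definition active k w := (#|SA k w| < s)%N.

Lemma layer_S k w : active k w -> D k.+1 w = #|SA k.+1 w :\: SA k w|.
Proof. by move=> a; rewrite /D (active_SI a). Qed.

Lemma card_SA_S k w : active k w -> #|SA k.+1 w| = (#|SA k w| + D k.+1 w)%N.
Proof.
by move=> a; rewrite layer_S // -(cardsID (SA k w) (SA k.+1 w)) (setIidPr (SA_mono _ _ _ _)).
Qed.

Lemma layer_stop k w : ~~ active k w -> D k.+1 w = D k w /\ #|SA k.+1 w| = #|SA k w|.
Proof. by rewrite -leqNgt => /stopped_SA[E1 E2]; rewrite /D E1 E2. Qed.

Lemma card_ST k w : active k w -> #|ST k w| = D k w.
Proof. by rewrite /active /ST => ->. Qed.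

Lemma hit_layer k w : active k w -> (#|hit w (SA k w) (ST k w)| <= D k.+1 w)%N.
Proof.
move=> a; rewrite layer_S //; apply/subset_leq_card/subsetP => x xh; rewrite inE.
have -> : x \notin SA k w by move: xh; rewrite inE => /andP[].
by rewrite SA_S nbrE; apply/setUP; left; apply/setUP; right.
Qed.

Lemma measurable_layer k : measurable (SI k) (SA k) (D k).
Proof.
have ex := @explorable_S n m s u k.
by move=> w w' ww'; rewrite /D (measurableA ex ww') (measurableI ex ww').
Qed.

Lemma measurable_active k : measurable (SI k) (SA k) (active k).
Proof.
have ex := @explorable_S n m s u k.
by move=> w w' ww'; rewrite /active (measurableA ex ww').
Qed.

Variables (K l : nat).
Hypothesis K0 : (0 < K)%N.

(** Growth is monitored from the first layer with [K] vertices on, where the failure bound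
    [Cvar / K] is small; for different [l] these events are disjoint. *)
Definition first_big w := (K <= D l w)%N && [forall i : 'I_l, (D i w < K)%N].
Definition expanding k w := [forall i : 'I_k, (l <= i)%N ==> active i w ==> (gam * (D i w)%:R <= (D i.+1 w)%:R)].

Lemma expandingS k w : expanding k.+1 w =
  expanding k w && ((l <= k)%N ==> active k w ==> (gam * (D k w)%:R <= (D k.+1 w)%:R)).
Proof.
apply/forallP/andP => [H|[/forallP H1 H2] [i ij]].
  split; last exact: (H ord_max).
  by apply/forallP => -[i ij]; exact: (H (Ordinal (leqW ij))).
by case: (ltngtP i k) (ij) => [ij' _|ji|->] //=; [exact: (H1 (Ordinal ij')) | rewrite ltnS leqNgt ji].
Qed.

Lemma measurable_first k : (l <= k)%N -> measurable (SI k) (SA k) first_big.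
Proof.
move=> lk w w' ww'; rewrite /first_big.
have mD i : (i <= k)%N -> D i w' = D i w.
  by move=> ik; exact: (measurable_S_leq ik (measurable_layer (k := i)) ww').
rewrite mD //; congr andb; apply: eq_forallb => i; rewrite mD //.
by apply: leq_trans (ltnW (ltn_ord i)) lk.
Qed.

Lemma measurable_expanding k : measurable (SI k) (SA k) (expanding k).
Proof.
move=> w w' ww'; have mD i : (i <= k)%N -> D i w' = D i w.
  by move=> ik; exact: (measurable_S_leq ik (measurable_layer (k := i)) ww').
have mA i : (i <= k)%N -> active i w' = active i w.
  by move=> ik; exact: (measurable_S_leq ik (measurable_active (k := i)) ww').
by apply: eq_forallb => i; rewrite !mD ?mA // ltnW.
Qed.

Lemma expanding_layer k w : (l <= k)%N -> first_big w -> expanding k w -> (K <= D k w)%N.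
Proof.
move=> /subnK <-; move: (k - l)%N => j /andP[KD _]; elim: j => [|j IH]; first by rewrite add0n.
rewrite addSn expandingS leq_addl /= => /andP[/IH h].
case: (boolP (active (j + l) w)) => [a /= g|na _]; last by rewrite (layer_stop na).1.
apply: leq_trans h _; rewrite -(ler_nat R); apply: le_trans g; by rewrite ler_peMl // ltW.
Qed.

(** [Cvar] times the geometric series of ratio [1 / gam], since the failure bounds decrease
    geometrically along growing layers. *)
Definition Cpot := Cvar * gam / (gam - 1).

Lemma Cpot_ge0 : 0 <= Cpot.
Proof.
have h : 0 <= Cvar := Cvar_ge0 m p0 g_lt.
by apply: divr_ge0; [apply: mulr_ge0 => // |]; move: gam1; lra.
Qed.

Lemma Cpot_eq : Cvar + Cpot / gam = Cpot.
Proof. by rewrite /Cpot; field; apply/andP; split; apply/eqP; move: gam1; lra. Qed.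

(* The chance that the next layer fails to grow is at most [Cvar / D], so that
   [Cpot / D] is a supermartingale potential dominating all later failures. *)
Lemma potential k : (l <= k)%N ->
  Pr q (fun w => first_big w && ~~ expanding k w) +
  Ex q (fun w => (first_big w && expanding k w)%:R * (Cpot / (D k w)%:R)) <= Cpot / K%:R * Pr q first_big.
Proof.
have C0 := Cpot_ge0; have V0 : 0 <= Cvar := Cvar_ge0 m p0 g_lt.
have K0' : 0 < K%:R :> R by rewrite ltr0n.
have Dpos k' w : (l <= k')%N -> first_big w -> expanding k' w -> 0 < (D k' w)%:R :> R.
  by move=> lk Fw Ew; rewrite ltr0n (leq_trans K0) // expanding_layer.
move=> /subnK <-; move: (k - l)%N => j; elim: j => [|j IH].
  have E w : expanding (0 + l) w by apply/forallP => -[i]; rewrite add0n /= => il; rewrite leqNgt il.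
  rewrite (Pr_eq q (E' := fun=> false)) => [|w]; last by rewrite E andbF.
  rewrite /Pr [X in X + _]/Ex big1 ?add0r => [|w _]; last by rewrite mulr0.
  rewrite -ExZ; apply: Ex_le => [|w]; first exact: qge0.
  rewrite E andbT mulrC; case Fw : (first_big w); rewrite ?mulr0 ?mulr1 //.
  have := Dpos _ w (leq_addl 0 l) Fw (E w); rewrite add0n => Dp.
  by rewrite ler_wpM2l // lef_pV2 ?posrE // ler_nat; case/andP: Fw.
rewrite addSn; set k' := (j + l)%N in IH *.
have lk : (l <= k')%N by rewrite leq_addl.
have ex := @explorable_S n m s u k'.
pose G := fun w => [&& first_big w, expanding k' w & active k' w].
have mG : measurable (SI k') (SA k') G.
  by move=> w w' ww'; rewrite /G (measurable_first lk ww') (measurable_expanding ww') (measurable_active ww').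
have Gok w : G w -> [disjoint ST k' w & SI k' w] && (#|SI k' w|.*2 <= n.+1)%N.
  move=> _; rewrite ST_disj /=; apply: leq_trans (s2N p1 sN); by rewrite leq_double ltnW // card_SI.
have Gok' w : G w -> [&& (0 < #|ST k' w|)%N, #|SA k' w|%:R <= th * N & #|ST k' w|%:R <= th * N].
  move=> /and3P[Fw Ew aw]; have h : #|SA k' w|%:R <= th * N.
    by apply: le_trans sth; rewrite ler_nat ltnW.
  rewrite h card_ST // (leq_trans K0) ?expanding_layer //=.
  by apply: le_trans h; rewrite ler_nat subset_leq_card // subsetDl.
have st := step_fail_Ex p0 p1 ex (@measurable_ST n m s u k') mG Gok g_lt (gam'_ge0 (ltW gam1) g_lt) g_le Gok'.
apply: le_trans IH.
apply: (@le_trans _ _ (Pr q (fun w => first_big w && ~~ expanding k' w) +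
  (Ex q (fun w => (G w)%:R * (Cvar / #|ST k' w|%:R)) +
   Ex q (fun w => (first_big w && expanding k'.+1 w)%:R * (Cpot / (D k'.+1 w)%:R))))).
  rewrite addrA lerD2r; apply: le_trans (lerD (lexx _) st).
  apply: Pr_union => [|w /andP[Fw]]; first exact: qge0.
  rewrite expandingS lk /= negb_and /G Fw /=; case: (expanding k' w) => //=.
  case aw : (active k' w) => //=; rewrite /grows card_ST //; apply: contra => /andP[h _].
  by apply: le_trans h _; rewrite ler_nat hit_layer.
rewrite lerD2l -ExD; apply: Ex_le => [|w]; first exact: qge0.
rewrite expandingS lk /G /=; case Fw : (first_big w); rewrite /= ?mul0r ?addr0 //.
case Ew : (expanding k' w); rewrite /= ?mul0r ?addr0 // !mul1r.
have Dp := Dpos _ _ lk Fw Ew.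
case: (boolP (active k' w)) => aw /=; last by rewrite mul0r add0r mul1r (layer_stop aw).1.
rewrite mul1r card_ST // -[X in _ <= X / _]Cpot_eq mulrDl lerD2l.
have g0 : 0 < gam by move: gam1; lra.
case: (leP (gam * _) _) => [h|_]; last first.
  by rewrite mul0r; apply: divr_ge0 => //; apply: divr_ge0 => //; apply: ltW.
have gD : 0 < gam * (D k' w)%:R by rewrite mulr_gt0.
move: Cpot C0 => c c0.
by rewrite mul1r -mulrA ler_wpM2l // -invfM lef_pV2 ?posrE ?(lt_le_trans gD h).
Qed.

Lemma fail_le k : (l <= k)%N ->
  Pr q (fun w => first_big w && ~~ expanding k w) <= Cpot / K%:R * Pr q first_big.
Proof.
move=> lk; apply: le_trans (potential lk); rewrite lerDl; apply: Ex_ge0 => [|w]; first exact: qge0.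
by rewrite mulr_ge0 // divr_ge0 // Cpot_ge0.
Qed.

(** The geometric series of ratio [1 / gam]: geometrically growing layers have together at most
    [gfac] times the size of the last one. *)
Definition gfac := gam / (gam - 1).

Lemma SA_le_early k w : (forall i, (i < k)%N -> (D i w < K)%N) -> (#|SA k w| <= K * k + D k w)%N.
Proof.
elim: k => [|k IH] H; first by rewrite /D /= setD0 leq_addl.
have {}IH := IH (fun i ik => H i (ltnW ik)); have Dk := H k (ltnSn k).
case: (boolP (active k w)) => [a|/layer_stop[-> ->]].
  by rewrite card_SA_S // leq_add2r mulnSr (leq_trans IH) // leq_add2l ltnW.
by apply: leq_trans IH _; rewrite leq_add2r leq_mul2l leqnSn orbT.
Qed.

Lemma SA_le_late k w : (l <= k)%N -> first_big w -> expanding k w ->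
  #|SA k w|%:R <= (K * l)%:R + gfac * (D k w)%:R.
Proof.
have g1 : 1 <= gfac by rewrite /gfac ler_pdivlMr; move: gam1; lra.
have gE : gfac = gfac / gam + 1.
  by rewrite /gfac; field; apply/andP; split; apply/eqP; move: gam1; lra.
move=> /subnK <-; move: (k - l)%N => j /andP[KD /forallP H]; elim: j => [|j IH].
  rewrite add0n => _; have := @SA_le_early l w (fun i il => H (Ordinal il)).
  rewrite -(ler_nat R) natrD => h; apply: le_trans h _; by rewrite lerD2l ler_peMl.
rewrite addSn expandingS leq_addl /= => /andP[/IH h].
case: (boolP (active (j + l) w)) => [a /= g|na _]; last by have [-> ->] := layer_stop na.
rewrite card_SA_S // natrD gE mulrDl mul1r addrA lerD2r; apply: le_trans h _; rewrite lerD2l.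
rewrite -mulrA ler_wpM2l //; first by apply: le_trans g1.
by rewrite ler_pdivlMl //; move: gam1; lra.
Qed.

End Frontier.

(** * Small frontiers and slow explorations are unlikely *)

Section FrontierFail.
Variables (R : realType) (n m : nat) (p : R) (s : nat).
Hypotheses (p0 : 0 < p) (p1 : p <= 1) (s0 : (0 < s)%N) (sN : 4 * s%:R <= p * n.+1%:R).
Variables (gam gam' th : R).
Hypotheses (gam1 : 1 < gam) (g_lt : gam < gam') (sth : s%:R <= th * n.+1%:R).
Hypothesis (g_le : gam' * (1 + m%:R * th) <= p * m%:R * (1 - th)).
Local Notation q := (@q R n m p).
Local Notation qge0 := (q_ge0 p0 p1).
Local Notation Cpot := (Cpot m p gam gam').
Local Notation gfac := (gfac gam).

(** Either some layer up to depth [c] reaches [K], and [E] forces a later failure of growth,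
    controlled by the potential; or none does, and the ball of radius [c] has at most [K * c.+1]
    vertices. *)
Lemma chain_cover (K c : nat) u r (E : pred {ffun 'I_m * 'I_n.+1 -> 'I_n.+1}) : (0 < K)%N -> (K * c.+1 <= s)%N ->
  (forall w l, E w -> (l <= c)%N -> first_big s u K l w ->
     (l <= r)%N && ~~ expanding s gam u l r w) ->
  Pr q E <= Cpot / K%:R + Pr q (fun w => #|ball (Gr w) c u| <= K * c.+1)%N.
Proof.
move=> K0 Kc EH; have C0 : 0 <= Cpot := Cpot_ge0 m p0 gam1 g_lt.
have CK0 : 0 <= Cpot / K%:R by rewrite divr_ge0.
pose E1 l (w : {ffun 'I_m * 'I_n.+1 -> 'I_n.+1}) := [&& (l <= r)%N, first_big s u K l w & ~~ expanding s gam u l r w].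
pose E2 (w : {ffun 'I_m * 'I_n.+1 -> 'I_n.+1}) := (#|ball (Gr w) c u| <= K * c.+1)%N.
apply: (@le_trans _ _ (Pr q (fun w => [exists l : 'I_c.+1, E1 l w]) + Pr q E2)).
  apply: Pr_union => [|w Ew]; first exact: qge0.
  case: (boolP [forall l : 'I_c.+1, (layer s u l w < K)%N]) => [/forallP small|].
    apply/orP; right; rewrite /E2.
    have h2 : (#|SA s u c w| <= K * c + layer s u c w)%N.
      by apply: SA_le_early => i ic; exact: (small (Ordinal (leqW ic))).
    have := small ord_max; rewrite /= => h1.
    have h3 : (#|SA s u c w| < s)%N.
      apply: leq_ltn_trans h2 _; apply: leq_trans (_ : (K * c + K <= s)%N); first by rewrite ltn_add2l.
      by rewrite addnC -mulnS.
    have [_ [_ E']] := SA_ball s u c w; rewrite -(E' h3) mulnS addnC.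
    by apply: leq_trans h2 _; rewrite leq_add2l ltnW.
  rewrite negb_forall => /existsP[l1]; rewrite -leqNgt => big1.
  have ex : exists l, (K <= layer s u l w)%N by exists l1.
  case: (ex_minnP ex) => l lK lmin; apply/orP; left.
  have lc : (l <= c)%N by apply: leq_trans (lmin _ big1) _; rewrite -ltnS.
  have first : first_big s u K l w.
    by rewrite /first_big lK; apply/forallP => i; rewrite ltnNge; apply/negP => /lmin; rewrite leqNgt ltn_ord.
  apply/existsP; exists (Ordinal (n:=c.+1) lc); rewrite /E1 /= first /=.
  exact: EH Ew lc first.
rewrite lerD2r; apply: (@le_trans _ _ (\sum_(l < c.+1) Pr q (E1 l))).
  apply: Pr_union_sum => [|w /existsP[l El]]; first exact: qge0.
  by exists l.
apply: (@le_trans _ _ (\sum_(l < c.+1) Cpot / K%:R * Pr q (first_big s u K l))).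
  apply: ler_sum => l _; rewrite /E1; case: (leqP l r) => [lr|_] /=.
    exact: (fail_le p0 p1 s0 sN gam1 g_lt sth g_le).
  rewrite (_ : Pr q _ = 0); first by rewrite mulr_ge0 // Pr_ge0 //; exact: qge0.
  by rewrite /Pr /Ex big1 // => w _; rewrite mulr0.
(* At most one depth carries the first big layer, so these probabilities sum to at most 1. *)
rewrite -mulr_sumr ler_piMr // -[leRHS](Ex1 (q_sum1 p (m := m) (n := n))) /Pr -Ex_sum.
apply: Ex_le => [|w]; first exact: qge0.
case: (pickP (fun l : 'I_c.+1 => first_big s u K l w)) => [l Fl|no]; last first.
  by rewrite big1 // => l _; rewrite no.
rewrite (bigD1 l) //= Fl big1 ?addr0 // => i il; case Fi : (first_big s u K i w) => //.
move: Fl Fi => /andP[Kl /forallP Fl] /andP[Ki /forallP Fi].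
case: (ltngtP i l) => il'.
- by have := Fl (Ordinal il'); rewrite /= ltnNge Ki.
- by have := Fi (Ordinal il'); rewrite /= ltnNge Kl.
- by case/eqP: il; apply/val_inj.
Qed.

(** Without a failure of growth, the early layers hold at most [K * l <= s / 2] vertices and the
    later ones at most [gfac] times the last layer, which must therefore have at least
    [s / (2 * gfac)] vertices. *)
Lemma frontier_fail (K c : nat) u r : (0 < K)%N -> ((K * c.+1).*2 <= s)%N ->
  Pr q (fun w => (s <= #|SA s u r w|)%N && ((layer s u r w)%:R * (2 * gfac) < s%:R)) <=
  Cpot / K%:R + Pr q (fun w => #|ball (Gr w) c u| <= K * c.+1)%N.
Proof.
move=> K0 Kc; have gf1 : 1 <= gfac by rewrite /gfac ler_pdivlMr; move: gam1; lra.
apply: chain_cover (r) _ K0 _ _; first by apply: leq_trans Kc; rewrite -addnn leq_addr.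
move=> w l /andP[sA lay] lc first.
have bound : (K * l)%:R <= s%:R / 2 :> R.
  rewrite ler_pdivlMr // -natrM ler_nat muln2; apply: leq_trans Kc; rewrite leq_double leq_mul2l.
  by rewrite leqW ?orbT.
have concl : ~ (#|SA s u r w|%:R <= (K * l)%:R + gfac * (layer s u r w)%:R).
  move=> h; have : s%:R <= #|SA s u r w|%:R :> R by rewrite ler_nat.
  by move: lay; lra.
case: (leqP l r) => [lr|rl] /=.
  by apply/negP => ok; apply: concl; apply: SA_le_late ok.
exfalso; apply: concl; have h : (#|SA s u r w| <= K * r + layer s u r w)%N.
  apply: SA_le_early => i ir; have /andP[_ /forallP H] := first.
  exact: (H (Ordinal (ltn_trans ir rl))).
move: h; rewrite -(ler_nat R) natrD => h; apply: le_trans h _; apply: lerD.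
  by rewrite ler_nat leq_mul2l (ltnW rl) orbT.
by rewrite ler_peMl.
Qed.

(** Without a failure of growth, every layer after depth [c] adds at least [K] vertices until [s] is
    reached. *)
Lemma slow_fail (K c : nat) u r : (0 < K)%N -> (K * c.+1 <= s)%N -> (c <= r)%N -> (s <= K * (r - c))%N ->
  Pr q (fun w => #|SA s u r w| < s)%N <= Cpot / K%:R + Pr q (fun w => #|ball (Gr w) c u| <= K * c.+1)%N.
Proof.
move=> K0 Kc cr sK; apply: chain_cover (r) _ K0 Kc _ => w l slow lc first.
have lr : (l <= r)%N := leq_trans lc cr; rewrite lr /=; apply/negP => ok.
have act k : (k <= r)%N -> active s u k w.
  by move=> kr; apply: leq_ltn_trans slow; apply/subset_leq_card/SA_leq.
have okk k : (k <= r)%N -> expanding s gam u l k w.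
  move=> kr; apply/forallP => i; exact: (forallP ok (Ordinal (leq_trans (ltn_ord i) kr))).
have grow j : (l + j <= r)%N -> (K * j <= #|SA s u (l + j) w|)%N.
  elim: j => [|j IH] jr; first by rewrite muln0.
  rewrite addnS in jr *; rewrite card_SA_S ?act ?(ltnW jr) // mulnSr leq_add ?IH ?(ltnW jr) //.
  apply: (expanding_layer gam1 _ first (okk _ jr)); by rewrite leqW // leq_addr.
have := grow (r - l)%N; rewrite subnKC // leqnn => /(_ isT) h.
have : (s <= #|SA s u r w|)%N.
  by apply: leq_trans sK (leq_trans _ h); rewrite leq_mul2l leq_sub2l ?orbT.
by rewrite leqNgt slow.
Qed.

End FrontierFail.

Section FrontierAsymptotic.
Variables (R : realType) (m : nat) (p : R) (d0 : 'I_m).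
Hypotheses (p0 : 0 < p) (p1 : p <= 1) (d00 : d0 = 0%N :> nat).
Variables (gam gam' th : R).
Hypotheses (gam1 : 1 < gam) (g_lt : gam < gam') (th0 : 0 < th) (th2 : th <= 2^-1).
Hypothesis (g_le : gam' * (1 + m%:R * th) <= p * m%:R * (1 - th)).

Lemma frontier kappa : 0 < kappa -> exists s1 n0, forall n s, (n0 <= n)%N -> (s1 <= s)%N ->
  s%:R <= th * n.+1%:R -> 4 * s%:R <= p * n.+1%:R -> forall (u : 'I_n.+1) r,
  Pr (@q R n m p) (fun w => (s <= #|SA s u r w|)%N && ((layer s u r w)%:R * (2 * gfac gam) < s%:R)) <= kappa.
Proof.
move=> k0; have C0 : 0 <= Cpot m p gam gam' := Cpot_ge0 m p0 gam1 g_lt.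
have [K1 HK1] := nat_above (2 * Cpot m p gam gam' / kappa).
have K0 : (0 < K1.+1)%N by [].
have [c [n0 Hr]] := reach p0 p1 d00 gam1 g_lt th0 th2 g_le K0 (divr_gt0 k0 (ltr0n R 2)).
exists ((K1.+1 * c.+1).*2), n0 => n s n0n ss sth sN u r.
have s0 : (0 < s)%N by apply: leq_trans ss; rewrite double_gt0 muln_gt0.
apply: le_trans (frontier_fail p0 p1 s0 sN gam1 g_lt sth g_le _ _ K0 ss) _.
have -> : kappa = kappa / 2 + kappa / 2 by lra.
apply: lerD (Hr _ n0n u).
rewrite ler_pdivrMr //; move: HK1; rewrite ler_pdivrMr // => HK1.
have : K1%:R <= K1.+1%:R :> R by rewrite ler_nat.
by move: HK1; nra.
Qed.

End FrontierAsymptotic.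

(** * Composition and symmetry of balls *)

Section Balls.
Variables (n : nat) (G : graph n.+1).
Implicit Types u v x y : 'I_n.+1.

Lemma ball_edge k u x y : x \in ball G k u -> (x, y) \in G -> y \in ball G k.+1 u.
Proof.
move=> xk xy; rewrite ballS !inE; apply/orP; right; apply/existsP; exists x.
by rewrite xk.
Qed.

Lemma ball_trans k l u x y : x \in ball G k u -> y \in ball G l x -> y \in ball G (k + l) u.
Proof.
move=> xk; elim: l y => [|l IH] y; first by rewrite addn0 inE => /eqP ->.
rewrite ballS !inE addnS => /orP[/IH h|/existsP[z /andP[/IH zl zy]]].
  by apply: (subsetP (ball_leq G u (leqnSn _))).
exact: ball_edge zy.
Qed.

Lemma ball_split k l u v : v \in ball G (k + l) u -> exists2 x, x \in ball G k u & v \in ball G l x.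
Proof.
elim: l v => [|l IH] v; first by rewrite addn0; exists v; rewrite // inE.
rewrite addnS ballS !inE => /orP[/IH[x xk vl]|/existsP[y /andP[/IH[x xk yl] yv]]]; exists x => //.
  by apply: (subsetP (ball_leq G x (leqnSn _))).
exact: ball_edge yv.
Qed.

Hypothesis Gsym : forall x y, ((x, y) \in G) = ((y, x) \in G).

Lemma ball_sym k u v : (v \in ball G k u) = (u \in ball G k v).
Proof.
have imp a b : a \in ball G k b -> b \in ball G k a; last by apply/idP/idP; apply: imp.
elim: k a => [|k IH] a; first by rewrite !inE eq_sym.
rewrite -(addn1 k) => /ball_split[x xk]; rewrite ballS !inE => /orP[/eqP ->|].
  by apply: (subsetP (ball_leq G x (leq_addr 1 k))); apply: IH.
move=> /existsP[z /andP[]]; rewrite inE => /eqP -> xa; rewrite (addnC k).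
by apply: ball_trans (IH _ xk); apply: (@ball_edge 0 _ a); rewrite ?inE // Gsym.
Qed.

Lemma ball_meet k l u v : v \in ball G (k + l) u -> ~~ [disjoint ball G k u & ball G l v].
Proof.
move=> /ball_split[x xk xl]; rewrite -setI_eq0; apply/set0Pn; exists x.
by rewrite inE xk ball_sym.
Qed.

End Balls.

Lemma Gr_sym n m (w : {ffun 'I_m * 'I_n.+1 -> 'I_n.+1}) x y : ((x, y) \in Gr w) = ((y, x) \in Gr w).
Proof. by rewrite !inE /adj orbC. Qed.

(** Backward growth absorbs only undiscovered vertices, so the already discovered [W] stays out of
    the interior and remains a possible endpoint of unrevealed slots. *)
Lemma gI_disjoint n m (I A T : {ffun 'I_m * 'I_n.+1 -> 'I_n.+1} -> {set 'I_n.+1}) (W : {set 'I_n.+1}) w j :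
  [disjoint W & I w] -> [disjoint W & T w] -> W \subset A w ->
  [disjoint W & gI I A T j w] && (W \subset gA I A T j w) && [disjoint W & gT I A T j w].
Proof.
move=> WI WT WA; elim: j => [|j /andP[/andP[i1 i2] i3]]; first by rewrite /gI /gA /gT /= WI WA WT.
rewrite gA_S (subset_trans i2) ?subsetUl // andbT /gI /gT /= -/(gI I A T j w) -/(gT I A T j w).
apply/andP; split; first by rewrite disjoints_subset setCU subsetI -!disjoints_subset i1 i3.
rewrite disjoints_subset; apply/subsetP => x xW; rewrite !inE negb_and negbK.
by rewrite (subsetP i2 x xW).
Qed.

(** * Connecting two frontiers *)

Section Connect.
Variables (R : realType) (n m : nat) (p : R) (s : nat) (d0 d1 : 'I_m).
Hypotheses (p0 : 0 < p) (p1 : p <= 1) (s0 : (0 < s)%N) (d01 : d0 != d1).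
Variables (gam gam' th : R).
Hypotheses (gam1 : 1 < gam) (g_lt : gam < gam') (th2 : th <= 2^-1).
Hypothesis (g_le : gam' * (1 + m%:R * th) <= p * m%:R * (1 - th)).
Local Notation q := (@q R n m p).
Local Notation qge0 := (q_ge0 p0 p1).
Local Notation N := (n.+1%:R : R).
Local Notation Om := {ffun 'I_m * 'I_n.+1 -> 'I_n.+1}.
Local Notation Gam := (Gam m p gam gam').
Local Notation Cvar := (Cvar m p gam gam').
Implicit Types w : Om.
Variables (u v : 'I_n.+1) (r b : nat) (t alpha : R).
Hypotheses (t0 : 0 < t) (al0 : 0 <= alpha) (al : alpha * (1 + Gam) ^+ b <= th).

Definition pair_ready w := [&& [disjoint SA s u r w & SA s v r w],
  t <= (layer s u r w)%:R, t <= (layer s v r w)%:R &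
  (#|SA s u r w| + #|SA s v r w|)%:R <= alpha * N].

(* One frontier grows [b] steps backwards along incoming edges; then some vertex
   outside both explorations sends [d0] to one side and [d1] to the other. *)
Lemma pair_connect :
  Pr q (fun w => pair_ready w && (v \notin ball (Gr w) (r + r + b + 2) u)) <=
  b%:R * (Cvar / t) + 2 * N / (p ^+ 2 * (gam ^+ b * t) * t).
Proof.
pose I w := SI s u r w :|: SI s v r w; pose A w := SA s u r w :|: SA s v r w.
pose T w := SA s u r w :\: SI s u r w; pose W w := SA s v r w :\: SI s v r w.
have exu := @explorable_S n m s u r; have exv := @explorable_S n m s v r.
have ex : explorable I A := explorable_join exu exv.
have mu (X : Type) (f : Om -> X) : measurable (SI s u r) (SA s u r) f -> measurable I A f.
  exact: measurable_joinl.
have mv (X : Type) (f : Om -> X) : measurable (SI s v r) (SA s v r) f -> measurable I A f.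
  exact: measurable_joinr.
have mSAu := mu _ _ (measurableA exu); have mSIu := mu _ _ (measurableI exu).
have mSAv := mv _ _ (measurableA exv); have mSIv := mv _ _ (measurableI exv).
have mT : measurable I A T by move=> w w' ww'; rewrite /T (mSAu _ _ ww') (mSIu _ _ ww').
have mW : measurable I A W by move=> w w' ww'; rewrite /W (mSAv _ _ ww') (mSIv _ _ ww').
have mG : measurable I A pair_ready.
  move=> w w' ww'; rewrite /pair_ready /layer.
  by rewrite (mSAu _ _ ww') (mSIu _ _ ww') (mSAv _ _ ww') (mSIv _ _ ww').
have disTI w : pair_ready w -> [disjoint T w & I w] /\ [disjoint W w & I w].
  move=> /and4P[dis _ _ _]; split; rewrite disjoints_subset; apply/subsetP => x; rewrite !inE negb_or => /andP[-> xA] /=.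
    by apply/negP => /(subsetP (SI_sub _ _ _ _)); rewrite (disjointFr dis xA).
  rewrite andbT; apply/negP => /(subsetP (SI_sub _ _ _ _)) xu.
  by have := disjointFr dis xu; rewrite xA.
have Gok w : pair_ready w -> [&& [disjoint T w & I w], T w \subset A w, I w \subset A w,
   t <= #|T w|%:R & #|A w|%:R <= alpha * N].
  move=> Gw; rewrite (disTI w Gw).1 /=; case/and4P: Gw => dis tu tv al1; apply/and4P; split => //.
  - exact: subset_trans (subsetDl _ _) (subsetUl _ _).
  - by apply: setUSS; apply: SI_sub.
  - by apply: le_trans al1; rewrite ler_nat leq_card_setU.
have gf := grow_fail p0 p1 (ltW gam1) g_lt th2 g_le ex mT mG t0 al0 al Gok (leqnn b).
pose G' w := pair_ready w && grown p gam gam' I A T b w.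
have [exb mTb] := ingrow_ok ex mT b.
have mG' : measurable (gI I A T b) (gA I A T b) G'.
  move=> w w' ww'; rewrite /G' (measurable_ingrow ex mT mG ww').
  by rewrite (measurable_grown p gam gam' ex mT ww').
have mWb := measurable_ingrow ex mT mW (j := b).
have gb0 : 0 < gam ^+ b by rewrite exprn_gt0 //; move: gam1; lra.
have ok' w : G' w -> [&& [disjoint gT I A T b w & gI I A T b w], [disjoint W w & gI I A T b w],
   (#|gA I A T b w|.*2 <= n.+1)%N, gam ^+ b * t <= #|gT I A T b w|%:R & t <= #|W w|%:R].
  move=> /andP[Gw gw]; have /and5P[h1 h2 h3 h4 h5] := grown_facts p0 (ltW gam1) g_lt Gok Gw gw.
  have [TI WI] := disTI w Gw; case/and4P: (Gw) => dis tu tv _.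
  have WT : [disjoint W w & T w].
    rewrite disjoint_sym; apply: disjointWl (subsetDl _ _) _.
    by apply: disjointWr (subsetDl _ _) dis.
  have WA : W w \subset A w by apply: subset_trans (subsetDl _ _) (subsetUr _ _).
  have /andP[/andP[k1 k2] _] := gI_disjoint b WI WT WA.
  apply/and5P; split=> //.
    rewrite -(ler_nat R) -muln2 natrM -ler_pdivlMr //; apply: le_trans h5 _.
    rewrite mulrA [_ * alpha]mulrC [leRHS]mulrC; apply: ler_wpM2r; first exact/ltW/N_gt0.
    exact: le_trans al th2.
  apply: le_trans h4; rewrite ler_wpM2l ?(ltW gb0) //; by case/and4P: Gw.
have cf := connect_fail p0 p1 exb mTb mWb mG' d01 (mulr_gt0 gb0 t0) t0 ok'.
apply: (@le_trans _ _ (Pr q (fun w => pair_ready w && ~~ grown p gam gam' I A T b w) +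
  Pr q (fun w => G' w && [forall x in ~: gA I A T b w, ~~ links (gT I A T b w) d0 d1 (W w) x w]))).
  apply: Pr_union => [|w /andP[Gw nb]]; first exact: qge0.
  rewrite /G' Gw /=; case gw : (grown _ _ _ _ _ _ _ _) => //=.
  apply/forallP => x; apply/implyP => _; apply: contra nb => /andP[xT xW].
  have Tu : T w \subset ball (Gr w) r u.
    by apply: subset_trans (subsetDl _ _) (SA_ball s u r w).1.
  have h1 := subsetP (gT_ball I A b Tu) _ xT.
  have h2 : w (d1, x) \in ball (Gr w) r v.
    by apply: (subsetP (SA_ball s v r w).1); move: xW; rewrite inE => /andP[].
  have h3 : x \in ball (Gr w) (r + b).+1 u.
    apply: ball_edge h1 _; rewrite inE /adj; apply/orP; right; by apply/existsP; exists d0.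
  have h4 : w (d1, x) \in ball (Gr w) (r + b).+2 u.
    apply: ball_edge h3 _; rewrite inE /adj; apply/orP; left; by apply/existsP; exists d1.
  (* Radius [r], then [b] backward steps, two edges through the linking vertex, and radius [r] back
     to [v]. *)
  have -> : (r + r + b + 2 = (r + b).+2 + r)%N by clear; lia.
  by apply: ball_trans h4 _; rewrite ball_sym //; apply: Gr_sym.
apply: lerD.
  apply: le_trans gf _; rewrite ler_piMr ?Pr_le1 //; [|exact: qge0|exact: q_sum1].
  by rewrite mulr_ge0 // divr_ge0 ?(ltW t0) // Cvar_ge0.
apply: le_trans cf _; rewrite ler_piMr ?Pr_le1 //; [|exact: qge0|exact: q_sum1].
apply: divr_ge0; first by rewrite mulr_ge0.
apply: mulr_ge0; last exact: ltW.
by apply: mulr_ge0; [rewrite exprn_ge0 // ltW | apply/ltW/mulr_gt0].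
Qed.

End Connect.

(** * Vertices with fast explorations *)

Section Concentration.
Variables (R : realType) (n m : nat) (p : R) (s : nat).
Hypotheses (p0 : 0 < p) (p1 : p <= 1) (s0 : (0 < s)%N) (sN : 4 * s%:R <= p * n.+1%:R).
Local Notation q := (@q R n m p).
Local Notation qge0 := (q_ge0 p0 p1).
Local Notation N := (n.+1%:R : R).
Local Notation Om := {ffun 'I_m * 'I_n.+1 -> 'I_n.+1}.
Local Notation errdec := (errdec n m p s).
Implicit Types w : Om.
Variable r : nat.

Definition fast (u : 'I_n.+1) w := (s <= #|SA s u r w|)%N.
Definition meanfast := \sum_u Pr q (fast u).
Definition nfast w : R := \sum_u (fast u w)%:R.
Local Notation Q := meanfast.

Lemma sum_slow : \sum_u Pr q (fun w => #|SA s u r w| < s)%N = N - Q.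
Proof.
apply/eqP; rewrite eq_sym subr_eq -big_split /= (eq_bigr (fun=> 1)); first by rewrite sumr_const card_ord.
move=> u _; rewrite -[RHS](Ex1 (q_sum1 p (m := m) (n := n))) /Pr -ExD; apply: Ex_eq => w.
by rewrite /fast ltnNge; case: (s <= _)%N; rewrite ?addr0 ?add0r.
Qed.

Lemma meanfast_ge0 : 0 <= Q.
Proof. by apply: sumr_ge0 => u _; apply: Pr_ge0 qge0 _. Qed.

(** Two slow and disjoint explorations are whole balls of radius [r], so their centres are at
    distance more than [r + r]; by decoupling such pairs have total probability at least
    [(N - Q) ^+ 2] up to the error. *)
Lemma close_pairs : \sum_u \sum_v Pr q (fun w => v \in ball (Gr w) (r + r) u) <= 2 * Q * N + errdec * N ^+ 2.
Proof.
have dec := @decoupling R n m p s p0 p1 s0 sN r (fun k => k < s)%N (fun k => k < s)%N.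
rewrite !sum_slow in dec.
have tot : \sum_(u : 'I_n.+1) \sum_(v : 'I_n.+1) 1 = N ^+ 2 :> R.
  by rewrite !sumr_const card_ord -mulrnA -natrX.
apply: (@le_trans _ _ (N ^+ 2 - \sum_u \sum_v Pr q (fun w => [&& (#|SA s u r w| < s)%N,
   (#|SA s v r w| < s)%N & [disjoint SA s u r w & SA s v r w]]))).
  rewrite -tot -sumrB; apply: ler_sum => u _; rewrite -sumrB; apply: ler_sum => v _.
  rewrite lerBrDr -[leRHS](Ex1 (q_sum1 p (m := m) (n := n))) /Pr -ExD; apply: Ex_le => [|w]; first exact: qge0.
  case: (boolP (v \in _)) => [vb|_]; rewrite ?add0r ?lern1 ?leq_b1 //.
  case: (boolP [&& _, _ & _]) => [|_]; rewrite ?addr0 // => /and3P[su sv].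
  have [_ [_ ->//]] := SA_ball s u r w; have [_ [_ ->//]] := SA_ball s v r w.
  by rewrite (negbTE (ball_meet (@Gr_sym _ _ w) vb)).
have := meanfast_ge0; move: dec; rewrite !expr2; move: (\sum_u \sum_v _) => X; move: errdec Q N => a b c.
move=> *; nra.
Qed.

(** Decoupling gives only lower bounds, since it asks for disjointness. The upper bound comes by
    complement from the three combinations with a slow vertex, whence the factor 3. *)
Lemma nfast_moment2 : Ex q (fun w => nfast w ^+ 2) <= Q ^+ 2 + 3 * errdec * N ^+ 2.
Proof.
have d1 := @decoupling R n m p s p0 p1 s0 sN r (fun k => k < s)%N (fun k => k < s)%N.
have d2 := @decoupling R n m p s p0 p1 s0 sN r (fun k => k < s)%N (fun k => s <= k)%N.
have d3 := @decoupling R n m p s p0 p1 s0 sN r (fun k => s <= k)%N (fun k => k < s)%N.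
rewrite !sum_slow -/Q in d1 d2 d3.
have tot : \sum_(u : 'I_n.+1) \sum_(v : 'I_n.+1) 1 = N ^+ 2 :> R.
  by rewrite !sumr_const card_ord -mulrnA -natrX.
set S1 := \sum_u \sum_v _ in d1; set S2 := \sum_u \sum_v _ in d2; set S3 := \sum_u \sum_v _ in d3.
have E : Ex q (fun w => nfast w ^+ 2) + S1 + S2 + S3 <= N ^+ 2.
  have -> : Ex q (fun w => nfast w ^+ 2) = \sum_u \sum_v Pr q (fun w => fast u w && fast v w).
    rewrite (eq_bigr _ (fun u _ => esym (Ex_sum q xpredT _))) -Ex_sum; apply: Ex_eq => w.
    rewrite expr2 /nfast mulr_suml; apply: eq_bigr => u _; rewrite mulr_sumr; apply: eq_bigr => v _.
    by rewrite -natrM mulnb.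
  rewrite -tot /S1 /S2 /S3 -!big_split; apply: ler_sum => u _ /=; rewrite -!big_split; apply: ler_sum => v _ /=.
  rewrite -[leRHS](Ex1 (q_sum1 p (m := m) (n := n))) /Pr -!ExD; apply: Ex_le => [|w]; first exact: qge0.
  rewrite /fast !ltnNge -!natrD lern1.
  by case: (s <= #|SA s u r w|)%N; case: (s <= #|SA s v r w|)%N; case: [disjoint _ & _].
move: E d1 d2 d3; rewrite -/Q; move: (Ex q _) S1 S2 S3 => X S1 S2 S3.
rewrite !expr2; move: errdec Q N => a b c; lra.
Qed.

Lemma nfast_lower : 0 < Q -> Pr q (fun w => nfast w <= Q / 2) <= 12 * errdec * N ^+ 2 / Q ^+ 2.
Proof.
move=> Q0; have h0 : 0 < (Q / 2) ^+ 2 by rewrite exprn_gt0 // divr_gt0.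
apply: (@le_trans _ _ (Pr q (fun w => (Q / 2) ^+ 2 <= (nfast w - Q) ^+ 2))).
  apply: Pr_le => [|w h]; first exact: qge0.
  by rewrite -[leRHS]sqrrN; apply: lerXn2r; rewrite ?nnegrE; move: h Q0; lra.
apply: le_trans (markov qge0 h0 _) _; first by move=> w; apply: sqr_ge0.
have E1 : Ex q nfast = Q by rewrite Ex_sum.
have -> : Ex q (fun w => (nfast w - Q) ^+ 2) = Ex q (fun w => nfast w ^+ 2) - Q ^+ 2.
  have -> : Ex q (fun w => (nfast w - Q) ^+ 2) = Ex q (fun w => nfast w ^+ 2 + ((- (2 * Q)) * nfast w + Q ^+ 2)).
    by apply: Ex_eq => w; ring.
  by rewrite !ExD ExZ E1 Ex_cst; [ring | exact: q_sum1].
rewrite ler_pdivrMr //.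
have -> : 12 * errdec * N ^+ 2 / Q ^+ 2 * (Q / 2) ^+ 2 = 3 * errdec * N ^+ 2.
  by move: N errdec => a b; field; rewrite gt_eqF.
by have := nfast_moment2; lra.
Qed.

Definition Cdec : R := 8 * m%:R / p + 2 * m.+1%:R * (1 + Csize m p) ^+ 2.

Lemma Cdec_ge0 : 0 <= Cdec.
Proof.
apply: addr_ge0; first by apply: divr_ge0; [rewrite mulr_ge0 | apply: ltW].
by apply: mulr_ge0; [rewrite mulr_ge0 | rewrite exprn_ge0 // addr_ge0 // Csize_ge0].
Qed.

Lemma errdec_le : errdec <= Cdec * s%:R ^+ 2 / N.
Proof.
have N0 := N_gt0 R n; have C0 := Csize_ge0 m p0.
have s1 : 1 <= s%:R :> R by rewrite ler1n.
have B : (1 + Csize m p * s%:R) ^+ 2 <= (1 + Csize m p) ^+ 2 * s%:R ^+ 2.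
  have h1 : 0 <= 1 + Csize m p * s%:R by rewrite addr_ge0 // mulr_ge0.
  have h2 : 1 + Csize m p * s%:R <= (1 + Csize m p) * s%:R by rewrite [leRHS]mulrDl mul1r lerD2r.
  by rewrite -exprMn; apply: lerXn2r => //; rewrite nnegrE // (le_trans h1 h2).
have {}B : 2 * m.+1%:R * (1 + Csize m p * s%:R) ^+ 2 / N <= 2 * m.+1%:R * ((1 + Csize m p) ^+ 2 * s%:R ^+ 2) / N.
  by rewrite ler_pM2r ?invr_gt0 // ler_wpM2l // mulr_ge0.
rewrite /errdec; apply: le_trans (lerD (lexx _) B) _.
rewrite /edec /Cdec invfM le_eqVlt; apply/orP; left; apply/eqP.
move: (p^-1) (N^-1) (m.+1%:R) (Csize m p) => a b c d; ring.
Qed.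

End Concentration.

(** * Connecting fast vertices at the scale sqrt (n/D) *)

Section Star.
Variables (R : realType) (m : nat) (p : R) (d0 d1 : 'I_m).
Hypotheses (p0 : 0 < p) (p1 : p <= 1) (d00 : d0 = 0%N :> nat) (d01 : d0 != d1).
Variables (gam gam' th : R).
Hypotheses (gam1 : 1 < gam) (g_lt : gam < gam') (th0 : 0 < th) (th2 : th <= 2^-1).
Hypothesis (g_le : gam' * (1 + m%:R * th) <= p * m%:R * (1 - th)).
Local Notation Gam := (Gam m p gam gam').
Local Notation Cvar := (Cvar m p gam gam').
Local Notation g := (gfac gam).

(* [s] is of order [sqrt (n / D)], the size at which explorations are stopped. *)
Definition scale (D n s : nat) := (D * s ^ 2 <= n.+1 <= 4 * D * s ^ 2)%N.

Lemma scale_large D S : (0 < D)%N -> exists n0, forall n s, (n0 <= n)%N -> scale D n s -> (S <= s)%N.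
Proof.
move=> D0; exists (4 * D * S ^ 2)%N => n s n0n /andP[_ h].
rewrite -leq_sqr -(@leq_pmul2l (4 * D)) ?muln_gt0 //.
by apply: leq_trans h; apply: leqW.
Qed.

Lemma scale_le D n s (x : R) : (0 < D)%N -> 0 < x -> scale D n s -> x^-1 <= s%:R -> s%:R <= x * n.+1%:R.
Proof.
move=> D0 x0 /andP[h _] xs; have s0 : 0 < s%:R :> R by apply: lt_le_trans xs; rewrite invr_gt0.
rewrite -ler_pdivrMl //; apply: (@le_trans _ _ (s%:R * s%:R)); first by rewrite ler_wpM2r // ltW.
by rewrite -natrM ler_nat; apply: leq_trans h; rewrite mulnn leq_pmull.
Qed.

Lemma scale_exists D : (0 < D)%N -> exists n0, forall n, (n0 <= n)%N -> exists2 s, (0 < s)%N & scale D n s.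
Proof.
move=> D0; exists D => n Dn.
have ex : exists s, (D * s ^ 2 <= n.+1)%N by exists 0%N; rewrite muln0.
have bnd s : (D * s ^ 2 <= n.+1)%N -> (s <= n.+1)%N.
  move=> h; apply: leq_trans h; case: s => // s; rewrite expnS expn1 mulnA leq_pmull // muln_gt0 D0 //.
case: (ex_maxnP ex bnd) => s hs smax.
have s0 : (0 < s)%N by apply: (smax 1%N); rewrite exp1n muln1 leqW.
exists s => //; rewrite /scale hs /=.
have : ~~ (D * s.+1 ^ 2 <= n.+1)%N by apply/negP => /smax; rewrite ltnn.
rewrite -ltnNge => /ltnW h; apply: leq_trans h _.
rewrite (mulnC 4) -mulnA leq_pmul2l //; have -> : (4 * s ^ 2 = (2 * s) ^ 2)%N by rewrite expnMn.
rewrite leq_sqr.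
by rewrite mul2n -addnn -addn1 leq_add2l.
Qed.

Definition ncon n k (w : {ffun 'I_m * 'I_n.+1 -> 'I_n.+1}) :=
  #|[set uv : 'I_n.+1 * 'I_n.+1 | uv.2 \in ball (Gr w) k uv.1]|.

Lemma ncon_sum n k w : (ncon k w)%:R = \sum_(u : 'I_n.+1) \sum_(v : 'I_n.+1) (v \in ball (Gr w) k u)%:R :> R.
Proof.
rewrite /ncon -sum1_card natr_sum big_mkcond pair_bigA /=; apply: eq_bigr => uv _.
by rewrite inE; case: (_ \in _).
Qed.

(** If [nfast] exceeds half its mean, there are at least [(eps * n.+1 / 2) ^+ 2] fast pairs, and
    half that number may be lost as unconnected. Each of the two failures gets probability
    [eta / 2]; [D] takes care of the first. *)
Lemma fast_pairs_meet (eps eta : R) (D : nat) : 0 < eps -> 0 < eta -> (0 < D)%N ->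
  12 * Cdec m p / (D%:R * eps ^+ 2) <= eta / 2 ->
  exists b n0, forall n s, (n0 <= n)%N -> scale D n s -> forall r,
    eps * n.+1%:R <= meanfast n m p s r ->
    Pr (@q R n m p) (fun w => (ncon (r + r + b + 2) w)%:R < eps ^+ 2 / 8 * n.+1%:R ^+ 2) <= eta.
Proof.
move=> e0 eta0 D0 HD.
have Dr0 : 0 < D%:R :> R by rewrite ltr0n.
have g1 : 1 <= g by rewrite /gfac ler_pdivlMr; move: gam1; lra.
have g0 : 0 < g by apply: lt_le_trans g1.
have C0 := Csize_ge0 m p0; have V0 := Cvar_ge0 m p0 g_lt; have G0 := Gam_ge0 m p0 g_lt.
(* A pair fails with probability at most [5 * kappa], and Markov's inequality at density
   [eps ^+ 2 / 8] turns this into [40 * kappa / eps ^+ 2 = eta / 2]. *)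
have [kappa kE] : {x | x = eta * eps ^+ 2 / 80} by exists (eta * eps ^+ 2 / 80).
have k0 : 0 < kappa by rewrite kE divr_gt0 // mulr_gt0 // exprn_gt0.
(* Makes the linking failure at most [kappa / 2]: the frontiers have sizes at least [gam ^+ b * t]
   and [t = s / (2 * g)], while [n.+1 <= 4 * D * s ^ 2]. *)
have [b Hb] := expr_above (64 * D%:R * g ^+ 2 / (p ^+ 2 * kappa)) gam1.
set alpha := th / (1 + Gam) ^+ b.
have al0 : 0 < alpha by rewrite divr_gt0 // exprn_gt0 // ltr_pwDl.
have alb : alpha * (1 + Gam) ^+ b <= th by rewrite divfK // gt_eqF // exprn_gt0 // ltr_pwDl.
have [s1 [n1 Hf]] := frontier p0 p1 d00 gam1 g_lt th0 th2 g_le k0.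
have [s2 Hs2] := nat_above (th^-1).
have [s3 Hs3] := nat_above ((p / 4)^-1).
have [s4 Hs4] := nat_above (4 * g * b%:R * Cvar / kappa).
have [s5 Hs5] := nat_above (2 * (1 + Csize m p) / (alpha * kappa)).
have [n2 Hn2] := scale_large (maxn s1 (maxn s2 (maxn s3 (maxn s4 (maxn s5 1))))) D0.
exists b, (maxn n1 n2) => n s; rewrite geq_max => /andP[n1n n2n] sc r HQ.
have := Hn2 _ _ n2n sc; rewrite 5!geq_max => /and5P[s1s s2s s3s s4s /andP[s5s s0]].
have N0 := N_gt0 R n; have qge0 := q_ge0 (n := n) (m := m) p0 p1; have qsum1 := q_sum1 p (m := m) (n := n).
have up x (k : nat) : x <= k%:R -> (k <= s)%N -> x <= s%:R :> R.
  by move=> h ks; apply: le_trans h _; rewrite ler_nat.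
have {}Hs2 := up _ _ Hs2 s2s; have {}Hs3 := up _ _ Hs3 s3s; have {}Hs4 := up _ _ Hs4 s4s; have {}Hs5 := up _ _ Hs5 s5s.
have sr0 : 0 < s%:R :> R by rewrite ltr0n.
have sth : s%:R <= th * n.+1%:R := scale_le D0 th0 sc Hs2.
have sN : 4 * s%:R <= p * n.+1%:R.
  have := scale_le D0 (divr_gt0 p0 (ltr0n R 4)) sc Hs3; lra.
have /andP[sc1 sc2] := sc.
have sq1 : D%:R * s%:R ^+ 2 <= n.+1%:R :> R by rewrite -natrX -natrM ler_nat.
have sq2 : n.+1%:R <= 4 * D%:R * s%:R ^+ 2 :> R by rewrite -natrX -!natrM ler_nat.
set t := s%:R / (2 * g).
have t0 : 0 < t by rewrite divr_gt0 // mulr_gt0.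
set k := (r + r + b + 2)%N.
have pairs u v : Pr (@q R n m p) (fun w => [&& fast s r u w, fast s r v w & v \notin ball (Gr w) k u]) <= 5 * kappa.
  have size_bad x : Pr (@q R n m p) (fun w => alpha * n.+1%:R / 2 <= #|SA s x r w|%:R) <= kappa.
    have an0 : 0 < alpha * n.+1%:R / 2 by rewrite divr_gt0 // mulr_gt0.
    apply: le_trans (@markov R _ _ _ qge0 (fun w => #|SA s x r w|%:R) _ an0 _) _; first by [].
    rewrite ler_pdivrMr //; have h := @Ex_SA R n m p s p0 p1 s0 sN x r. apply: le_trans h _.
    apply: (@le_trans _ _ ((1 + Csize m p) * s%:R)).
      by rewrite [leRHS]mulrDl mul1r lerD2r ler1n.
    move: Hs5; rewrite ler_pdivrMr; last by rewrite mulr_gt0.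
    have : s%:R * s%:R <= n.+1%:R :> R.
      by apply: le_trans sq1; rewrite -expr2 ler_peMl ?exprn_ge0 // ler1n.
    have ak : 0 < alpha * kappa by rewrite mulr_gt0.
    move: (n.+1%:R) (Csize m p) (s%:R) sr0 => a c S S0 h1 h2.
    have := ler_wpM2r (ltW S0) h2; have := ler_wpM2r (ltW ak) h1; lra.
  pose F x (w : {ffun 'I_m * 'I_n.+1 -> 'I_n.+1}) := (s <= #|SA s x r w|)%N && ((layer s x r w)%:R * (2 * g) < s%:R).
  pose B x (w : {ffun 'I_m * 'I_n.+1 -> 'I_n.+1}) := alpha * n.+1%:R / 2 <= #|SA s x r w|%:R.
  pose P (w : {ffun 'I_m * 'I_n.+1 -> 'I_n.+1}) := pair_ready (R := R) s u v r t alpha w && (v \notin ball (Gr w) k u).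
  have := Hf n s n1n s1s sth sN u r; have := Hf n s n1n s1s sth sN v r.
  rewrite -/(F u) -/(F v) => Fv Fu.
  have Bu := size_bad u; have Bv := size_bad v; rewrite -/(B u) in Bu; rewrite -/(B v) in Bv.
  have PC : Pr (@q R n m p) P <= kappa.
    apply: le_trans (pair_connect s p0 p1 d01 gam1 g_lt th2 g_le u v r t0 (ltW al0) alb) _.
    have -> : kappa = kappa / 2 + kappa / 2 by lra.
    apply: lerD.
      rewrite /t; move: Hs4; rewrite ler_pdivrMr //.
      move: (kappa) (Cvar) (g) (b%:R) (s%:R) sr0 => z1 z2 z3 z4 z5 z50 hh.
      by rewrite invf_div !mulrA ler_pdivrMr //; lra.
    have gb0 : 0 < gam ^+ b by rewrite exprn_gt0 // (lt_trans ltr01).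
    rewrite ler_pdivrMr; last by apply: mulr_gt0 => //; apply: mulr_gt0; [rewrite exprn_gt0 | apply: mulr_gt0].
    move: Hb; rewrite ler_pdivrMr ?mulr_gt0 ?exprn_gt0 // => Hb.
    have -> : kappa / 2 * (p ^+ 2 * (gam ^+ b * t) * t) = (gam ^+ b * (p ^+ 2 * kappa)) * (s%:R ^+ 2 / (8 * g ^+ 2)).
      by rewrite /t; move: (gam ^+ b) (s%:R) (kappa) => x y z; field; rewrite gt_eqF.
    have sg0 : 0 <= s%:R ^+ 2 / (8 * g ^+ 2).
      by apply: divr_ge0; [rewrite exprn_ge0 | apply: mulr_ge0 => //; rewrite exprn_ge0 // ltW].
    apply: le_trans (ler_wpM2r sg0 Hb).
    have -> : 64 * D%:R * g ^+ 2 * (s%:R ^+ 2 / (8 * g ^+ 2)) = 2 * (4 * D%:R * s%:R ^+ 2).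
      by move: (s%:R) (D%:R) => y z; field; rewrite gt_eqF.
    by rewrite ler_wpM2l.
  (* The five failures: a small frontier or an oversized exploration at either end, or no link
     between two ready explorations. *)
  apply: (@le_trans _ _ (Pr (@q R n m p) (F u) + (Pr (@q R n m p) (F v) + (Pr (@q R n m p) (B u) +
     (Pr (@q R n m p) (B v) + Pr (@q R n m p) P))))); last by lra.
  rewrite /Pr -!ExD; apply: Ex_le => // w; rewrite -!natrD ler_nat.
  case fu : (fast s r u w) => //; case fv : (fast s r v w) => //; case vb : (v \notin _) => //=.
  rewrite /fast in fu fv.
  case Fuw : (F u w); first by rewrite leq_addr.
  case Fvw : (F v w); first by rewrite add0n leq_addr.
  case Buw : (B u w); first by rewrite !add0n leq_addr.
  case Bvw : (B v w); first by rewrite !add0n leq_addr.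
  rewrite !add0n /P vb andbT /pair_ready.
  have -> : [disjoint SA s u r w & SA s v r w].
    rewrite -setI_eq0; apply/set0Pn => -[x]; rewrite inE => /andP[xu xv].
    have h1 := subsetP (SA_ball s u r w).1 _ xu; have h2 := subsetP (SA_ball s v r w).1 _ xv.
    rewrite ball_sym in h2; last exact: Gr_sym.
    have := ball_trans h1 h2; move=> /(subsetP (ball_leq (Gr w) u (_ : r + r <= k)%N)).
    by rewrite (negbTE vb) => /(_ _) H; have := H; rewrite /k -addnA leq_addr => /(_ isT).
  have tl x : F x w = false -> (s <= #|SA s x r w|)%N -> t <= (layer s x r w)%:R.
    rewrite /F => h sx; move: h; rewrite sx /= => /negbT; rewrite -leNgt => h.
    by rewrite /t ler_pdivrMr // mulr_gt0.
  rewrite !tl //= natrD; move: Buw Bvw; rewrite /B => /negbT; rewrite -ltNge => b1 /negbT; rewrite -ltNge => b2.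
  by have -> : #|SA s u r w|%:R + #|SA s v r w|%:R <= alpha * n.+1%:R by lra.
pose Y (w : {ffun 'I_m * 'I_n.+1 -> 'I_n.+1}) : R := \sum_u \sum_v [&& fast s r u w, fast s r v w & v \notin ball (Gr w) k u]%:R.
have EY : Ex (@q R n m p) Y <= 5 * kappa * n.+1%:R ^+ 2.
  rewrite /Y Ex_sum (eq_bigr _ (fun u _ => Ex_sum _ _ _)).
  apply: (@le_trans _ _ (\sum_(u : 'I_n.+1) \sum_(v : 'I_n.+1) 5 * kappa)).
    by apply: ler_sum => u _; apply: ler_sum => v _; apply: pairs.
  by rewrite !sumr_const card_ord -mulrnA -[leLHS]mulr_natr natrM -expr2.
set c8 := eps ^+ 2 / 8 * n.+1%:R ^+ 2.
have c80 : 0 < c8 by rewrite mulr_gt0 ?divr_gt0 ?exprn_gt0.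
have Q0 : 0 < meanfast n m p s r by apply: lt_le_trans HQ; rewrite mulr_gt0.
apply: (@le_trans _ _ (Pr (@q R n m p) (fun w => nfast R s r w <= meanfast n m p s r / 2) +
   Pr (@q R n m p) (fun w => c8 <= Y w))).
  apply: Pr_union => // w small.
  case: (lerP (nfast R s r w) _) => //= nf; case: (lerP c8 (Y w)) => //= Yw; exfalso.
  have : nfast R s r w ^+ 2 <= (ncon k w)%:R + Y w.
    rewrite ncon_sum /Y -big_split expr2 /nfast mulr_suml /=; apply: ler_sum => u _.
    rewrite mulr_sumr -big_split /=; apply: ler_sum => v _; rewrite -natrM -natrD ler_nat.
    by case: (fast _ _ _ _); case: (fast _ _ _ _); case: (_ \in _).
  have : (eps * n.+1%:R / 2) ^+ 2 <= nfast R s r w ^+ 2.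
    apply: lerXn2r; rewrite ?nnegrE.
    - by rewrite divr_ge0 ?mulr_ge0 // ltW.
    - by apply: sumr_ge0.
    - by move: nf HQ; lra.
  by move: small Yw; rewrite /c8 exprMn exprMn; lra.
have -> : eta = eta / 2 + eta / 2 by lra.
apply: lerD.
  apply: le_trans (nfast_lower p0 p1 s0 sN Q0) _; apply: le_trans HD.
  rewrite ler_pdivrMr ?exprn_gt0 //.
  have E2 : (eps * n.+1%:R) ^+ 2 <= meanfast n m p s r ^+ 2.
    by apply: lerXn2r; rewrite ?nnegrE // ?mulr_ge0 // ltW.
  have cd0 : 0 <= 12 * Cdec m p / (D%:R * eps ^+ 2).
    by rewrite divr_ge0 ?mulr_ge0 ?exprn_ge0 ?Cdec_ge0 // ltW.
  apply: le_trans (ler_wpM2l cd0 E2).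
  have h := errdec_le n m p0 s0.
  apply: (@le_trans _ _ (12 * (Cdec m p * s%:R ^+ 2 / n.+1%:R) * n.+1%:R ^+ 2)).
    by rewrite ler_wpM2r ?exprn_ge0 // ler_wpM2l.
  have -> : 12 * (Cdec m p * s%:R ^+ 2 / n.+1%:R) * n.+1%:R ^+ 2 = 12 * Cdec m p * n.+1%:R * s%:R ^+ 2.
    by move: (n.+1%:R) N0 (Cdec m p) => x x0 y; field; rewrite gt_eqF.
  have -> : 12 * Cdec m p / (D%:R * eps ^+ 2) * (eps * n.+1%:R) ^+ 2 = 12 * Cdec m p * n.+1%:R * (n.+1%:R / D%:R).
    by move: (n.+1%:R) (Cdec m p) => x y; field; rewrite !gt_eqF.
  rewrite ler_wpM2l ?mulr_ge0 ?Cdec_ge0 // ler_pdivlMr // mulrC; exact: sq1.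
apply: le_trans (@markov R _ _ _ qge0 Y _ c80 _) _.
  by move=> w; apply: sumr_ge0 => u _; apply: sumr_ge0.
rewrite ler_pdivrMr //; apply: le_trans EY _; rewrite /c8 kE.
by rewrite le_eqVlt; apply/orP; left; apply/eqP; move: (n.+1%:R) => x; field.
Qed.

End Star.

(** * Small vertex sets carrying a path *)

Section PathSets.
Variable n : nat.
Implicit Types (G H : graph n.+1) (u v x y : 'I_n.+1) (P : {set 'I_n.+1}).

Lemma ball_subgraph G H k u : G \subset H -> ball G k u \subset ball H k u.
Proof.
move=> GH; elim: k => [|k IH] //; rewrite !ballS setUSS //.
apply/subsetP => y; rewrite !inE => /existsP[x /andP[xk xy]]; apply/existsP; exists x.
by rewrite (subsetP IH) // (subsetP GH).
Qed.

Definition induced G P : graph n.+1 := [set e in G | (e.1 \in P) && (e.2 \in P)].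

Lemma path_set G k u v : v \in ball G k u ->
  exists P, (#|P| <= k.+1)%N && (v \in ball (induced G P) k u) && (v \in P).
Proof.
elim: k v => [|k IH] v; first by rewrite inE => /eqP ->; exists [set u]; rewrite cards1 !inE eqxx.
rewrite ballS !inE => /orP[/IH[P /andP[/andP[cP vP] vP']]|/existsP[x /andP[/IH[P /andP[/andP[cP xP] xP']] xv]]].
  exists P; rewrite vP' andbT leqW //=; exact: (subsetP (ball_leq _ _ (leqnSn k))).
exists (v |: P); rewrite setU11 andbT; apply/andP; split.
  by rewrite cardsU1; case: (v \notin P); [rewrite add1n ltnS | rewrite add0n leqW].
apply: (@ball_edge _ _ k u x v); last by rewrite !inE xv eqxx xP' orbT.
apply: (subsetP (ball_subgraph _ _ _)) xP.
by apply/subsetP => e; rewrite !inE => /and3P[-> -> ->]; rewrite !orbT.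
Qed.

(** A selected set inside which [v] is reached. A ball member can be lost by discarding slots of [Y]
    only if its route meets [Y]. *)
Definition route G k u v : {set 'I_n.+1} :=
  odflt set0 [pick P : {set 'I_n.+1} | (#|P| <= k.+1)%N && (v \in ball (induced G P) k u) && (v \in P)].

Lemma routeP G k u v : v \in ball G k u ->
  (#|route G k u v| <= k.+1)%N && (v \in ball (induced G (route G k u v)) k u).
Proof.
move=> /path_set[P HP]; rewrite /route; case: pickP => [Q /andP[]//|/(_ P)].
by rewrite HP.
Qed.

Lemma card_route G k u v : (#|route G k u v| <= k.+1)%N.
Proof. by rewrite /route; case: pickP => [Q /andP[/andP[]]|] //=; rewrite cards0. Qed.

End PathSets.

(** * Large balls reach almost everything *)

Section Amplify.
Variables (R : realType) (n m : nat) (p : R) (d0 d1 : 'I_m).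
Hypotheses (p0 : 0 < p) (p1 : p <= 1) (d00 : d0 = 0%N :> nat) (d01 : d0 != d1).
Local Notation V := 'I_n.+1.
Local Notation N := (n.+1%:R : R).
Local Notation slot := ('I_m * V)%type.
Local Notation Om := {ffun slot -> V}.
Local Notation q := (@q R n m p).
Local Notation qge0 := (q_ge0 p0 p1).
Local Notation qsum1 := (q_sum1 p (m := m) (n := n)).
Implicit Types (w : Om) (x y u v : V).

Definition indeg w x := #|[set e : slot | w e == x]|.

Lemma Ex_prod (f : slot -> V -> R) : Ex q (fun w => \prod_e f e (w e)) = \prod_e \sum_y q e y * f e y.
Proof.
rewrite bigA_distr_bigA; apply: eq_bigr => w _; by rewrite /mass -big_split.
Qed.

Lemma sum_q x : \sum_e q e x = m%:R.
Proof.
have := @qs_sum R n m p [set x]; rewrite cards1 mulr1 => <-.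
by apply: eq_bigr => e _; rewrite /qs big_set1.
Qed.

Lemma prod_le_exp (T : finType) (f : T -> R) : (forall i, 0 <= f i) -> \prod_i (1 + f i) <= expR (\sum_i f i).
Proof.
move=> f0; rewrite expR_sum; apply: ler_prod => i _; rewrite addr_ge0 //=; exact: expR_ge1Dx.
Qed.

(** The slots contribute independent factors of mean [1 + q e x], and the mean in-degree is [m]. *)
Lemma Ex_2_indeg x : Ex q (fun w => 2 ^+ indeg w x) <= expR (m%:R).
Proof.
rewrite (Ex_eq q (G := fun w => \prod_e (if w e == x then 2 else 1))) => [|w].
  rewrite (Ex_prod (fun _ y => if y == x then 2 else 1)) -(sum_q x); apply: le_trans (prod_le_exp (fun e => ltW (q_gt0 p0 p1 e x))).
  apply: ler_prod => e _; apply/andP; split.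
    by apply: sumr_ge0 => y _; rewrite mulr_ge0 //; [apply: qge0 | case: ifP].
  rewrite -[in leRHS](q_sum1 p e) (bigD1 x) //= eqxx [in leRHS](bigD1 x) //=.
  rewrite (eq_bigr (fun y => q e y)) => [|y /negbTE ->]; last by rewrite mulr1.
  by rewrite le_eqVlt; apply/orP; left; apply/eqP; ring.
by rewrite -big_mkcond /= prodr_const /indeg; congr (_ ^+ _); apply: eq_card => e; rewrite inE.
Qed.

Lemma indeg_tail x t : Pr q (fun w => t <= indeg w x)%N <= expR (m%:R) / 2 ^+ t.
Proof.
have t0 : 0 < 2 ^+ t :> R by rewrite exprn_gt0.
apply: (@le_trans _ _ (Pr q (fun w => 2 ^+ t <= 2 ^+ indeg w x :> R))).
  apply: Pr_le => [|w h]; [exact: qge0|by rewrite ler_weXn2l // ler1n].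
apply: le_trans (@markov R _ _ q qge0 (fun w => 2 ^+ indeg w x) _ t0 _) _; first by move=> w; rewrite exprn_ge0.
by rewrite ler_pM2r ?invr_gt0 // Ex_2_indeg.
Qed.

Definition low_indeg Del w := [forall x, (indeg w x < Del)%N].

Lemma low_indeg_fail Del : Pr q (fun w => ~~ low_indeg Del w) <= N * expR (m%:R) / 2 ^+ Del.
Proof.
apply: (@le_trans _ _ (\sum_(x : V) Pr q (fun w => Del <= indeg w x)%N)).
  apply: Pr_union_sum => [|w]; first exact: qge0.
  by rewrite negb_forall => /existsP[x]; rewrite -leqNgt; exists x.
apply: (@le_trans _ _ (\sum_(x : V) expR (m%:R) / 2 ^+ Del)); first by apply: ler_sum => x _; apply: indeg_tail.
by rewrite sumr_const card_ord -[leLHS]mulr_natr mulrC mulrA.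
Qed.

Lemma orb_preim Del w j x : low_indeg Del w -> (#|[set v | orb d0 w v j == x]| <= Del ^ j)%N.
Proof.
move=> /forallP low; elim: j x => [|j IH] x.
  by rewrite expn0 -(cards1 x); apply/subset_leq_card/subsetP => v; rewrite !inE.
have sub : [set v | orb d0 w v j.+1 == x] \subset \bigcup_(y in [set y | w (d0, y) == x]) [set v | orb d0 w v j == y].
  apply/subsetP => v; rewrite inE /orb iterS => h; apply/bigcupP; exists (orb d0 w v j); by rewrite !inE.
apply: leq_trans (subset_leq_card sub) _; apply: leq_trans (unstable.card_big_setU _ _ _) _.
apply: (@leq_trans (\sum_(y in [set y | w (d0, y) == x]) Del ^ j)); first by apply: leq_sum.
rewrite sum_nat_const expnS leq_mul2r; apply/orP; right.
apply: leq_trans (ltnW (low x)); rewrite /indeg -(card_imset _ (_ : injective (fun y => (d0, y)))) => [|y z []//].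
by apply/subset_leq_card/subsetP => e /imsetP[y]; rewrite !inE => h ->.
Qed.

(* Balls of the pruned graph do not depend on the slots [(d1, y)], [y \in Y], which
   may therefore be redrawn after the ball has been revealed. *)
Definition pruned_adj w (Y : {set V}) x y :=
  [exists d, (w (d, x) == y) && ~~ ((d == d1) && (x \in Y))] ||
  [exists d, (w (d, y) == x) && ~~ ((d == d1) && (y \in Y))].
Definition pruned w Y : graph n.+1 := [set e | pruned_adj w Y e.1 e.2].

Lemma pruned_sub w (Y : {set V}) : pruned w Y \subset Gr w.
Proof.
apply/subsetP => e; rewrite !inE => /orP[] /existsP[d /andP[h _]]; apply/orP; [left|right];
  by apply/existsP; exists d.
Qed.

Lemma induced_sub w (Y P : {set V}) : [disjoint P & Y] -> induced (Gr w) P \subset pruned w Y.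
Proof.
move=> dis; apply/subsetP => -[x y]; rewrite !inE /= => /and3P[h xP yP]; rewrite /pruned_adj.
rewrite (disjointFr dis xP) (disjointFr dis yP).
by case/orP: h => /existsP[d h]; apply/orP; [left|right]; apply/existsP; exists d; rewrite h andbF.
Qed.

Definition forward_orbit v L w := orbs d0 v L.+1 w.
Definition pruned_ball u v L K w := ball (pruned w (forward_orbit v L w)) K u.
(** Atoms of the information on all slots except [(d1, y)] with [y] in the orbit. The orbit uses
    only the index [d0], so it is constant on each atom. *)
Definition resample v L w : {ffun slot -> {set V}} :=
  [ffun e => if (e.1 == d1) && (e.2 \in forward_orbit v L w) then setT else [set w e]].

Lemma resample_agree v L w w' : inr (resample v L w) w' ->
  (forall e, ~~ ((e.1 == d1) && (e.2 \in forward_orbit v L w)) -> w' e = w e) /\ forward_orbit v L w' = forward_orbit v L w.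
Proof.
move=> /forallP H; have A e : ~~ ((e.1 == d1) && (e.2 \in forward_orbit v L w)) -> w' e = w e.
  by move=> h; have := H e; rewrite ffunE (negbTE h) inE => /eqP.
split=> //; apply/setP => x; rewrite !inE; apply: eq_existsb => i; congr (_ == _).
elim: (i : nat) => [|j IH] //; rewrite /orb !iterS -!/(orb _ _ _ _) IH A //=.
by rewrite (negbTE d01).
Qed.

Lemma resample_part v L : partitioning (resample v L).
Proof.
split=> [w|w w' h]; first by apply/forallP => e; rewrite ffunE; case: ifP => _; rewrite inE.
have [A EY] := resample_agree h; apply/ffunP => e; rewrite !ffunE EY.
by case: ifP => // /negbT/A ->.
Qed.

Lemma pruned_ball_agree u v L K w w' : inr (resample v L w) w' -> pruned_ball u v L K w' = pruned_ball u v L K w.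
Proof.
move=> h; have [A EY] := resample_agree h; rewrite /pruned_ball EY; congr (ball _ K u).
apply/setP => -[x y]; rewrite !inE /pruned_adj /=.
congr (_ || _); apply: eq_existsb => d; (case: (boolP (_ && (_ \in forward_orbit v L w))) => ne; [by rewrite !andbF | by rewrite A]).
Qed.

(** On an atom of [resample] the pruned ball is fixed, and a clear orbit carries [L.+1] distinct
    fresh slots, each entering the ball with probability at least [p * th]. *)
Lemma miss_target u v L K th : 0 <= th -> th <= 1 ->
  Pr q (fun w => [&& [forall j : 'I_L.+1, clear d0 v L j w], th * N <= #|pruned_ball u v L K w|%:R &
                   [forall y in forward_orbit v L w, w (d1, y) \notin pruned_ball u v L K w]]) <= (1 - p * th) ^+ L.+1.
Proof.
move=> th0 th1; have N0 := N_gt0 R n.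
pose G w := [forall j : 'I_L.+1, clear d0 v L j w] && (th * N <= #|pruned_ball u v L K w|%:R).
have pt0 : 0 <= 1 - p * th by rewrite subr_ge0 mulr_ile1 // ltW.
have b0 : 0 <= (1 - p * th) ^+ L.+1 by rewrite exprn_ge0.
apply: (@le_trans _ _ ((1 - p * th) ^+ L.+1 * Pr q G)); last first.
  by rewrite ler_piMr // Pr_le1 //; [exact: qge0 | exact: qsum1].
apply: (Pr_blocks qge0 (resample_part v L)) => [w w' h|w /and3P[a b _]|w /andP[cl Uw]].
- rewrite /G (pruned_ball_agree _ _ h); congr andb; have [A _] := resample_agree h.
  have orbE j : orb d0 w' v j = orb d0 w v j.
    elim: j => [|j IH] //; rewrite /orb !iterS -!/(orb _ _ _ _) IH A //=; by rewrite (negbTE d01).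
  by apply: eq_forallb => j; apply: eq_forallb => i; apply: eq_forallb => c; rewrite !orbE.
- by rewrite /G a.
pose Kr : {ffun slot -> {set V}} :=
  [ffun e => if (e.1 == d1) && (e.2 \in forward_orbit v L w) then ~: pruned_ball u v L K w else setT].
apply: (@le_trans _ _ (Pr q (inr (recI (resample v L w) Kr)))).
  apply: Pr_le => [|w' /andP[h /and3P[_ _ /forallP miss]]]; first exact: qge0.
  rewrite inr_recI h /=; apply/forallP => -[d y]; rewrite ffunE /=.
  case: andP => [[/eqP -> yY]|_]; last by rewrite inE.
  have [_ EY] := resample_agree h; have := miss y; rewrite EY yY (pruned_ball_agree _ _ h) /=.
  by rewrite inE.
rewrite !Pr_rect.
have -> : (1 - p * th) ^+ L.+1 = \prod_(e : slot) (if (e.1 == d1) && (e.2 \in forward_orbit v L w) then 1 - p * th else 1).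
  rewrite -big_mkcond /= prodr_const; congr (_ ^+ _).
  rewrite -(clear_card cl) -(card_imset _ (_ : injective (fun y => (d1, y)))) => [|y z []//].
  apply: eq_card => -[d y]; rewrite [RHS]inE /=; apply/imsetP/andP => [[z zY [-> ->]]|[/eqP -> yY]].
    by rewrite eqxx.
  by exists y.
rewrite -big_split /=; apply: ler_prod => e _; rewrite (qs_ge0 qge0) /=.
rewrite [recI _ _ _]ffunE !ffunE; case: ifP => _; last by rewrite setIT mul1r.
rewrite setTI qs_setC.
have -> : qs q e setT = 1 by rewrite -(q_sum1 p e) /qs; apply: eq_bigl => z; rewrite inE.
rewrite mulr1 lerD2l lerN2; apply: le_trans (qs_ge p1 e _).
by rewrite -mulrA ler_pM2l // ler_pdivlMr.
Qed.

Definition touched u v L K w := [set b in ball (Gr w) K u | ~~ [disjoint route (Gr w) K u b & forward_orbit v L w]].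

(** Double counting: a route has at most [K.+1] vertices, and with in-degrees below [Del] each
    vertex lies in the orbits of at most [L.+1 * Del ^ L] starting points. *)
Lemma touched_sum Del u L K w : (0 < Del)%N -> low_indeg Del w ->
  (\sum_v #|touched u v L K w| <= n.+1 * (K.+1 * (L.+1 * Del ^ L)))%N.
Proof.
move=> D0 low.
have inY x : (#|[set v | x \in forward_orbit v L w]| <= L.+1 * Del ^ L)%N.
  have sub : [set v | x \in forward_orbit v L w] \subset \bigcup_(j : 'I_L.+1) [set v | orb d0 w v j == x].
    by apply/subsetP => v; rewrite !inE => /existsP[j h]; apply/bigcupP; exists j; rewrite ?inE.
  apply: leq_trans (subset_leq_card sub) _; apply: leq_trans (unstable.card_big_setU _ _ _) _.
  apply: (@leq_trans (\sum_(j < L.+1) Del ^ L)); last by rewrite sum_nat_const card_ord.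
  apply: leq_sum => j _; apply: leq_trans (orb_preim _ _ low) _.
  by rewrite leq_pexp2l // -ltnS.
rewrite (eq_bigr (fun v => \sum_(b in ball (Gr w) K u) (~~ [disjoint route (Gr w) K u b & forward_orbit v L w] : nat))) => [|v _]; last first.
  by rewrite -sum1_card big_mkcond [RHS]big_mkcond; apply: eq_bigr => b _; rewrite inE; case: (b \in _) => //=; case: [disjoint _ & _].
rewrite exchange_big /=.
apply: (@leq_trans (\sum_(b in ball (Gr w) K u) K.+1 * (L.+1 * Del ^ L))%N); last first.
  by rewrite sum_nat_const leq_mul2r; apply/orP; right; apply: leq_trans (max_card _) _; rewrite card_ord.
apply: leq_sum => b _.
apply: (@leq_trans (\sum_v \sum_(x in route (Gr w) K u b) (x \in forward_orbit v L w))).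
  apply: leq_sum => v _; case: (boolP [disjoint _ & _]) => //=; rewrite -setI_eq0 => /set0Pn[x].
  by rewrite inE => /andP[xr xY]; rewrite (bigD1 x) //= xY.
rewrite exchange_big /=; apply: (@leq_trans (\sum_(x in route (Gr w) K u b) L.+1 * Del ^ L)%N); last first.
  by rewrite sum_nat_const leq_mul2r card_route orbT.
apply: leq_sum => x _; apply: leq_trans (inY x); rewrite -sum1_card [leqRHS]big_mkcond.
by apply: leq_sum => v _; rewrite inE; case: (_ \in _).
Qed.

Lemma untouched u v L K w : (#|ball (Gr w) K u| <= #|touched u v L K w| + #|pruned_ball u v L K w|)%N.
Proof.
have sub : ball (Gr w) K u \subset touched u v L K w :|: pruned_ball u v L K w.
  apply/subsetP => b bk; rewrite inE; apply/orP; case: (boolP [disjoint route (Gr w) K u b & forward_orbit v L w]) => dis.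
    right; have /andP[_ h] := routeP bk; apply: (subsetP (ball_subgraph _ _ _)) h.
    exact: induced_sub.
  by left; rewrite inE bk dis.
by apply: leq_trans (subset_leq_card sub) (leq_card_setU _ _).
Qed.

(* The slots [(d1, y)], for [y] in the slot-[d0] orbit of [v], can be redrawn
   without changing most of the ball of [u], so one of them hits it. *)
Lemma large_ball_reaches L K Del (th : R) : 0 < th -> th <= 1 -> (L <= n)%N -> (0 < Del)%N ->
  \sum_u \sum_v Pr q (fun w => (th * N <= #|ball (Gr w) K u|%:R) && (v \notin ball (Gr w) (K + L.+1) u)) <=
  N ^+ 2 * ((1 - p * (th / 2)) ^+ L.+1 + L.+1%:R ^+ 3 / N + N * expR m%:R / 2 ^+ Del
     + 2 / th * (K.+1 * (L.+1 * Del ^ L))%:R / N).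
Proof.
move=> th0 th1 Ln D0; have N0 := N_gt0 R n.
pose E4 u v w := low_indeg Del w && (th / 2 * N <= #|touched u v L K w|%:R).
have step u v : Pr q (fun w => (th * N <= #|ball (Gr w) K u|%:R) && (v \notin ball (Gr w) (K + L.+1) u)) <=
   (1 - p * (th / 2)) ^+ L.+1 + L.+1%:R ^+ 3 / N + N * expR m%:R / 2 ^+ Del + Pr q (E4 u v).
  have t2 : 0 <= th / 2 by rewrite divr_ge0 // ltW.
  have t21 : th / 2 <= 1 by lra.
  have h1 := miss_target u v L K t2 t21; have h2 := orb_fail p0 p1 d00 v Ln; have h3 := low_indeg_fail Del.
  apply: le_trans (lerD (lerD (lerD h1 h2) h3) (lexx _)).
  rewrite /Pr -!ExD; apply: Ex_le => [|w]; first exact: qge0.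
  case: (boolP (_ && _)) => [/andP[big far]|_]; last by rewrite !addr_ge0.
  case: (boolP [forall j : 'I_L.+1, clear d0 v L j w]) => cl; last first.
    by rewrite /= -!addrA add0r lerDl !addr_ge0.
  rewrite /E4; case: (boolP (low_indeg Del w)) => low; last by rewrite /= addrC addrA lerDr !addr_ge0.
  rewrite /= !addr0 -natrD ler_nat.
  (* If fewer than [th / 2 * N] ball vertices are touched, the pruned ball keeps at least as many,
     and one fresh slot entering it gives a path of length [K + L.+1]. *)
  case: (lerP (th / 2 * N) #|touched u v L K w|%:R) => tch; first by rewrite addn1.
  have -> : th / 2 * N <= #|pruned_ball u v L K w|%:R.
    have := untouched u v L K w; rewrite -(ler_nat R) natrD; move: tch big.
    by move: (n.+1%:R) => z; lra.
  rewrite addn0 /=; have -> //: [forall y in forward_orbit v L w, w (d1, y) \notin pruned_ball u v L K w].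
  apply/forallP => y; apply/implyP => yY; apply: contra far => yU.
  have h4 : w (d1, y) \in ball (Gr w) K u by apply: (subsetP (ball_subgraph _ _ (pruned_sub _ _))) yU.
  have h5 : y \in ball (Gr w) K.+1 u.
    apply: ball_edge h4 _; rewrite inE /adj; apply/orP; right; by apply/existsP; exists d1.
  rewrite -addSnnS; apply: ball_trans h5 _; rewrite ball_sym; last exact: Gr_sym.
  exact: (subsetP (orbs_ball _ _ _ _)) yY.
apply: (@le_trans _ _ (\sum_(u : V) \sum_(v : V) ((1 - p * (th / 2)) ^+ L.+1 + L.+1%:R ^+ 3 / N + N * expR m%:R / 2 ^+ Del + Pr q (E4 u v)))).
  by apply: ler_sum => u _; apply: ler_sum => v _; apply: step.
set c1 := (1 - p * (th / 2)) ^+ L.+1 + L.+1%:R ^+ 3 / N + N * expR m%:R / 2 ^+ Del.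
have -> : N ^+ 2 * (c1 + 2 / th * (K.+1 * (L.+1 * Del ^ L))%:R / N) =
   \sum_(u : V) (c1 * N + 2 / th * (K.+1 * (L.+1 * Del ^ L))%:R).
  rewrite sumr_const card_ord -[RHS]mulr_natr; move: N N0 c1 ((K.+1 * (L.+1 * Del ^ L))%:R) => z z0 c x.
  by field; rewrite !gt_eqF.
apply: ler_sum => u _; rewrite big_split /= sumr_const card_ord -[X in X + _]mulr_natr lerD2l.
rewrite -Ex_sum -[leRHS](Ex_cst qsum1); apply: Ex_le => [|w]; first exact: qge0.
case: (boolP (low_indeg Del w)) => low; last first.
  rewrite big1 => [|v _]; last by rewrite /E4 (negbTE low).
  by rewrite mulr_ge0 // divr_ge0 // ltW.
have tn : 0 < th / 2 * N by rewrite mulr_gt0 // divr_gt0.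
apply: (@le_trans _ _ (\sum_v #|touched u v L K w|%:R / (th / 2 * N))).
  apply: ler_sum => v _; rewrite /E4 low /=; case: (lerP (th / 2 * N) _) => h; last by rewrite divr_ge0 // ltW.
  by rewrite ler_pdivlMr // mul1r.
rewrite -mulr_suml -natr_sum ler_pdivrMr //.
have := touched_sum u L K D0 low; rewrite -(ler_nat R) natrM => h; apply: le_trans h _.
rewrite le_eqVlt; apply/orP; left; apply/eqP; move: N N0 ((K.+1 * (L.+1 * Del ^ L))%:R) => z z0 x.
by field; rewrite gt_eqF.
Qed.

End Amplify.

Lemma expn_leq_exp2 M : exists z0, forall z, (z0 <= z)%N -> (z.+1 ^ M <= 2 ^ z)%N.
Proof.
case: M => [|M']; first by exists 0%N => z _; rewrite expn0 expn_gt0.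
set M := M'.+1; set D := (2 * M)%N; exists (D ^ 2)%N => z z0z.
have D0 : (0 < D)%N by rewrite muln_gt0.
set k := (z %/ D)%N.
have h1 : (z.+1 <= k.+1 * D)%N by rewrite mulnC mulnC ltn_ceil.
have h2 : (k.+1 <= 2 ^ k)%N by apply: ltn_expl.
have h3 : (z.+1 ^ (2 * M) <= 2 ^ z * (D ^ 2) ^ M)%N.
  apply: (@leq_trans ((2 ^ k * D) ^ (2 * M))); first by rewrite leq_exp2r ?muln_gt0 //; apply: leq_trans h1 _; rewrite leq_mul2r h2 orbT.
  rewrite expnMn -!expnM -/D leq_mul //.
  by rewrite leq_pexp2l // /k leq_trunc_div.
have h4 : ((D ^ 2) ^ M <= z.+1 ^ M)%N by rewrite leq_exp2r // leqW.
have : (z.+1 ^ M * z.+1 ^ M <= 2 ^ z * z.+1 ^ M)%N.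
  by rewrite -expnD addnn -mul2n; apply: leq_trans h3 _; rewrite leq_mul2l h4 orbT.
by rewrite leq_pmul2r // expn_gt0.
Qed.

Lemma root_exists M n : (0 < M)%N -> exists2 z, (z ^ M <= n.+1)%N & (n.+1 < z.+1 ^ M)%N.
Proof.
move=> M0; have ex : exists z, (z ^ M <= n.+1)%N by exists 0%N; rewrite exp0n.
have bnd z : (z ^ M <= n.+1)%N -> (z <= n.+1)%N.
  case: z => // z h; apply: leq_trans h; rewrite -[X in (X <= _)%N]expn1 leq_pexp2l //.
case: (ex_maxnP ex bnd) => z hz zmax; exists z => //.
by rewrite ltnNge; apply/negP => /zmax; rewrite ltnn.
Qed.

(** * From a positive proportion of close pairs to almost all pairs *)

Section IID.
Variables (R : realType) (m : nat) (p : R) (d0 d1 : 'I_m).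
Hypotheses (p0 : 0 < p) (p1 : p <= 1) (d00 : d0 = 0%N :> nat) (d01 : d0 != d1).
Hypothesis pm1 : 1 < p * m%:R.
Local Notation Om n := {ffun 'I_m * 'I_n.+1 -> 'I_n.+1}.
Local Notation PR n := (Pr (@q R n m p)).
Local Notation N n := (n.+1%:R : R).

Lemma large_ball_reaches_asymp (th eta : R) : 0 < th -> th <= 1 -> 0 < eta -> exists L n0, forall n, (n0 <= n)%N ->
  forall K, (K.+1 ^ 2 <= n.+1)%N ->
  \sum_(u : 'I_n.+1) \sum_(v : 'I_n.+1) PR n (fun w => (th * N n <= #|ball (Gr w) K u|%:R) && (v \notin ball (Gr w) (K + L) u))
    <= eta * N n ^+ 2.
Proof.
move=> th0 th1 eta0; have e4 : 0 < eta / 4 by rewrite divr_gt0.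
set x := p * (th / 2); have x0 : 0 < x by rewrite mulr_gt0 // divr_gt0.
have x1 : x < 1.
  by apply: (@le_lt_trans _ _ (th / 2)); [rewrite ler_piMl // divr_ge0 // ltW | lra].
have y1 : 1 < (1 - x)^-1 by rewrite invf_gt1; lra.
have [L HL] := expr_above (eta / 4)^-1 y1.
have {}HL : (1 - x) ^+ L.+1 <= eta / 4.
  apply: (@le_trans _ _ ((1 - x) ^+ L)); first by rewrite ler_wiXn2l //; lra.
  move: HL; rewrite exprVn lef_pV2 // posrE ?exprn_gt0 //; lra.
have [n1 Hn1] := above_all (L.+1%:R ^+ 3 / (eta / 4)).
have [n2 Hn2] := above_all (expR (m%:R : R) / (eta / 4)).
have [c Hc] := nat_above (2 / th * L.+1%:R / (eta / 4)).
(* The degree bound will be [z], about the [M]-th root of [n.+1]: small enough that [K.+1 * z ^ L]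
   is negligible against [n.+1] when [K.+1 ^ 2 <= n.+1], and large enough that [2 ^+ z] is at least
   [n.+1 ^+ 2]. *)
set M := (4 * L.+1)%N; have M0 : (0 < M)%N by rewrite muln_gt0.
have [z0 Hz0] := expn_leq_exp2 (M * 2).
exists L.+1, (maxn L (maxn n1 (maxn n2 (maxn (c ^ 4) (z0.+1 ^ M))))) => n.
rewrite !geq_max => /and5P[Ln n1n n2n cn zn] K Kn.
have N0 := N_gt0 R n.
have [z zM zM'] := root_exists n M0.
have z0z : (z0 < z)%N.
  by rewrite -ltnS -(@ltn_exp2r _ _ M) //; apply: leq_ltn_trans zM'; apply: leqW.
have zpos : (0 < z)%N by apply: leq_trans z0z.
apply: le_trans (large_ball_reaches p0 p1 d00 d01 K th0 th1 Ln zpos) _.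
rewrite mulrC ler_wpM2r ?exprn_ge0 //.
have -> : eta = eta / 4 + eta / 4 + eta / 4 + eta / 4 by lra.
apply: lerD; [apply: lerD; [apply: lerD|]|] => //.
- by rewrite ler_pdivrMr // mulrC -ler_pdivrMr //; apply: Hn1.
- have h : n.+1%:R ^+ 2 <= 2 ^+ z :> R.
    rewrite -!natrX ler_nat; apply: leq_trans (Hz0 _ (ltnW z0z)).
    by rewrite expnM leq_exp2r // ltnW.
  have h2 : 0 < 2 ^+ z :> R by rewrite exprn_gt0.
  rewrite ler_pdivrMr //; apply: (@le_trans _ _ (eta / 4 * n.+1%:R ^+ 2)); last by rewrite ler_wpM2l // ltW.
  rewrite expr2 mulrA [leLHS]mulrC ler_wpM2r // [leRHS]mulrC -ler_pdivrMr //; exact: Hn2.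
- have h : (K.+1 * z ^ L * c <= n.+1)%N.
    rewrite -(@leq_exp2r _ _ 4) // !expnMn.
    have k4 : (K.+1 ^ 4 <= n.+1 ^ 2)%N by rewrite (expnM _ 2 2) leq_exp2r.
    have z4 : ((z ^ L) ^ 4 <= n.+1)%N.
      apply: leq_trans zM; rewrite -expnM leq_pexp2l // /M mulnC leq_mul2l leqnSn orbT //.
    have c4 : (c ^ 4 <= n.+1)%N by apply: leqW.
    apply: leq_trans (leq_mul (leq_mul k4 z4) c4) _.
    by rewrite -[X in (_ * X * _)%N]expn1 -[X in (_ * _ * X)%N]expn1 -!expnD.
  have hR : (K.+1 * z ^ L)%:R * c%:R <= n.+1%:R :> R by rewrite -natrM ler_nat.
  rewrite ler_pdivrMr //.
  have -> : (K.+1 * (L.+1 * z ^ L))%:R = (K.+1 * z ^ L)%:R * L.+1%:R :> R by rewrite -natrM mulnAC mulnA.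
  apply: le_trans (ler_wpM2l (ltW e4) hR).
  move: Hc; rewrite ler_pdivrMr // => Hc.
  have Z0 : 0 <= (K.+1 * z ^ L)%:R :> R by [].
  have := ler_wpM2l Z0 Hc; move: ((K.+1 * z ^ L)%:R) (c%:R) (L.+1%:R) (2 / th) => a b d e; lra.
Qed.

Definition close_mass n k : R := \sum_(u : 'I_n.+1) \sum_(v : 'I_n.+1) PR n (fun w => v \in ball (Gr w) k u).

Lemma close_mass_mono n k l : (k <= l)%N -> close_mass n k <= close_mass n l.
Proof.
move=> kl; apply: ler_sum => u _; apply: ler_sum => v _; apply: Pr_le => [|w]; first exact: q_ge0.
by apply/subsetP/ball_leq.
Qed.

Lemma close_mass_compl n k : N n ^+ 2 - close_mass n k = \sum_(u : 'I_n.+1) \sum_(v : 'I_n.+1) PR n (fun w => v \notin ball (Gr w) k u).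
Proof.
have tot : \sum_(u : 'I_n.+1) \sum_(v : 'I_n.+1) 1 = N n ^+ 2 :> R.
  by rewrite !sumr_const card_ord -mulrnA -natrX.
rewrite -tot -sumrB; apply: eq_bigr => u _; rewrite -sumrB; apply: eq_bigr => v _.
by rewrite -Pr_predC //; [exact: q_sum1].
Qed.

(** [large_ball_reaches_asymp] is used twice: from a positive proportion of vertices with large
    balls to large balls at almost all vertices, and from these to almost all pairs. *)
Lemma dense_to_full (eps eta : R) : 0 < eps -> eps <= 1 -> 0 < eta -> exists L n0, forall n, (n0 <= n)%N -> forall K,
  ((K + L).+1 ^ 2 <= n.+1)%N -> PR n (fun w => (ncon K w)%:R < eps * N n ^+ 2) <= eta / 3 ->
  (1 - eta) * N n ^+ 2 <= close_mass n (K + L).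
Proof.
move=> eps0 eps1 eta0; set th := eps / 2.
have th0 : 0 < th by rewrite divr_gt0.
have th1 : th <= 1 by rewrite /th; lra.
have [L1 [n1 H1]] := large_ball_reaches_asymp th0 th1 (divr_gt0 (mulr_gt0 eta0 th0) (ltr0n R 6)).
have th20 : 0 < th / 2 by rewrite divr_gt0.
have th21 : th / 2 <= 1 by lra.
have [L2 [n2 H2]] := large_ball_reaches_asymp th20 th21 (divr_gt0 eta0 (ltr0n R 3)).
exists (L1 + L2)%N, (maxn n1 n2) => n; rewrite geq_max => /andP[n1n n2n] K KL dense.
have N0 := N_gt0 R n; have qge0 := q_ge0 (n := n) (m := m) p0 p1.
have sm (a : nat) : (a <= K + (L1 + L2))%N -> (a.+1 ^ 2 <= n.+1)%N.
  by move=> h; apply: leq_trans KL; rewrite leq_exp2r // ltnS.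
have {}H1 := H1 n n1n K (sm _ (leq_addr _ _)).
have K1le : (K + L1 <= K + (L1 + L2))%N by rewrite addnA leq_addr.
have {}H2 := H2 n n2n (K + L1)%N (sm _ K1le).
set K1 := (K + L1)%N in H1 H2.
(* By [H1] and symmetry of balls, most vertices are close to most of the many
   vertices with large [K]-balls, hence have large [K1]-balls themselves. *)
have mid : \sum_(v : 'I_n.+1) PR n (fun w => #|ball (Gr w) K1 v|%:R < th / 2 * N n) <= 2 * eta / 3 * N n.
  pose X (w : Om n) : R := \sum_(a : 'I_n.+1) \sum_(v : 'I_n.+1)
     ((th * N n <= #|ball (Gr w) K a|%:R) && (v \notin ball (Gr w) K1 a))%:R.
  have EX : Ex (@q R n m p) X <= eta * th / 6 * N n ^+ 2.
    by rewrite Ex_sum (eq_bigr _ (fun u _ => Ex_sum _ _ _)).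
  have tN : 0 < th / 2 * N n by rewrite mulr_gt0.
  apply: (@le_trans _ _ (N n * PR n (fun w => (ncon K w)%:R < eps * N n ^+ 2) + Ex (@q R n m p) X / (th / 2 * N n))); last first.
    apply: le_trans (lerD (ler_wpM2l (ltW N0) dense) (ler_wpM2r _ EX)) _; first by rewrite invr_ge0 ltW.
    by rewrite le_eqVlt; apply/orP; left; apply/eqP; move: (N n) N0 => z zz0; field; rewrite !gt_eqF.
  rewrite -Ex_sum -ExZ -ExZr -ExD; apply: Ex_le => // w.
  case: ltP => dn; last rewrite mulr0 add0r.
    rewrite mulr1; apply: (@le_trans _ _ (\sum_(v : 'I_n.+1) 1)); last first.
      by rewrite sumr_const card_ord lerDl divr_ge0 ?(ltW tN) // sumr_ge0 // => a _; rewrite sumr_ge0.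
    by apply: ler_sum => v _; case: (_ < _).
  (* Vertices with balls below [th * N] account for at most half of the [eps * N ^+ 2] close
     pairs. *)
  have Ubig : th * N n <= \sum_(a : 'I_n.+1) (th * N n <= #|ball (Gr w) K a|%:R)%R%:R.
    have : eps * N n ^+ 2 <= N n * \sum_(a : 'I_n.+1) (th * N n <= #|ball (Gr w) K a|%:R)%R%:R + th * N n ^+ 2.
      apply: le_trans dn _; rewrite ncon_sum mulr_sumr.
      have -> : th * N n ^+ 2 = \sum_(a : 'I_n.+1) th * N n by rewrite sumr_const card_ord -[RHS]mulr_natr expr2 mulrA.
      rewrite -big_split /=; apply: ler_sum => a _.
      have -> : \sum_(v : 'I_n.+1) (v \in ball (Gr w) K a)%:R = #|ball (Gr w) K a|%:R :> R.
        by rewrite -sum1_card natr_sum [RHS]big_mkcond; apply: eq_bigr => v _; case: ifP.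
      case: (lerP (th * N n)) => h; last by rewrite mulr0 add0r ltW.
      rewrite mulr1; apply: (@le_trans _ _ (N n)); last by rewrite lerDl mulr_ge0 // ltW.
      by rewrite ler_nat; apply: leq_trans (max_card _) _; rewrite card_ord.
    have -> : eps = th + th by rewrite /th; lra.
    move=> h; rewrite -(ler_pM2l N0); move: h; rewrite expr2; lra.
  rewrite ler_pdivlMr // mulr_suml /X exchange_big /=; apply: ler_sum => v _.
  case: ltP => small; last by rewrite mul0r sumr_ge0.
  rewrite mul1r.
  have -> : th / 2 * N n = th * N n - th / 2 * N n by lra.
  apply: (@le_trans _ _ (\sum_(a : 'I_n.+1) (th * N n <= #|ball (Gr w) K a|%:R)%R%:R - #|ball (Gr w) K1 v|%:R)).
    by apply: lerB => //; apply: ltW.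
  rewrite lerBlDr -sum1_card natr_sum [X in _ <= _ + X]big_mkcond -big_split /=; apply: ler_sum => a _.
  rewrite [X in (if X then _ else _)]ball_sym; last exact: Gr_sym.
  by case: (th * N n <= _); case: (v \in _); rewrite ?addr0 ?add0r.
rewrite addnA -/K1.
suff : N n ^+ 2 - close_mass n (K1 + L2) <= eta * N n ^+ 2 by lra.
rewrite close_mass_compl; apply: (@le_trans _ _ (\sum_(u : 'I_n.+1) \sum_(v : 'I_n.+1)
   (PR n (fun w => (th / 2 * N n <= #|ball (Gr w) K1 u|%:R) && (v \notin ball (Gr w) (K1 + L2) u)) +
    PR n (fun w => #|ball (Gr w) K1 u|%:R < th / 2 * N n)))).
  apply: ler_sum => u _; apply: ler_sum => v _; apply: Pr_union => // w vn.
  by rewrite vn andbT; case: ltP.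
rewrite (eq_bigr _ (fun u _ => big_split _ _ _ _ _)) big_split /=.
have -> : eta * N n ^+ 2 = eta / 3 * N n ^+ 2 + 2 * eta / 3 * N n * N n by lra.
apply: lerD => //; rewrite -[leRHS]mulrC.
rewrite (eq_bigr (fun u => N n * PR n (fun w => #|ball (Gr w) K1 u|%:R < th / 2 * N n))) => [|u _].
  by rewrite -mulr_sumr ler_wpM2l // ltW.
by rewrite sumr_const card_ord -[LHS]mulr_natr mulrC.
Qed.

End IID.

(** * Concentration of distances in the independent model *)

Section Distances.
Variables (R : realType) (m : nat) (p : R) (d0 d1 : 'I_m).
Hypotheses (p0 : 0 < p) (p1 : p <= 1) (d00 : d0 = 0%N :> nat) (d01 : d0 != d1).
Hypothesis pm1 : 1 < p * m%:R.
Local Notation PR n := (Pr (@q R n m p)).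
Local Notation N n := (n.+1%:R : R).
Local Notation close_mass := (@close_mass R m p).

Lemma fast_to_full (eps eta : R) D : 0 < eps -> eps <= 1 -> 0 < eta -> (0 < D)%N ->
  12 * Cdec m p / (D%:R * eps ^+ 2) <= eta / 6 ->
  exists b n0, forall n s, (n0 <= n)%N -> scale D n s -> forall r, (16 * r ^ 2 <= n.+1)%N ->
    eps * N n <= meanfast n m p s r -> (1 - eta) * N n ^+ 2 <= close_mass n (r + r + b).
Proof.
move=> e0 e1 eta0 D0 HD; have [gam [gam' [th [gam1 g_lt th0 th2 g_le]]]] := growth_constants p0 pm1.
have eta3 : 0 < eta / 3 by rewrite divr_gt0.
have HD' : 12 * Cdec m p / (D%:R * eps ^+ 2) <= eta / 3 / 2 by apply: le_trans HD _; lra.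
have [b [n1 H1]] := fast_pairs_meet p0 p1 d00 d01 gam1 g_lt th0 th2 g_le e0 eta3 D0 HD'.
have e80 : 0 < eps ^+ 2 / 8 by rewrite divr_gt0 // exprn_gt0.
have e81 : eps ^+ 2 / 8 <= 1.
  have : eps ^+ 2 <= 1 by rewrite expr_le1 // ltW.
  by lra.
have [L [n2 H2]] := dense_to_full p0 p1 d00 d01 e80 e81 eta0.
set c := (b + L + 3)%N; exists (b + 2 + L)%N, (maxn n1 (maxn n2 (4 * c ^ 2))) => n s.
rewrite !geq_max => /and3P[n1n n2n cn] sc r rn Q.
rewrite -addnA -!addnA (addnA r) (addnA b) !addnA; apply: H2 => //; last exact: H1 Q.
have -> : ((r + r + b + 2 + L).+1 = 2 * r + c)%N by rewrite /c; clear; lia.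
move: rn cn; clear; move: (n) c => n' c; rewrite -!mulnn => h1 h2.
(* The form of [(2 * r - c) ^ 2 >= 0] in natural numbers: at least one of the two truncated
   differences vanishes. *)
have := (leq0n ((2 * r - c) * (2 * r - c) + (c - 2 * r) * (c - 2 * r))%N); nia.
Qed.

(** Layers of [K] vertices already reach [s] within a radius of order [sqrt n], so at least half of
    the vertices are fast in mean. This is an a priori bound on the distance scale. *)
Lemma sqrt_radius_full (eta : R) : 0 < eta -> exists b n0, forall n, (n0 <= n)%N -> forall r, scale 16 n r ->
  (1 - eta) * N n ^+ 2 <= close_mass n (r + r + b).
Proof.
move=> eta0; have [gam [gam' [th [gam1 g_lt th0 th2 g_le]]]] := growth_constants p0 pm1.
have Cd0 := Cdec_ge0 m p0; have Cp0 := Cpot_ge0 m p0 gam1 g_lt.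
have [D' HD] := nat_above (12 * Cdec m p * 4 * 6 / eta); set D := D'.+1.
have D0 : (0 < D)%N by [].
have h0 : 0 < 2^-1 :> R by rewrite invr_gt0.
have h1 : 2^-1 <= 1 :> R by lra.
have {}HD : 12 * Cdec m p / (D%:R * 2^-1 ^+ 2) <= eta / 6.
  rewrite ler_pdivrMr ?mulr_gt0 ?ltr0n ?exprn_gt0 //.
  have : D'%:R <= D%:R :> R by rewrite ler_nat.
  by move: HD; rewrite ler_pdivrMr // => HD h; have := ler_wpM2l (ltW eta0) h; rewrite expr2; lra.
have [b [n1 H1]] := fast_to_full h0 h1 eta0 D0 HD.
(* The summand 16 ensures [K * (r - c) >= 8 * r >= s], as [2 * c <= r]. *)
have [K' HK] := nat_above (4 * Cpot m p gam gam'); set K := (K'.+1 + 16)%N.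
have K0 : (0 < K)%N by [].
have q4 : 0 < 4^-1 :> R by rewrite invr_gt0.
have [c [n2 H2]] := reach p0 p1 d00 gam1 g_lt th0 th2 g_le K0 q4.
have [S1 HS1] := nat_above (th^-1).
have [S2 HS2] := nat_above ((p / 4)^-1).
have [n3 H3] := scale_large (maxn S1 (maxn S2 (maxn 1 (K * c.+1)))) D0.
have [n4 H4] := @scale_large 16 (2 * c) isT.
have [n5 H5] := scale_exists D0.
exists b, (maxn n1 (maxn n2 (maxn n3 (maxn n4 n5)))) => n.
rewrite !geq_max => /and5P[n1n n2n n3n n4n n5n] r scr.
have [s s0 scs] := H5 n n5n.
have := H3 n s n3n scs; rewrite !geq_max => /and4P[S1s S2s _ Ks].
have cr := H4 n r n4n scr.
have up x (k : nat) : x <= k%:R -> (k <= s)%N -> x <= s%:R :> R.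
  by move=> h ks; apply: le_trans h _; rewrite ler_nat.
have sth : s%:R <= th * n.+1%:R := scale_le D0 th0 scs (up _ _ HS1 S1s).
have sN : 4 * s%:R <= p * n.+1%:R.
  have := scale_le D0 (divr_gt0 p0 (ltr0n R 4)) scs (up _ _ HS2 S2s); lra.
have s8 : (s <= 8 * r)%N.
  have /andP[h _] := scs; have /andP[_ h'] := scr.
  rewrite -leq_sqr; apply: leq_trans (_ : 4 * 16 * r ^ 2 <= _)%N; last by rewrite expnMn leq_mul2r leqnn orbT.
  by apply: leq_trans h'; apply: leq_trans h; rewrite leq_pmull.
apply: (H1 n s) => //; first by case/andP: scr.
suff : \sum_u PR n (fun w => #|SA s u r w| < s)%N <= 2^-1 * N n by rewrite sum_slow; lra.
apply: (@le_trans _ _ (\sum_(u : 'I_n.+1) 2^-1)); last by rewrite sumr_const card_ord -[leLHS]mulr_natr.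
apply: ler_sum => u _.
apply: le_trans (slow_fail p0 p1 s0 sN gam1 g_lt sth g_le u K0 Ks _ _) _.
- by move: cr; clear; lia.
- by move: cr s8; rewrite /K; clear; nia.
have -> : 2^-1 = 4^-1 + 4^-1 :> R by lra.
apply: lerD; last exact: H2.
rewrite ler_pdivrMr ?ltr0n //.
have : K'%:R <= K%:R :> R by rewrite ler_nat /K addSn -addnS leq_addr.
by move: HK; lra.
Qed.

(** Reads [close_pairs] backwards: once [D] makes the decoupling error at most [eps / 2], a density
    [eps] of close pairs forces [meanfast] to be at least [eps / 4 * N]. *)
Lemma partial_to_full_even (eps eta : R) : 0 < eps -> eps <= 1 -> 0 < eta -> exists b n0, forall n, (n0 <= n)%N -> forall r,
  (16 * r ^ 2 <= n.+1)%N -> eps * N n ^+ 2 <= close_mass n (r + r) -> (1 - eta) * N n ^+ 2 <= close_mass n (r + r + b).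
Proof.
move=> e0 e1 eta0; have Cd0 := Cdec_ge0 m p0; set ep := eps / 4.
have ep0 : 0 < ep by rewrite divr_gt0.
have ep1 : ep <= 1 by rewrite /ep; lra.
have [D1 HD1] := nat_above (12 * Cdec m p * 6 / (eta * ep ^+ 2)).
have [D2 HD2] := nat_above (2 * Cdec m p / eps).
set D := (D1 + D2).+1; have D0 : (0 < D)%N by [].
have Dr0 : 0 < D%:R :> R by rewrite ltr0n.
have ep2 : 0 < ep ^+ 2 by rewrite exprn_gt0.
have HDa : 12 * Cdec m p / (D%:R * ep ^+ 2) <= eta / 6.
  rewrite ler_pdivrMr; last exact: mulr_gt0 Dr0 ep2.
  have h : D1%:R <= D%:R :> R by rewrite ler_nat /D -addnS leq_addr.
  have ee0 : 0 < eta * ep ^+ 2 by rewrite mulr_gt0.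
  move: HD1; rewrite ler_pdivrMr // => HD1; have := ler_wpM2r (ltW ee0) h; lra.
have HDb : Cdec m p / D%:R <= eps / 2.
  rewrite ler_pdivrMr //.
  have h : D2%:R <= D%:R :> R by rewrite ler_nat /D -addSn leq_addl.
  move: HD2; rewrite ler_pdivrMr // => HD2; have := ler_wpM2r (ltW e0) h; lra.
have [b [n1 H1]] := fast_to_full ep0 ep1 eta0 D0 HDa.
have [S2 HS2] := nat_above ((p / 4)^-1).
have [n2 H2] := scale_large S2 D0.
have [n3 H3] := scale_exists D0.
exists b, (maxn n1 (maxn n2 n3)) => n; rewrite !geq_max => /and3P[n1n n2n n3n] r rn F.
have [s s0 scs] := H3 n n3n; have S2s := H2 n s n2n scs.
have sN : 4 * s%:R <= p * n.+1%:R.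
  have h : (p / 4)^-1 <= s%:R by apply: le_trans HS2 _; rewrite ler_nat.
  have := scale_le D0 (divr_gt0 p0 (ltr0n R 4)) scs h; lra.
apply: (H1 n s) => //; have N0 := N_gt0 R n.
have err : errdec n m p s <= eps / 2.
  apply: le_trans (errdec_le n m p0 s0) _; apply: le_trans HDb.
  rewrite ler_pdivrMr // mulrAC -mulrA ler_wpM2l // ler_pdivlMr // mulrC.
  by case/andP: scs => h _; rewrite -natrX -natrM ler_nat.
have CP : close_mass n (r + r) <= 2 * meanfast n m p s r * N n + errdec n m p s * N n ^+ 2 by exact: close_pairs.
have {}CP := le_trans F CP.
have : errdec n m p s * N n ^+ 2 <= eps / 2 * N n ^+ 2 by rewrite ler_wpM2r // exprn_ge0.
move=> h; rewrite -(ler_pM2r N0) /ep; move: CP h; rewrite !expr2; lra.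
Qed.

(** [k] is rounded up to an even number. If its half exceeds the square-root scale allowed in the
    even case, [sqrt_radius_full] applies at a smaller radius. *)
Lemma partial_to_full (eps eta : R) : 0 < eps -> eps <= 1 -> 0 < eta -> exists b n0, forall n, (n0 <= n)%N -> forall k,
  eps * N n ^+ 2 <= close_mass n k -> (1 - eta) * N n ^+ 2 <= close_mass n (k + b).
Proof.
move=> e0 e1 eta0; have [b1 [n1 H1]] := partial_to_full_even e0 e1 eta0; have [b2 [n2 H2]] := sqrt_radius_full eta0.
have [n3 H3] := @scale_exists 16 isT.
exists (b1.+1 + b2)%N, (maxn n1 (maxn n2 n3)) => n; rewrite !geq_max => /and3P[n1n n2n n3n] k Fk.
have kr : (k <= uphalf k + uphalf k <= k.+1)%N by rewrite addnn uphalfE; clear; lia.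
move: (uphalf k) kr => r /andP[kr rk].
case: (leqP (16 * r ^ 2) n.+1) => rn.
  have F2 := le_trans Fk (close_mass_mono m p0 p1 n kr).
  apply: le_trans (H1 n n1n r rn F2) _.
  apply: close_mass_mono => //; move: rk; clear; lia.
have [r1 _ sc] := H3 n n3n; apply: le_trans (H2 n n2n r1 sc) _; apply: close_mass_mono => //.
have : (r1 < r)%N.
  have /andP[h _] := sc; have := leq_ltn_trans h rn; rewrite ltn_pmul2l //.
  by rewrite ltn_sqr.
by move: rk; clear; lia.
Qed.

(* The median distance; the default value [n.+1] does not occur for large [n]. *)
Definition typical n := find (fun k => N n ^+ 2 / 2 <= close_mass n k) (iota 0 n.+1).

Lemma typical_before n k : (k < typical n)%N -> (k <= n)%N -> close_mass n k < N n ^+ 2 / 2.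
Proof. by move=> kt kn; have := before_find 0%N kt; rewrite nth_iota // ltNge => ->. Qed.

Lemma typical_at n k : (k <= n)%N -> N n ^+ 2 / 2 <= close_mass n k -> (typical n <= k)%N /\ N n ^+ 2 / 2 <= close_mass n (typical n).
Proof.
move=> kn Fk; have hs : has (fun k => N n ^+ 2 / 2 <= close_mass n k) (iota 0 n.+1).
  by apply/hasP; exists k => //; rewrite mem_iota.
have h := nth_find 0%N hs; move: (hs); rewrite has_find size_iota => ts.
rewrite nth_iota // in h; split=> //.
by rewrite leqNgt; apply/negP => /typical_before /(_ kn); rewrite ltNge Fk.
Qed.

(** The threshold is used upwards from density 1/2 at [typical n], and downwards by contraposition:
    density [eta] well before [typical n] would give density 1/2 too early. The square-root bound
    keeps [typical n + B] at most [n]. *)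
Lemma concentration (eta : R) : 0 < eta -> eta <= 1 -> exists B n0, forall n, (n0 <= n)%N ->
  [/\ (typical n + B <= n)%N, (1 - eta) * N n ^+ 2 <= close_mass n (typical n + B) &
      forall k, (k + B < typical n)%N -> close_mass n k <= eta * N n ^+ 2].
Proof.
move=> eta0 eta1; have h0 : 0 < 2^-1 :> R by rewrite invr_gt0.
have h1 : 2^-1 <= 1 :> R by lra.
have [b [n1 H1]] := sqrt_radius_full h0; have [n2 H2] := @scale_exists 16 isT.
have [b3 [n3 H3]] := partial_to_full h0 h1 eta0; have [b4 [n4 H4]] := partial_to_full eta0 eta1 h0.
exists (b3 + b4)%N, (maxn n1 (maxn n2 (maxn n3 (maxn n4 (2 * (b + b3 + b4).+1))))) => n.
rewrite !geq_max => /and5P[n1n n2n n3n n4n bn].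
have [r r0 sc] := H2 n n2n; have := H1 n n1n r sc; have /andP[rn _] := sc.
have -> : (1 - 2^-1) * N n ^+ 2 = N n ^+ 2 / 2 by lra.
have rb : (r + r + b + (b3 + b4) <= n)%N.
  by move: rn bn r0; clear; rewrite -mulnn; nia.
move=> Fr; have [] := typical_at (leq_trans (leq_addr _ _) rb) Fr; move=> tr Ft.
have tn : (typical n + (b3 + b4) <= n)%N by apply: leq_trans rb; rewrite leq_add2r.
split=> // [|k kt].
  apply: le_trans (H3 n n3n (typical n) _) _; first by apply: le_trans Ft; lra.
  by apply: close_mass_mono => //; rewrite leq_add2l leq_addr.
rewrite leNgt; apply/negP => /ltW /(H4 n n4n k).
have k4 : (k + b4 < typical n)%N by apply: leq_ltn_trans kt; rewrite leq_add2l leq_addl.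
have kn : (k + b4 <= n)%N by apply: leq_trans (ltnW k4) (leq_trans (leq_addr _ _) tn).
have := typical_before k4 kn; lra.
Qed.

End Distances.

(** * Comparison with sequential rewiring *)

Section Runs.
Variables (R : realType) (J S : finType).
Local Notation Om := {ffun J -> S}.
Local Notation kernel := (Om -> J -> S -> R).
Implicit Types (k : kernel) (l : seq J) (w : Om) (f g : Om -> R).

Definition upd w e y : Om := [ffun e' => if e' == e then y else w e'].

(** Mean of [f] after redrawing the slots of [l] in turn, with laws depending on the current
    configuration; the backward recursion lets kernels be compared by induction on [l]. *)
Fixpoint run k l w f : R := if l is e :: l' then \sum_y k w e y * run k l' (upd w e y) f else f w.

Definition agree l w w' := [forall e, (e \in l) || (w' e == w e)].

Lemma agreeP l w w' : reflect (forall e, e \notin l -> w' e = w e) (agree l w w').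
Proof.
apply: (iffP forallP) => H e; first by move=> el; have := H e; rewrite (negbTE el) => /eqP.
by case: (boolP (e \in l)) => //= /H ->.
Qed.

Lemma agree_upd l w w' e y : agree l (upd w e y) w' -> agree (e :: l) w w'.
Proof.
move=> /agreeP H; apply/agreeP => e'; rewrite inE negb_or => /andP[/negbTE ee el].
by rewrite H // ffunE ee.
Qed.

Lemma run_le k l w f g : (forall w e y, 0 <= k w e y) -> (forall w', agree l w w' -> f w' <= g w') ->
  run k l w f <= run k l w g.
Proof.
move=> k0; elim: l w => [|e l IH] w H /=; first by apply: H; apply/agreeP.
apply: ler_sum => y _; rewrite ler_wpM2l //; apply: IH => w' h; exact: H (agree_upd h).
Qed.

Lemma run_cst k l w c : (forall w e, \sum_y k w e y = 1) -> run k l w (fun=> c) = c.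
Proof.
move=> k1; elim: l w => //= e l IH w; rewrite (eq_bigr (fun y => k w e y * c)) => [|y _]; last by rewrite IH.
by rewrite -mulr_suml k1 mul1r.
Qed.

Lemma runZ k l w c f : run k l w (fun w => c * f w) = c * run k l w f.
Proof.
elim: l w => //= e l IH w; rewrite mulr_sumr; apply: eq_bigr => y _ /=.
by rewrite IH mulrCA.
Qed.

Lemma run_product (q : J -> S -> R) l w f : uniq l ->
  run (fun=> q) l w f = \sum_w' (agree l w w')%:R * (\prod_(e <- l) q e (w' e)) * f w'.
Proof.
elim: l w => [|e l IH] w /=.
  under eq_bigr do rewrite big_nil mulr1.
  rewrite (bigD1 w) //= big1 => [|w' /negP ww].
    rewrite addr0; suff -> : agree [::] w w by rewrite mul1r.
    exact/agreeP.
  case: (boolP (agree _ _ _)) => [/agreeP h|_]; last by rewrite !mul0r.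
  by exfalso; apply: ww; apply/eqP/ffunP => e; apply: h.
move=> /andP[el lu]; under eq_bigr do rewrite IH // mulr_sumr.
rewrite exchange_big /=; apply: eq_bigr => w' _.
rewrite (bigD1 (w' e)) //= [X in _ + X]big1 => [|y /eqP yw].
  rewrite addr0 big_cons; set a := agree _ _ _; have -> : a = agree (e :: l) w w'.
    apply/idP/idP => [/agree_upd//|/agreeP h]; apply/agreeP => e' e'l; rewrite ffunE.
    by case: eqP => [->//|/eqP ne]; apply: h; rewrite inE negb_or ne.
  by rewrite -!mulrA mulrCA.
case: (boolP (agree _ _ _)) => [/agreeP h|_]; last by rewrite !mul0r mulr0.
by exfalso; apply: yw; rewrite (h e el) ffunE eqxx.
Qed.

Lemma run_Ex (q : J -> S -> R) l w f : uniq l -> (forall e, e \in l) -> run (fun=> q) l w f = Ex q f.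
Proof.
move=> lu lT; rewrite run_product //; apply: eq_bigr => w' _.
have -> : agree l w w' by apply/agreeP => e; rewrite lT.
rewrite mul1r; congr (_ * _); rewrite /mass; have pe : perm_eq l (index_enum J).
  by apply: uniq_perm; rewrite ?index_enum_uniq // => e; rewrite lT mem_index_enum.
by rewrite (perm_big _ pe).
Qed.

End Runs.

Section Trajectories.
Variables (R : realType) (n : nat) (p : R) (T : Type) (st : T -> graph n -> fdist R (graph n)).
Implicit Types (l : seq T) (G : graph n).

Fixpoint trun l G (F : graph n -> R) : R := if l is s :: l' then \sum_G' st s G G' * trun l' G' F else F G.

(** Duality between pushing the law forward and pulling the test function back along the chain. *)
Lemma foldl_trun l (mu : fdist R (graph n)) F :
  \sum_G foldl (fun mu s => fbind mu (st s)) mu l G * F G = \sum_G mu G * trun l G F.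
Proof.
elim: l mu => //= s l IH mu; rewrite IH.
under eq_bigr do rewrite /fbind mulr_suml.
rewrite exchange_big /=; apply: eq_bigr => G _; rewrite mulr_sumr.
by apply: eq_bigr => G' _; rewrite mulrA.
Qed.

End Trajectories.

(** * Rewiring expressed on slot configurations *)

Section Coupling.
Variables (R : realType) (n m : nat) (p : R).
Hypotheses (p0 : 0 < p) (p1 : p <= 1) (mn : (2 * m < n.+1)%N).
Local Notation V := 'I_n.+1.
Local Notation N := (n.+1%:R : R).
Local Notation slot := ('I_m * V)%type.
Local Notation Om := {ffun slot -> V}.
Local Notation q := (@q R n m p).
Local Notation qge0 := (q_ge0 p0 p1).
Local Notation lat := (@lat n m).
Implicit Types (e : slot) (w : Om) (x y u v : V) (l : seq slot).

Definition cand w u := [set y : V | (y != u) && ((u, y) \notin Gr w)].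

Definition ker w e y : R := if cand w e.2 == set0 then (y == lat e)%:R else
  (1 - p) * (y == lat e)%:R + p * ((y \in cand w e.2)%:R / #|cand w e.2|%:R).

Lemma ker_ge0 w e y : 0 <= ker w e y.
Proof.
rewrite /ker; case: ifP => // _; apply: addr_ge0; first by rewrite mulr_ge0 // subr_ge0.
by rewrite mulr_ge0 ?(ltW p0) // divr_ge0.
Qed.

Lemma ker_sum1 w e : \sum_y ker w e y = 1.
Proof.
have d1 : \sum_y (y == lat e)%:R = 1 :> R by rewrite (bigD1 (lat e)) //= eqxx big1 ?addr0 // => y /negbTE ->.
rewrite /ker; case: (boolP (cand w e.2 == set0)) => C0 //; rewrite big_split /= -!mulr_sumr d1 -mulr_suml.
have -> : \sum_y (y \in cand w e.2)%:R = #|cand w e.2|%:R :> R.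
  by rewrite -sum1_card natr_sum [RHS]big_mkcond; apply: eq_bigr => y _; case: ifP.
by rewrite mulfV ?pnatr_eq0 -?lt0n ?card_gt0 //; lra.
Qed.

(* Each slot carries its own edge, so overwriting a slot moves exactly one edge. *)
Definition simple w := [forall e, (w e != e.2) &&
  [forall e', (e' != e) ==> ~~ ((e'.2 == e.2) && (w e' == w e)) && ~~ ((e'.2 == w e) && (w e' == e.2))]].

Lemma simpleP w : reflect ((forall e, w e != e.2) /\ forall e e', e' != e ->
    ~~ ((e'.2 == e.2) && (w e' == w e)) /\ ~~ ((e'.2 == w e) && (w e' == e.2))) (simple w).
Proof.
apply: (iffP forallP) => [H|[H1 H2] e]; last first.
  by rewrite H1; apply/forallP => e'; apply/implyP => /H2 /andP.
split=> [e|e e' ee]; first by case/andP: (H e).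
by case/andP: (H e) => _ /forallP/(_ e'); rewrite ee => /andP.
Qed.

Lemma GrE w x y : ((x, y) \in Gr w) = [exists e, ((e.2 == x) && (w e == y)) || ((e.2 == y) && (w e == x))].
Proof.
rewrite inE /adj /=; apply/orP/existsP.
  by case=> /existsP[d /eqP h]; [exists (d, x) | exists (d, y)]; rewrite /= eqxx h eqxx ?orbT.
case=> -[d z] /= /orP[] /andP[/eqP -> h]; [left|right]; by apply/existsP; exists d.
Qed.

Lemma Gr_upd w e y : simple w -> y \in cand w e.2 ->
  simple (upd w e y) /\ Gr (upd w e y) = add_edge (rem_edge (Gr w) e.2 (w e)) e.2 y.
Proof.
move=> /simpleP[nl di]; rewrite inE => /andP[yu yn].
have yn' e' : ~~ ((e'.2 == e.2) && (w e' == y)) /\ ~~ ((e'.2 == y) && (w e' == e.2)).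
  by split; apply: contra yn => h; rewrite GrE; apply/existsP; exists e'; rewrite h ?orbT.
split.
  apply/simpleP; split=> [e'|a b ba]; rewrite !ffunE; first by case: (e' =P e) => [->|].
  case: (eqVneq b e) ba => [-> ea|be ba]; case: (eqVneq a e) => [ae|ae].
  - by rewrite ae eqxx in ea.
  - by have [h1 h2] := yn' a; rewrite /= !(eq_sym e.2) !(eq_sym y); split=> //; rewrite andbC.
  - by rewrite ae; exact: yn'.
  - exact: di.
apply/setP => -[a b]; rewrite GrE !inE !xpair_eqE -/(adj w a b).
have -> : adj w a b = ((a, b) \in Gr w) by rewrite inE.
rewrite GrE; apply/existsP/orP.
  case=> e'; rewrite ffunE; case: (eqVneq e' e) => [-> h|ee h]; [right|left].
    by case/orP: h => /andP[/eqP -> /eqP ->]; rewrite !eqxx ?orbT.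
  apply/andP; split; last by apply/existsP; exists e'.
  have [h1 h2] := di _ _ ee; apply/negP => /orP[] /andP[/eqP aE /eqP bE]; move: h; rewrite aE bE.
    by rewrite (negbTE h1) (negbTE h2).
  by rewrite (negbTE h1) (negbTE h2).
case=> [/andP[ne /existsP[e' h]]|h].
  exists e'; rewrite ffunE; case: (e' =P e) => // ee; rewrite ee in h; exfalso; move/negP: ne; apply.
  by case/orP: h => /andP[/eqP <- /eqP <-]; rewrite !eqxx ?orbT.
exists e; rewrite ffunE eqxx.
by case/orP: h => /andP[/eqP -> /eqP ->]; rewrite !eqxx ?orbT.
Qed.

Lemma upd_id w e : upd w e (w e) = w.
Proof. by apply/ffunP => e'; rewrite ffunE; case: eqP => [->|]. Qed.

Definition step (e : slot) : graph n.+1 -> fdist R (graph n.+1) := rewire_step p e.2 (lat e).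

(** A slot not yet processed still carries its lattice edge, so the edge to be rewired is present.
    Simplicity makes the graph step the image of overwriting this single slot. *)
Lemma step_ker w e (F : graph n.+1 -> R) : simple w -> w e = lat e ->
  \sum_G step e (Gr w) G * F G = \sum_y ker w e y * F (Gr (upd w e y)).
Proof.
move=> sw we; rewrite /step /rewire_step.
have -> : (e.2, lat e) \in Gr w.
  by rewrite GrE; apply/existsP; exists e; rewrite we !eqxx.
have stay : \sum_G (G == Gr w)%:R * F G = F (Gr w).
  by rewrite (bigD1 (Gr w)) //= eqxx mul1r big1 ?addr0 // => G /negbTE ->; rewrite mul0r.
have stay' : \sum_y (y == lat e)%:R * F (Gr (upd w e y)) = F (Gr w).
  rewrite (bigD1 (lat e)) //= eqxx mul1r big1 ?addr0 => [|y /negbTE ->]; last by rewrite mul0r.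
  by rewrite -we upd_id.
have CE : [set v : V | (v != e.2) && ((e.2, v) \notin Gr w)] = cand w e.2 by [].
rewrite CE /ker; case: (cand w e.2 == set0); first by rewrite stay' /dirac stay.
under eq_bigr do rewrite mulrDl -!mulrA; rewrite big_split /= -!mulr_sumr stay.
under [RHS]eq_bigr do rewrite mulrDl -!mulrA; rewrite [RHS]big_split /= -!mulr_sumr stay'.
congr (_ + _ * _).
under eq_bigr do rewrite mulrCA mulr_suml mulr_sumr.
rewrite exchange_big /= big_mkcond; apply: eq_bigr => y _; case: ifPn => yC; last by rewrite mul0r.
have := (Gr_upd sw yC).2; rewrite we => <-; rewrite mul1r (bigD1 (Gr (upd w e y))) //= eqxx mul1r big1 ?addr0 // => G /negbTE ->.
by rewrite mul0r mulr0.
Qed.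

End Coupling.

(** * The initial lattice, the schedule, and degrees during the run *)

Section Contiguity.
Variables (R : realType) (n m : nat) (p : R).
Hypotheses (p0 : 0 < p) (p1 : p <= 1) (mn : (2 * m < n.+1)%N).
Local Notation V := 'I_n.+1.
Local Notation N := (n.+1%:R : R).
Local Notation slot := ('I_m * V)%type.
Local Notation Om := {ffun slot -> V}.
Local Notation q := (@q R n m p).
Local Notation qge0 := (q_ge0 p0 p1).
Local Notation lat := (@lat n m).
Local Notation ker := (@ker R n m p).
Local Notation step := (@step R n m p).
Implicit Types (e : slot) (w : Om) (x y u v : V) (l : seq slot).

Definition lattice : Om := [ffun e => lat e].

Lemma latE d x : lat (d, x) = x + inZp d.+1.
Proof. exact: iter_ordSE. Qed.

Lemma val_inZp (d : 'I_m) : (inZp d.+1 : V) = d.+1 :> nat.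
Proof. by rewrite /= modn_small //; move: (ltn_ord d) mn; clear; lia. Qed.

(** [2 * m < n.+1] prevents two offsets from adding up to a full turn, hence prevents an edge from
    being carried by two slots. *)
Lemma lattice_simple : simple lattice.
Proof.
apply/simpleP; split=> [[d x]|[d x] [d' x'] ne]; rewrite !ffunE !latE /=.
  by apply/eqP => /(canRL (addKr x)); rewrite addNr => /(congr1 val) /=; rewrite modn_small //; move: (ltn_ord d) mn; clear; lia.
split; apply/negP => /andP[/eqP xx /eqP h].
  move: ne; rewrite xx in h *; move: h => /addrI/(congr1 (@nat_of_ord _)); rewrite !val_inZp => -[/val_inj ->].
  by rewrite eqxx.
rewrite xx -addrA in h; move: h => /(canRL (addKr x)); rewrite addNr => /(congr1 (@nat_of_ord _)).
have -> : (inZp d.+1 : V) + inZp d'.+1 = (d.+1 + d'.+1)%N :> nat.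
  rewrite [LHS]/= modnDm modn_small //; move: (ltn_ord d) (ltn_ord d') mn; clear; lia.
by [].
Qed.

Lemma val_subr x y : (y - x : V) = ((y + n.+1 - x) %% n.+1)%N :> nat.
Proof. by rewrite /= modnDmr addnBA // ltnW. Qed.

Lemma lattice_hit x y : [exists d, lat (d, x) == y] = (x != y) && (((y + n.+1 - x) %% n.+1)%N <= m)%N.
Proof.
rewrite -val_subr; apply/existsP/andP => [[d /eqP <-]|[xy ym]].
  rewrite latE addrAC subrr add0r val_inZp ltn_ord; split=> //.
  by have /simpleP[/(_ (d, x)) h _] := lattice_simple; move: h; rewrite ffunE latE eq_sym.
have k0 : (0 < (y - x)%R)%N.
  rewrite lt0n; apply: contra xy => /eqP h; rewrite eq_sym -subr_eq0; apply/eqP; exact: val_inj.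
have km : ((y - x)%R.-1 < m)%N by rewrite prednK.
exists (Ordinal km); rewrite latE (_ : nat_of_ord (Ordinal km) = (y - x)%R.-1) // prednK // valZpK addrC subrK //.
Qed.

Lemma Gr_lattice : Gr lattice = ring_lattice n.+1 m.
Proof.
apply/setP => -[x y]; rewrite !inE /adj /=.
rewrite (eq_existsb (fun d => _ : (lattice (d, x) == y) = (lat (d, x) == y))) => [|d]; last by rewrite ffunE.
rewrite (eq_existsb (fun d => _ : (lattice (d, y) == x) = (lat (d, y) == x))) => [|d]; last by rewrite ffunE.
by rewrite !lattice_hit (eq_sym y x) -andb_orr.
Qed.

Lemma trun_run l w (F : graph n.+1 -> R) : simple w -> uniq l -> (forall e, e \in l -> w e = lat e) ->
  trun step l (Gr w) F = run ker l w (F \o @Gr n m).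
Proof.
elim: l w => //= e l IH w sw /andP[el lu] wl.
rewrite step_ker //; last by rewrite wl // inE eqxx.
apply: eq_bigr => y _; have updl e' : e' \in l -> upd w e y e' = lat e'.
  move=> e'l; rewrite ffunE; case: (e' =P e) => [ee|_]; first by rewrite -ee e'l in el.
  by rewrite wl // inE e'l orbT.
case: (boolP (y \in cand w e.2)) => yC; first by rewrite IH // (Gr_upd sw yC).1.
case: (eqVneq y (lat e)) => [yE|yE].
  by rewrite IH // yE -wl ?inE ?eqxx // upd_id.
rewrite /ker (negbTE yE) (negbTE yC) mul0r !mulr0 addr0.
by case: ifP; rewrite !mul0r.
Qed.

Definition slots : seq slot := [seq (d, x) | d <- enum 'I_m, x <- enum V].

Lemma slots_uniq : uniq slots.
Proof. by apply: allpairs_uniq; rewrite ?enum_uniq // => -[a b] [c d]. Qed.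

Lemma mem_slots e : e \in slots.
Proof. by case: e => d x; apply: allpairs_f; rewrite mem_enum. Qed.

Lemma WS_scheduleE : WS_schedule n.+1 m = [seq (e.1.+1, e.2) | e <- slots].
Proof.
rewrite /WS_schedule /slots map_allpairs /=; have -> : minn m n = m by apply/minn_idPl; move: mn; clear; lia.
by rewrite (iotaDl 1 0) -val_enum_ord -map_comp allpairs_mapl.
Qed.

Lemma WS_run (F : graph n.+1 -> R) : \sum_G WS_law m p G * F G = run ker slots lattice (F \o @Gr n m).
Proof.
rewrite -trun_run ?lattice_simple ?slots_uniq // => [|e _]; last by rewrite ffunE.
rewrite Gr_lattice /WS_law WS_scheduleE.
have -> (mu : fdist R (graph n.+1)) : foldl (fun mu du => fbind mu (rewire_step p du.2 (cshift du.1 du.2))) mu [seq (e.1.+1, e.2) | e <- slots]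
  = foldl (fun mu s => fbind mu (step s)) mu slots.
  by elim: slots mu => //= e l IH mu; rewrite IH.
rewrite foldl_trun (bigD1 (ring_lattice n.+1 m)) //= /dirac eqxx mul1r big1 ?addr0 // => G /negbTE ->.
by rewrite mul0r.
Qed.

Lemma card_cand w u : (n.+1 <= #|cand w u| + (1 + m + indeg w u))%N.
Proof.
set O := [set w (d, u) | d in 'I_m]; set I := [set e.2 | e in [set e | w e == u]].
have cov : [set: V] \subset cand w u :|: ([set u] :|: O :|: I).
  apply/subsetP => y _; rewrite !inE; case: (eqVneq y u) => //= yu; case: (boolP (adj w u y)) => //= /orP[] /existsP[d h].
    by apply/orP; left; apply/imsetP; exists d => //; rewrite (eqP h).
  by apply/orP; right; apply/imsetP; exists (d, y); rewrite ?inE.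
have := subset_leq_card cov; rewrite cardsT card_ord => h; apply: leq_trans h _.
apply: leq_trans (leq_card_setU _ _) _; rewrite leq_add2l.
apply: leq_trans (leq_card_setU _ _) _; apply: leq_add; last exact: leq_imset_card.
apply: leq_trans (leq_card_setU _ _) _; rewrite cards1 leq_add2l.
by apply: leq_trans (leq_imset_card _ _) _; rewrite card_ord.
Qed.

(** Unprocessed slots sit at their lattice endpoints and contribute at most [m]; the others keep
    their values to the end. So the final configuration controls the degrees at every time. *)
Lemma indeg_agree l w w' u : (forall e, e \in l -> w e = lat e) -> agree l w w' ->
  (indeg w u <= m + indeg w' u)%N.
Proof.
move=> wl /agreeP ww'; set L := [set e | lat e == u].
have cL : (#|L| <= m)%N.
  have inj : {in L &, injective (fun e => e.1)}.
    move=> [d x] [d' x']; rewrite !inE => /eqP h /eqP h' /= dd; rewrite -dd in h' *.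
    by congr pair; apply: (@lat_inj n m d); rewrite h h'.
  by rewrite -(card_in_imset inj); apply: leq_trans (max_card _) _; rewrite card_ord.
apply: leq_trans (_ : #|L :|: [set e | w' e == u]| <= _)%N; last first.
  by apply: leq_trans (leq_card_setU _ _) _; rewrite leq_add2r.
apply/subset_leq_card/subsetP => e; rewrite !inE => wu; case: (boolP (e \in l)) => el.
  by rewrite -wl // wu.
by rewrite ww' // wu orbT.
Qed.

End Contiguity.

(** * Bounded density with respect to the independent model *)

Section Domination.
Variables (R : realType) (n m : nat) (p : R).
Hypotheses (p0 : 0 < p) (p1 : p <= 1) (mn : (2 * m < n.+1)%N).
Local Notation V := 'I_n.+1.
Local Notation N := (n.+1%:R : R).
Local Notation slot := ('I_m * V)%type.
Local Notation Om := {ffun slot -> V}.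
Local Notation q := (@q R n m p).
Local Notation qge0 := (q_ge0 p0 p1).
Local Notation lat := (@lat n m).
Local Notation ker := (@ker R n m p).
Implicit Types (e : slot) (w : Om) (x y u v : V) (l : seq slot) (f g : Om -> R).

(** Bound, in terms of the final configuration, on the endpoints excluded for [u] at any time: [u]
    itself, its [m] slots, [m] lattice slots pointing to it, and its final in-degree. *)
Definition load w u := (1 + 2 * m + indeg w u)%N.
Definition heavy w := [exists u, (n.+1 < 2 * load w u)%N].

(* Coincides with [ker] until some node has become adjacent to half of the others;
   after that it is the independent redraw, so that its density stays bounded. *)
Definition tame w e y : R := if (2 * #|cand w e.2| < n.+1)%N then q e y else ker w e y.

Lemma tame_ge0 w e y : 0 <= tame w e y.
Proof. by rewrite /tame; case: ifP => _; [exact: qge0 | exact: ker_ge0]. Qed.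

Lemma tame_sum1 w e : \sum_y tame w e y = 1.
Proof. by rewrite /tame; case: (_ < _)%N; [exact: q_sum1 | exact: ker_sum1]. Qed.

Lemma upd_off l w e y : e \notin l -> (forall e', e' \in e :: l -> w e' = lat e') ->
  forall e', e' \in l -> upd w e y e' = lat e'.
Proof.
move=> el wl e' e'l; rewrite ffunE; case: (e' =P e) => [ee|_]; first by rewrite -ee e'l in el.
by rewrite wl // inE e'l orbT.
Qed.

Lemma load_agree l w w' u : (forall e, e \in l -> w e = lat e) -> agree l w w' ->
  (1 + m + indeg w u <= load w' u)%N.
Proof. by move=> wl ww'; have := indeg_agree u wl ww'; rewrite /load; clear; lia. Qed.

(** The kernels differ only at a state with few candidates, and from such a state every final
    configuration is heavy, so the added indicator covers all that follows. *)
Lemma ker_le_tame l w f : uniq l -> (forall e, e \in l -> w e = lat e) -> (forall w, 0 <= f w <= 1) ->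
  run ker l w f <= run tame l w (fun w => f w + (heavy w)%:R).
Proof.
move=> lu wl f01; elim: l w lu wl => [|e l IH] w; first by move=> _ _ /=; rewrite lerDl.
move=> lu; have /andP[el lu'] := lu; move=> wl.
case: (ltnP (2 * #|cand w e.2|) n.+1) => small; last first.
  rewrite /= /tame ltnNge small /=; apply: ler_sum => y _; rewrite ler_wpM2l ?ker_ge0 //.
  by apply: IH => //; apply: upd_off.
apply: (@le_trans _ _ 1).
  rewrite -[leRHS](run_cst (k := ker) (e :: l) w 1 (@ker_sum1 R n m p)).
  by apply: run_le => [|w' _]; [exact: ker_ge0 | case/andP: (f01 w')].
rewrite -[leLHS](run_cst (k := tame) (e :: l) w 1 tame_sum1).
apply: run_le => [|w' ww']; first exact: tame_ge0.
suff -> : heavy w' by rewrite lerDr; case/andP: (f01 w').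
apply/existsP; exists e.2; have := card_cand w e.2; have := load_agree e.2 wl ww'.
by move: small; clear; lia.
Qed.

(** With [c >= N / 2] candidates and [N - c] at most the degree bound, [N / c = 1 + (N - c) / c]
    exceeds 1 by at most twice that bound over [N]. *)
Lemma tame_le w e y : tame w e y <= q e y * expR (2 * (1 + m + indeg w e.2)%:R / N).
Proof.
have N0 := N_gt0 R n; set x := 2 * _ / N.
have x0 : 0 <= x by rewrite divr_ge0 // mulr_ge0.
have E1 : 1 + x <= expR x := expR_ge1Dx x.
have E1' : 1 <= expR x by apply: le_trans E1; rewrite lerDl.
rewrite /tame; case: ltnP => small; first by rewrite ler_peMr // qge0.
have c0 : (0 < #|cand w e.2|)%N by move: small; clear; lia.
rewrite /ker; case: (boolP (_ == set0)) => [/eqP C0|_]; first by rewrite C0 cards0 in c0.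
rewrite /q [leRHS]mulrDl; apply: lerD.
  by rewrite ler_peMr // mulr_ge0 // subr_ge0.
rewrite -mulrA ler_wpM2l ?(ltW p0) //; set c := #|cand w e.2|.
have cr0 : 0 < c%:R :> R by rewrite ltr0n.
apply: (@le_trans _ _ (c%:R^-1)); first by rewrite ler_piMl ?invr_ge0 //; case: (_ \in _).
apply: (@le_trans _ _ (N^-1 * (1 + x))); last by rewrite ler_wpM2l // invr_ge0.
rewrite -[leLHS]mul1r ler_pdivrMr //.
rewrite (_ : N^-1 * (1 + x) * c%:R = c%:R * (1 + x) / N); last by rewrite mulrC mulrA mulrAC.
rewrite ler_pdivlMr // mul1r.
have cc : N <= c%:R + (1 + m + indeg w e.2)%:R by rewrite -natrD ler_nat card_cand.
have c2 : N <= 2 * c%:R by rewrite -natrM ler_nat.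
have cN : c%:R <= N by rewrite ler_nat; apply: leq_trans (max_card _) _; rewrite card_ord.
have -> : c%:R * (1 + x) = c%:R * (N + 2 * (1 + m + indeg w e.2)%:R) / N.
  rewrite /x; move: (c%:R : R) ((1 + m + indeg w e.2)%:R : R) => a d.
  by move: (n.+1%:R : R) N0 => b b0; field; rewrite gt_eqF.
rewrite ler_pdivlMr //; move: ((1 + m + indeg w e.2)%:R) (c%:R : R) (n.+1%:R : R) cr0 cc c2 cN => D C a C0 cc c2 cN.
have : 0 <= (2 * C - a) * (a - C) by rewrite mulr_ge0 // subr_ge0.
have : 0 <= C * (C + D - a) by rewrite mulr_ge0 ?subr_ge0 // ltW.
lra.
Qed.

(* The factor [exp (2 deg / N)] lost at each slot is bounded by the final in-degrees,
   whose sum over all slots is deterministic. *)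
Lemma run_tame l w g : uniq l -> (forall e, e \in l -> w e = lat e) -> (forall w, 0 <= g w) ->
  run tame l w g <= run (fun=> q) l w (fun w' => g w' * expR (\sum_(e <- l) 2 * (load w' e.2)%:R / N)).
Proof.
move=> + + g0; have N0 := N_gt0 R n.
elim: l w => [|e l IH] w; first by move=> _ _ /=; rewrite big_nil expR0 mulr1.
move=> lu; have /andP[el lu'] := lu; move=> wl /=; set E := fun w' : Om => expR (\sum_(e <- l) 2 * (load w' e.2)%:R / N).
apply: ler_sum => y _.
apply: (@le_trans _ _ (q e y * expR (2 * (1 + m + indeg w e.2)%:R / N) * run (fun=> q) l (upd w e y) (fun w' => g w' * E w'))).
  have h := IH (upd w e y) lu' (upd_off y el wl); apply: le_trans (ler_wpM2l (tame_ge0 w e y) h) _.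
  rewrite ler_wpM2r ?tame_le //.
  rewrite -[leLHS](run_cst (k := fun=> q) l (upd w e y) 0 (fun _ => q_sum1 p)).
  by apply: run_le => [w' e' y'|w' _]; [exact: qge0 | rewrite mulr_ge0 ?expR_ge0].
rewrite -mulrA ler_wpM2l ?qge0 // -runZ; apply: run_le => [w' e' y'|w' ww']; first exact: qge0.
rewrite big_cons expRD mulrCA ler_wpM2l // ler_wpM2r ?expR_ge0 // ler_expR.
rewrite ler_wpM2r ?invr_ge0 // ler_wpM2l // ler_nat.
exact: load_agree wl (agree_upd ww').
Qed.

(** In every configuration the in-degrees sum to the number [m * N] of slots; hence the density
    bound is a constant depending on [m] only. *)
Lemma sum_load w : \sum_(e <- slots n m) 2 * (load w e.2)%:R / N = 2 * m%:R * (1 + 3 * m%:R).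
Proof.
have N0 := N_gt0 R n; rewrite -mulr_suml -mulr_sumr.
have -> : \sum_(e <- slots n m) (load w e.2)%:R = m%:R * (\sum_x (load w x)%:R) :> R.
  rewrite /slots big_allpairs big_enum /= (eq_bigr (fun=> \sum_x (load w x)%:R)) => [|d _]; last by rewrite big_enum.
  by rewrite sumr_const card_ord mulr_natl.
have -> : \sum_x (load w x)%:R = N * (1 + 2 * m%:R) + m%:R * N :> R.
  under eq_bigr do rewrite /load natrD; rewrite big_split /=; congr (_ + _).
    by rewrite sumr_const card_ord -[LHS]mulr_natl natrD natrM.
  have -> : \sum_x (indeg w x)%:R = \sum_x \sum_(e : slot) (w e == x)%:R :> R.
    apply: eq_bigr => x _; rewrite /indeg -sum1_card natr_sum big_mkcond; apply: eq_bigr => e _.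
    by rewrite inE; case: eqP.
  rewrite exchange_big /= (eq_bigr (fun=> 1)) => [|e _]; first by rewrite sumr_const card_prod !card_ord natrM.
  by rewrite (bigD1 (w e)) //= eqxx big1 ?addr0 // => x /negbTE; rewrite eq_sym => ->.
by move: (m%:R) (n.+1%:R) N0 => a b b0; field; rewrite gt_eqF.
Qed.

Lemma contiguity (F : graph n.+1 -> R) : (forall G, 0 <= F G <= 1) ->
  \sum_G WS_law m p G * F G <= expR (2 * m%:R * (1 + 3 * m%:R)) * (Ex q (F \o @Gr n m) + Pr q heavy).
Proof.
move=> F01; rewrite (WS_run p mn).
have wl e : e \in slots n m -> lattice n m e = lat e by rewrite ffunE.
apply: le_trans (ker_le_tame _ wl _) _; rewrite ?slots_uniq //=.
apply: le_trans (run_tame _ wl _) _; rewrite ?slots_uniq //.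
  by move=> w; rewrite addr_ge0 //; case/andP: (F01 (Gr w)).
rewrite run_Ex ?slots_uniq //; last exact: mem_slots.
by rewrite /Pr -ExD -ExZ le_eqVlt; apply/orP; left; apply/eqP/Ex_eq => w; rewrite sum_load mulrC.
Qed.

End Domination.

(** * Strong idemetricity *)

Lemma gdist_le n (G : graph n) u v k : (k < n)%N -> v \in ball G k u ->
  exists2 d, gdist G u v = Some d & (d <= k)%N && (v \in ball G d u).
Proof.
move=> kn vk; have hs : has (fun k => v \in ball G k u) (iota 0 n).
  by apply/hasP; exists k => //; rewrite mem_iota.
have h := nth_find 0%N hs; rewrite /gdist; move: (hs) h; rewrite has_find size_iota; set d := find _ _ => dn.
rewrite dn nth_iota // => vd; exists d => //; rewrite vd andbT leqNgt; apply/negP => kd.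
by have := before_find 0%N kd; rewrite nth_iota // vk.
Qed.

Section Limit.
Variables (R : realType) (m : nat) (p : R).
Hypotheses (p0 : 0 < p) (p1 : p <= 1).
Local Notation PR n := (Pr (@q R n m p)).
Local Notation N n := (n.+1%:R : R).

(** A heavy vertex has in-degree at least [n.+1 %/ 4], which is exponentially unlikely. *)
Lemma heavy_rare (eta : R) : 0 < eta -> exists n0, forall n, (n0 <= n)%N -> PR n (@heavy n m) <= eta.
Proof.
move=> eta0; have [z0 Hz] := expn_leq_exp2 2.
have [n1 H1] := above_all (16 * expR (m%:R : R) / eta).
exists (maxn n1 (maxn (4 * z0) (16 * m + 16))) => n; rewrite !geq_max => /and3P[n1n zn mn].
have N0 := N_gt0 R n; set z := (n.+1 %/ 4)%N.
have nz : (n.+1 < 4 * z.+1)%N by rewrite /z; clear; lia.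
have zz : (z0 <= z)%N by rewrite /z; move: zn; clear; lia.
apply: (@le_trans _ _ (PR n (fun w => ~~ low_indeg z w))).
  apply: Pr_le => [|w /existsP[u hu]]; first exact: q_ge0.
  apply/negP => /forallP/(_ u); move: hu; rewrite /load; move: (indeg w u) => d.
  by rewrite /z; move: mn; clear; lia.
apply: le_trans (@low_indeg_fail R n m p p0 p1 z) _.
have h2 : 0 < 2 ^+ z :> R by rewrite exprn_gt0.
have hz : z.+1%:R ^+ 2 <= 2 ^+ z :> R by rewrite -!natrX ler_nat; apply: Hz.
have hN : N n <= 4 * z.+1%:R by rewrite -natrM ler_nat ltnW.
have E0 : 0 < expR (m%:R : R) := expR_gt0 _.
rewrite ler_pdivrMr //; have := H1 n n1n; rewrite ler_pdivrMr // => h1.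
have h4 : N n ^+ 2 <= 16 * 2 ^+ z.
  apply: (@le_trans _ _ ((4 * z.+1%:R) ^+ 2)); first by apply: lerXn2r; rewrite ?nnegrE ?mulr_ge0.
  have -> : 16 = 4 ^+ 2 :> R by rewrite -natrX.
  by rewrite exprMn ler_wpM2l // exprn_ge0.
rewrite -(ler_pM2r N0) mulrAC -expr2.
apply: le_trans (ler_wpM2r (ltW E0) h4) _.
have := ler_wpM2r (ltW h2) h1; move: (expR _) (2 ^+ z) (N n) => a b c; lra.
Qed.

Definition far n (b : R) (f : R) (G : graph n) := [set uv : 'I_n * 'I_n |
  ~~ (if gdist G uv.1 uv.2 is Some d then `|f - d%:R| < b else false)].

Definition far_ratio n (b : R) (f : R) (G : graph n) : R := #|far b f G|%:R / (n * n)%:R.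

Lemma far_ratio01 n b f (G : graph n.+1) : 0 <= far_ratio b f G <= 1.
Proof.
rewrite /far_ratio divr_ge0 //= ler_pdivrMr ?ltr0n ?muln_gt0 // mul1r ler_nat.
by apply: leq_trans (max_card _) _; rewrite card_prod card_ord.
Qed.

Lemma prob_close_far (f : nat -> R) b n : (2 * m < n.+1)%N ->
  prob_close (WS_law m p) f b n.+1 = 1 - \sum_G WS_law m p G * far_ratio b (f n.+1) (G : graph n.+1).
Proof.
move=> mn; have tot : \sum_G WS_law m p (G : graph n.+1) = 1.
  rewrite -[RHS](run_cst (slots n m) (lattice n m) 1 (@ker_sum1 R n m p)).
  have := WS_run p mn (fun=> 1); rewrite (eq_bigr (fun G => WS_law m p G)) => [->//|G _].
  by rewrite mulr1.
apply/eqP; rewrite -tot eq_sym subr_eq /prob_close -big_split; apply/eqP/eq_bigr => G _ /=.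
rewrite -mulrDr /far_ratio -mulrDl -natrD.
set S := [set uv | _]; have -> : far b (f n.+1) G = ~: S by apply/setP => uv; rewrite /far !inE.
by rewrite cardsC card_prod card_ord mulfV ?mulr1 // pnatr_eq0 -lt0n muln_gt0.
Qed.

(** The bound [B.+1] makes the strict inequality mean a gap of at most [B]. When [t <= B] the
    truncated radius [t - B.+1] is 0, and the factor [(B < t)] removes this spurious ball. *)
Lemma far_le n (w : {ffun 'I_m * 'I_n.+1 -> 'I_n.+1}) t B : (t + B <= n)%N ->
  far_ratio (B.+1%:R) (t%:R) (Gr w) <= (N n ^+ 2)^-1 * \sum_(u : 'I_n.+1) \sum_(v : 'I_n.+1)
    ((v \notin ball (Gr w) (t + B) u)%:R + (B < t)%:R * (v \in ball (Gr w) (t - B.+1) u)%:R).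
Proof.
move=> tn; rewrite /far_ratio natrM -expr2 mulrC ler_wpM2l ?invr_ge0 ?exprn_ge0 //.
rewrite pair_bigA /= -sum1_card natr_sum big_mkcond; apply: ler_sum => -[u v] _ /=; rewrite inE /=.
case: (boolP (v \in ball (Gr w) (t + B) u)) => vt; last by case: ifP => _; [rewrite lerDl mulr_ge0 | rewrite addr_ge0 // mulr_ge0].
have [//|d -> /andP[dt vd]] := gdist_le _ vt.
case: ltP => /= far_d; rewrite add0r; first by rewrite mulr_ge0.
suff h : (d + B < t)%N.
  rewrite (leq_ltn_trans _ h) ?leq_addl // mul1r (_ : v \in _) //.
  by apply: (subsetP (ball_leq _ _ _)) vd; move: h; clear; lia.
rewrite ltnNge; apply/negP => td; move: far_d; rewrite leNgt ltr_norml; move/negP; apply.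
have h1 : d%:R <= t%:R + B%:R :> R by rewrite -natrD ler_nat.
have h2 : t%:R <= d%:R + B%:R :> R by rewrite -natrD ler_nat.
have h3 : B%:R < B.+1%:R :> R by rewrite ltr_nat.
by apply/andP; split; lra.
Qed.

Lemma far_rare n t B (eta : R) : 0 <= eta -> (t + B <= n)%N -> (1 - eta) * N n ^+ 2 <= close_mass m p n (t + B) ->
  (forall k, (k + B < t)%N -> close_mass m p n k <= eta * N n ^+ 2) ->
  Ex (@q R n m p) (fun w => far_ratio (B.+1%:R) (t%:R) (Gr w)) <= 2 * eta.
Proof.
move=> eta0 tn up low; have N0 := N_gt0 R n; have N2 : 0 < N n ^+ 2 by rewrite exprn_gt0.
apply: le_trans (Ex_le (q_ge0 p0 p1) (fun w => far_le w tn)) _.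
rewrite ExZ mulrC ler_pdivrMr // Ex_sum (eq_bigr _ (fun u _ => Ex_sum _ _ _)).
under eq_bigr do under eq_bigr do rewrite ExD ExZ.
under eq_bigr do rewrite big_split -mulr_sumr; rewrite big_split -mulr_sumr /=.
have -> : 2 * eta * N n ^+ 2 = eta * N n ^+ 2 + eta * N n ^+ 2 by lra.
apply: lerD.
  by have := close_mass_compl m p n (t + B); rewrite /Pr => <-; lra.
case: (ltnP B t) => Bt; rewrite ?mul1r ?mul0r.
  by apply: low; move: Bt; clear; lia.
by rewrite mulr_ge0 // ltW.
Qed.

End Limit.

Theorem theorem2 (R : realType) (m : nat) (p : R) :
  (1 <= m)%N -> 0 <= p -> p <= 1 -> 1 < p * m%:R ->
  strongly_idemetric (WS_law m p).
Proof.
move=> m1 p0' p1 pm1; have p0 : 0 < p.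
  by rewrite lt_neqAle p0' andbT; apply/eqP => pE; move: pm1; rewrite -pE mul0r ltr10.
(* Supplies the second slot index for links and for fresh slots along an orbit. *)
have m2 : (1 < m)%N.
  rewrite -(@ltr_nat R); apply: lt_le_trans pm1 _; by rewrite ler_piMl.
pose d0 := Ordinal m1; pose d1 := Ordinal m2.
have d01 : d0 != d1 by [].
(* The independent model lives on ['I_n.+1], whence the predecessor. *)
exists (fun n => (typical m p n.-1)%:R) => eps eps0.
have [K KE] : {K | K = expR (2 * m%:R * (1 + 3 * m%:R)) :> R} by exists (expR (2 * m%:R * (1 + 3 * m%:R))).
have K0 : 0 < K by rewrite KE expR_gt0.
(* Far pairs cost [2 * eta] and heavy configurations [eta]; the factor 4 instead of 3 yields the
   strict inequality. *)
have [eta [eta0 eta1 eK]] : exists eta : R, [/\ 0 < eta, eta <= 1 & eta * (4 * K) <= eps].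
  have e0 : 0 < eps / (4 * K) by rewrite divr_gt0 // mulr_gt0.
  exists (Num.min 1 (eps / (4 * K))); split; first by rewrite lt_min ltr01.
    by rewrite ge_min lexx.
  by rewrite -ler_pdivlMr ?mulr_gt0 // ge_min lexx orbT.
have [B [n1 H1]] := concentration p0 p1 (erefl : d0 = 0%N :> nat) d01 pm1 eta0 eta1.
have [n2 H2] := heavy_rare m p0 p1 eta0.
exists B.+1%:R, (maxn n1 (maxn n2 (2 * m))).+1 => -[//|n]; rewrite ltnS !geq_max => /and3P[n1n n2n mn].
have [tn up low] := H1 n n1n; rewrite prob_close_far //.
have C := contiguity p0 p1 mn (@far_ratio01 R n B.+1%:R (typical m p n)%:R).
have F := far_rare p0 p1 (ltW eta0) tn up low.
rewrite -KE in C.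
have : K * (Ex (q p) (far_ratio B.+1%:R (typical m p n)%:R \o @Gr n m) + Pr (q p) (@heavy n m)) <= K * (2 * eta + eta).
  by rewrite ler_wpM2l ?(ltW K0) // lerD // H2.
have : 0 < eta * K by rewrite mulr_gt0.
move: C => /=; lra.
Qed.
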